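(* Let $p\in(1,\infty)$, let $q\in(1,\infty)$ satisfy $p^{-1}+q^{-1}=1$, and let $E$ be a separable real Banach space. Let $F\colon I\times E\multimap E$ be a set-valued map with convex values such that: (H1) the set $F(t,x)$ is nonempty, closed and bounded for every $(t,x)\in I\times E$; (H2) the map $F(\cdot,x)$ is $\Sigma$-measurable for every $x\in E$; (H3) there exists $\alpha\in L^p(I,\mathbb{R})$ such that $d_H(F(t,x),F(t,y))\leqslant\alpha(t)|x-y|$ for all $x,y\in E$, a.e. in $I$; (H4) there exists $\beta\in L^p(I,\mathbb{R})$ such that $d(0,F(t,0))\leqslant\beta(t)$ a.e. in $I$. Let $k\colon\triangle\to\mathcal{L}(E)$ be such that: (k5) $k(t,\cdot)\in L^q([0,t],\mathcal{L}(E))$ for every $t\in I$; (k6) the function $I\ni t\mapsto k(t,\cdot)\in L^q([0,t],\mathcal{L}(E))$ is continuous in the norm $\|\cdot\|_q$ of the space $L^q(I,\mathcal{L}(E))$. Then for every $h\in C(I,E)$ the set $$\mathcal{S}_F^p(h)=\left\{w\in L^p(I,E)\colon w(t)\in F\left(t,h(t)+\int_0^tk(t,s)w(s)\,ds\right)\text{ for a.a. }t\in I\right\}$$ is an absolute retract.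
   Context: $I=[0,T]$, $\triangle=\{(t,s)\in I\times I\colon 0\leqslant s\leqslant t\leqslant T\}$, $\Sigma$ is the $\sigma$-algebra of Lebesgue measurable subsets of $I$. $E$ has norm $|\cdot|$; $\mathcal{L}(E)$ is the space of bounded linear endomorphisms of $E$ with the operator norm. $C(I,E)$ carries the maximum norm; $L^p(I,E)$ is the space of Bochner $p$-integrable maps with its usual norm, and $\mathcal{S}_F^p(h)$ has the induced metric topology. $d(x,A)=\inf\{|x-y|\colon y\in A\}$ and $d_H(A,B)=\max\{\sup_{x\in A}d(x,B),\sup_{y\in B}d(y,A)\}$ is the Hausdorff distance. A set-valued map $G\colon I\multimap E$ is $\Sigma$-measurable if $\{t\in I\colon G(t)\subset C\}\in\Sigma$ for every open $C\subset E$. In (k6), $k(t,\cdot)$ is regarded as an element of $L^q(I,\mathcal{L}(E))$ by extending it by $0$ outside $[0,t]$. ''Absolute retract'' (AR) is meant in the class of metrizable spaces. *)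

(* Defs.v *)
From HB Require Import structures.
From mathcomp Require Import all_boot all_order all_algebra.
From mathcomp Require Import all_classical all_reals all_analysis.
From mathcomp Require Import measurable_realfun.

Set Implicit Arguments.
Unset Strict Implicit.
Unset Printing Implicit Defensive.
Import Order.TTheory GRing.Theory Num.Theory.
Import numFieldNormedType.Exports.
Local Open Scope classical_set_scope.
Local Open Scope ring_scope.

Section bounded_endomorphisms.
Context {R : realType} (E : normedModType R).

Definition bounded_linear : {pred E -> E} :=
  [pred f : E -> E | `[< linear f /\ exists M, forall x, `|f x| <= M * `|x| >]].

Lemma bounded_linearP (f : E -> E) : reflect
  (linear f /\ exists M, forall x, `|f x| <= M * `|x|) (f \in bounded_linear).
Proof. exact: asboolP. Qed.

Lemma bounded_linear_submod_closed : submod_closed bounded_linear.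
Proof.
split.
  apply/bounded_linearP; split.
    by move=> a u v; rewrite /= /GRing.zero /= scaler0 addr0.
  by exists 0 => x; rewrite [X in `|X|](_ : _ = 0)// normr0 mul0r.
move=> a f g /bounded_linearP[lf [M fM]] /bounded_linearP[lg [N gN]].
apply/bounded_linearP; split=> [b u v|].
  rewrite -[LHS]/(a *: f (b *: u + v) + g (b *: u + v)).
  rewrite -[RHS]/(b *: (a *: f u + g u) + (a *: f v + g v)).
  by rewrite lf lg !scalerDr !scalerA [a * b]mulrC addrACA.
exists (`|a| * M + N) => x; rewrite -[X in `|X|]/(a *: f x + g x).
rewrite (le_trans (ler_normD _ _))// mulrDl lerD// normrZ -mulrA.
by rewrite ler_wpM2l.
Qed.

HB.instance Definition _ := GRing.isSubmodClosed.Build R (E -> E)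
  bounded_linear bounded_linear_submod_closed.

Record endoL := EndoL { endoL_fun :> E -> E; _ : endoL_fun \in bounded_linear }.

HB.instance Definition _ := [isSub for endoL_fun].
HB.instance Definition _ := [Choice of endoL by <:].
HB.instance Definition _ := [SubChoice_isSubLmodule of endoL by <:].

Lemma endoL_is_linear (f : endoL) : linear f.
Proof. by case: f => f fP; have /bounded_linearP[] := fP. Qed.

HB.instance Definition _ (f : endoL) :=
  GRing.isLinear.Build R E E _ f (endoL_is_linear f).

Lemma endoL_bounded (f : endoL) : exists M, forall x, `|f x| <= M * `|x|.
Proof. by case: f => f fP; have /bounded_linearP[] := fP. Qed.

Definition opnorm (f : endoL) : R :=
  sup [set `|f x| | x in [set x : E | `|x| <= 1]].

Lemma opnorm_has_sup (f : endoL) :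
  has_sup [set `|f x| | x in [set x : E | `|x| <= 1]].
Proof.
split; first by exists `|f 0|, 0 => //=; rewrite normr0.
have [M fM] := endoL_bounded f.
exists `|M| => _ [x /= x1 <-]; rewrite (le_trans (fM x))//.
rewrite (le_trans (ler_norm _))// normrM normr_id.
by rewrite -[leRHS]mulr1 ler_wpM2l.
Qed.

Lemma opnorm_ub (f : endoL) x : `|x| <= 1 -> `|f x| <= opnorm f.
Proof.
by move=> x1; apply: ub_le_sup; [exact: (opnorm_has_sup f).2|exists x].
Qed.

Lemma opnorm_lub (f : endoL) M : (forall x, `|x| <= 1 -> `|f x| <= M) ->
  opnorm f <= M.
Proof.
move=> fM; apply: ge_sup; first exact: (opnorm_has_sup f).1.
by move=> _ [x /= x1 <-]; exact: fM.
Qed.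

Let opnormD (f g : endoL) : opnorm (f + g) <= opnorm f + opnorm g.
Proof.
apply: opnorm_lub => x x1; rewrite -[X in `|X|]/(f x + g x).
by rewrite (le_trans (ler_normD _ _))// lerD// opnorm_ub.
Qed.

Let opnormZ_le (a : R) (f : endoL) : opnorm (a *: f) <= `|a| * opnorm f.
Proof.
apply: opnorm_lub => x x1; rewrite -[X in `|X|]/(a *: f x) normrZ.
by rewrite ler_wpM2l// opnorm_ub.
Qed.

Let opnormZ (a : R) (f : endoL) : opnorm (a *: f) = `|a| * opnorm f.
Proof.
apply/eqP; rewrite eq_le opnormZ_le/=.
have [->|a0] := eqVneq a 0.
  rewrite normr0 mul0r (le_trans (normr_ge0 ((0 *: f : endoL) 0)))//.
  by rewrite opnorm_ub// normr0.
rewrite -ler_pdivlMl ?normr_gt0// -normfV.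
by rewrite -[in leLHS](scalerK a0 f) opnormZ_le.
Qed.

Let opnorm0_eq0 (f : endoL) : opnorm f = 0 -> f = 0.
Proof.
move=> f0; apply/val_inj/funext => x; rewrite /= -[RHS]/(0 : E).
have [->|x0] := eqVneq x 0; first exact: linear0.
have nx0 : `|x| != 0 by rewrite normr_eq0.
have : `|f (`|x|^-1 *: x)| <= 0.
  by rewrite -f0 opnorm_ub// normrZ normfV normr_id mulVf.
by rewrite linearZ normr_le0 scaler_eq0 invr_eq0 (negPf nx0) => /eqP.
Qed.

HB.instance Definition _ :=
  Lmodule_isNormed.Build R endoL opnormD opnormZ opnorm0_eq0.

End bounded_endomorphisms.

(* The real line with its Lebesgue measurable (not just Borel) subsets, and the
   complete Lebesgue measure on it. *)
Notation lebR R :=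
  (caratheodory_type (R := R) (wlength (R := R) idfun)^*%mu).
Notation lebesgueR R := (@completed_lebesgue_measure R).

Section bochner.
Context {R : realType} (V : normedModType R).
Implicit Types (D : set (lebR R)) (f : R -> V).

Definition simple_function (s : R -> V) :=
  finite_set (range s) /\
  forall v, measurable (s @^-1` [set v] : set (lebR R)).

Definition strongly_measurable D f := exists s : (R -> V)^nat,
  (forall n, simple_function (s n)) /\
  {ae lebesgueR R, forall t, D t -> s n t @[n --> \oo] --> f t}.

Definition simple_integral D (s : R -> V) : V :=
  \sum_(v \in range s) fine (lebesgueR R (D `&` s @^-1` [set v])) *: v.

Definition is_bochner_integral D f (v : V) :=
  strongly_measurable D f /\
  exists s : (R -> V)^nat,
    [/\ forall n, simple_function (s n),
        forall n u, u != 0 -> (lebesgueR R (D `&` s n @^-1` [set u]) < +oo)%E,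
        (\int[lebesgueR R]_(t in D) (`|f t - s n t|%:E))%E @[n --> \oo] --> 0%E
      & simple_integral D (s n) @[n --> \oo] --> v].

(* The value 0 is a default for maps that are not Bochner integrable on [D]. *)
Definition bochner_integral D f : V := xget 0 [set v | is_bochner_integral D f v].

(* [\_ D] extends by 0 outside [D]: this is (\int_D |f|^p)^(1/p). *)
Definition bochner_norm D (p : R) f : \bar R :=
  'N[lebesgueR R]_(p%:E)[EFin \o ((fun t => `|f t|) \_ D)].

Definition Lp_fun D (p : R) : set (R -> V) :=
  [set f | strongly_measurable D f /\ (bochner_norm D p f < +oo)%E].
End bochner.

Section bochner_measurability.
Context {R : realType} {V : normedModType R}.
Implicit Types (D : set (lebR R)) (f : R -> V).

Lemma simple_functionB (s r : R -> V) :
  simple_function s -> simple_function r ->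
  simple_function (fun t => s t - r t).
Proof.
move=> [fs ms] [fr mr]; split.
  apply: sub_finite_set (finite_image2 (fun a b => a - b) fs fr).
  by move=> _ [t _ <-] /=; exists (s t); [exists t|exists (r t) => //; exists t].
move=> v; rewrite (_ : _ @^-1` _ = \bigcup_(a in range s)
    (s @^-1` [set a] `&` r @^-1` [set a - v])); last first.
  apply/seteqP; split=> [t /= <-|t [_ [u _ <-]] /= [-> ->]].
    by exists (s t); [exists t|split=> //=; rewrite opprB addrCA subrr addr0].
  by rewrite opprB addrCA subrr addr0.
by apply: fin_bigcup_measurable => // a _; exact: measurableI.
Qed.

Lemma strongly_measurableB D f g : strongly_measurable D f ->
  strongly_measurable D g -> strongly_measurable D (fun t => f t - g t).
Proof.
move=> [s [ss sf]] [r [sr rg]]; exists (fun n t => s n t - r n t); split.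
  by move=> n; exact: simple_functionB.
by apply: filterS2 sf rg => t sf rg Dt; apply: cvgB; [exact: sf|exact: rg].
Qed.

Lemma measurable_norm_simple_function (s : R -> V) : simple_function s ->
  measurable_fun (setT : set (lebR R)) (fun t => `|s t|).
Proof.
move=> [fs ms] _ B mB; rewrite setTI.
rewrite (_ : _ @^-1` _ = \bigcup_(a in range s `&` [set a | B `|a|])
    s @^-1` [set a]); last first.
  apply/seteqP; split=> [t /= Bt|t [a [_ Ba] /= ->]] //.
  by exists (s t) => //; split=> //; exists t.
by apply: fin_bigcup_measurable => //; exact: finite_setIl.
Qed.

(* This is where completeness of the measure is used. *)
Lemma measurable_norm_strongly_measurable D f :
  measurable D -> strongly_measurable D f ->
  measurable_fun (setT : set (lebR R)) ((fun t => `|f t|) \_ D).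
Proof.
move=> mD [s [ss [N [mN N0 sfN]]]].
have mDN : measurable (D `\` N) by exact: measurableD.
pose g : lebR R -> R := (fun t => `|f t|) \_ (D `\` N).
apply/measurable_EFinP.
apply: (@ae_measurable_fun _ _ _ (lebesgueR R)
  completed_lebesgue_measure_is_complete setT (EFin \o g)).
  exists N; split=> // t /= /not_implyP[_ gt]; apply: contrapT => Nt; apply: gt.
  congr EFin; rewrite /g !patchE (_ : (t \in D `\` N) = (t \in D))//.
  by apply/idP/idP; rewrite !inE; [case|].
apply/measurable_EFinP.
apply: (@measurable_fun_cvg _ _ _ _ (fun n => (fun t => `|s n t|) \_ (D `\` N))).
  move=> n; apply/(measurable_restrictT _ mDN).
  exact: measurable_funS (measurable_norm_simple_function (ss n)).
move=> t _; rewrite /g patchE; case: ifPn => DNt.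
  rewrite (_ : (fun n => _) = fun n => `|s n t|); last first.
    by apply/funext => n; rewrite patchE DNt.
  apply: cvg_norm; move: DNt; rewrite inE => -[Dt Nt].
  by apply: contrapT => st; apply/Nt/sfN => /(_ Dt).
rewrite (_ : (fun n => _) = fun n => 0); first exact: cvg_cst.
by apply/funext => n; rewrite patchE (negPf DNt).
Qed.

End bochner_measurability.

Lemma ler_Lnorm d (X : measurableType d) (R : realType)
    (mu : {measure set X -> \bar R}) (p : R) (f g : X -> R) : 1 <= p ->
  measurable_fun setT f -> measurable_fun setT g ->
  (forall x, 0 <= f x <= g x) ->
  ('N[mu]_(p%:E)[EFin \o f] <= 'N[mu]_(p%:E)[EFin \o g])%E.
Proof.
move=> p1 mf mg fg; have p0 : 0 <= p by rewrite (le_trans _ p1).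
have mpow h : measurable_fun setT (h : X -> R) ->
    measurable_fun setT (fun x => (`|h x| `^ p)%:E).
  move=> mh; apply/measurable_EFinP.
  apply: (@measurableT_comp _ _ _ _ _ _ (fun y : R => y `^ p) _
    (fun x => `|h x|)); first exact: measurable_powR.
  exact: measurableT_comp.
rewrite unlock; apply: gt0_ler_poweR.
- by rewrite invr_ge0.
- by rewrite in_itv/= leey andbT integral_ge0// => t _; exact: poweR_ge0.
- by rewrite in_itv/= leey andbT integral_ge0// => t _; exact: poweR_ge0.
apply: ge0_le_integral.
- exact: measurableT.
- by move=> x _; exact: poweR_ge0.
- exact: mpow.
- exact: mpow.
move=> x _; have /andP[f0 fgx] := fg x.
rewrite lee_fin ge0_ler_powR ?nnegrE// !ger0_norm//.
exact: le_trans fgx.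
Qed.

Section bochner_norm_theory.
Context {R : realType} {V : normedModType R}.
Implicit Types (D : set (lebR R)) (p : R) (f g h : R -> V).

Lemma bochner_norm_triangle D p f g h : measurable D -> 1 <= p ->
  strongly_measurable D f -> strongly_measurable D g ->
  strongly_measurable D h ->
  (bochner_norm D p (fun t => f t - h t)%R <=
   bochner_norm D p (fun t => f t - g t)%R +
   bochner_norm D p (fun t => g t - h t)%R)%E.
Proof.
move=> mD p1 mf mg mh.
have mB u v : strongly_measurable D (u : R -> V) -> strongly_measurable D v ->
    measurable_fun (setT : set (lebR R)) ((fun t => `|u t - v t|) \_ D).
  move=> mu mv; apply: measurable_norm_strongly_measurable => //.
  exact: strongly_measurableB.
have p1E : (1 <= p%:E)%E by rewrite lee_fin.
apply: (le_trans _ (@eminkowski _ _ _ (lebesgueR R) _ _ p%:E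
  (mB _ _ mf mg) (mB _ _ mg mh) p1E)).
apply: (@ler_Lnorm _ _ _ (lebesgueR R) p) p1 (mB _ _ mf mh) _ _.
  by apply: measurable_funD; exact: mB.
move=> t; rewrite /= !patchE; case: ifPn => _; last by rewrite addr0 lexx.
by rewrite normr_ge0 ler_distD.
Qed.

Lemma bochner_normC D p f g :
  bochner_norm D p (fun t => f t - g t) = bochner_norm D p (fun t => g t - f t).
Proof.
rewrite /bochner_norm; congr Lnorm; apply/funext => t /=.
by rewrite !patchE distrC.
Qed.

Lemma eq_bochner_norm0 D p f : 1 <= p ->
  (forall t, f t = 0) -> bochner_norm D p f = 0%E.
Proof.
move=> p1 f0; rewrite /bochner_norm (_ : EFin \o _ = cst 0%E) ?Lnorm0//.
  by rewrite eqe gt_eqF// (lt_le_trans _ p1).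
by apply/funext => t /=; rewrite patchE f0 normr0 if_same.
Qed.

Lemma bochner_norm_eq0 D p f : measurable D -> 1 <= p ->
  strongly_measurable D f -> bochner_norm D p f = 0%E ->
  {ae lebesgueR R, forall t, D t -> f t = 0}.
Proof.
move=> mD p1 mf /Lnorm_eq0_eq0.
have p0 : (0 < p%:E)%E by rewrite lte_fin (lt_le_trans _ p1).
move=> /(_ _ p0) H; apply: filterS (H _).
  move=> t /(_ Logic.I) [] /=; rewrite patchE => ft Dt; apply/normr0_eq0.
  by move: ft; rewrite mem_set.
by apply/measurable_EFinP; exact: measurable_norm_strongly_measurable.
Qed.

Lemma bochner_norm_ge0 D p f : (0 <= bochner_norm D p f)%E.
Proof. exact: Lnorm_ge0. Qed.

Lemma strongly_measurable0 D : strongly_measurable D (cst 0 : R -> V).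
Proof.
exists (fun=> cst 0); split=> [_|]; last first.
  by apply: nearW => t _; exact: cvg_cst.
split=> [|v]; first exact: finite_image_cst.
by rewrite preimage_cst; case: ifP.
Qed.

Lemma Lp_fun0 D p : 1 <= p -> Lp_fun D p (cst 0 : R -> V).
Proof.
by move=> p1; split; [exact: strongly_measurable0|rewrite eq_bochner_norm0].
Qed.

End bochner_norm_theory.

(* The space L^p([a, b], V): classes of Bochner p-integrable maps modulo
   equality almost everywhere on [a, b]. Maps are defined on the whole line, but
   only their values on [a, b] matter. *)
Section Lp_space.
Context {R : realType} (a b p : R) (p1 : 1 <= p) (V : normedModType R).
Local Notation I := (`[a, b]%classic : set (lebR R)).

Definition Lp_map : Type := {f : R -> V | f \in Lp_fun I p}.
HB.instance Definition _ := Choice.on Lp_map.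
HB.instance Definition _ := SubType.on Lp_map.

Definition Lp_eq (f g : Lp_map) : bool :=
  `[< {ae lebesgueR R, forall t, I t -> val f t = val g t} >].

Lemma Lp_eq_refl : reflexive Lp_eq.
Proof. by move=> f; apply/asboolP; exact: nearW. Qed.

Lemma Lp_eq_sym : symmetric Lp_eq.
Proof.
by move=> f g; apply/asboolP/asboolP; apply: filterS => t fg It; rewrite fg.
Qed.

Lemma Lp_eq_trans : transitive Lp_eq.
Proof.
move=> g f h /asboolP fg /asboolP gh; apply/asboolP.
by apply: filterS2 fg gh => t fg gh It; rewrite fg// gh.
Qed.

Canonical Lp_eq_canonical := EquivRel Lp_eq Lp_eq_refl Lp_eq_sym Lp_eq_trans.

Local Open Scope quotient_scope.

(* [p1] is recorded in the type for the sake of the metric structure below. *)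
Definition Lp_space of 1 <= p : Type := {eq_quot Lp_eq}.
Local Notation Lp := (Lp_space p1).
HB.instance Definition _ := Choice.on Lp.
HB.instance Definition _ := EqQuotient.on Lp.

Definition Lp_repr (w : Lp) : R -> V := val (repr w : Lp_map).

Lemma Lp_reprP (w : Lp) : Lp_fun I p (Lp_repr w).
Proof. exact: set_mem (valP (repr w : Lp_map)). Qed.

(* The class of [f], and by default the class of 0 if [f] is not in L^p. *)
Definition Lp_class (f : R -> V) : Lp :=
  \pi_Lp (insubd (exist _ (cst 0) (mem_set (Lp_fun0 I p1)) : Lp_map) f).

Definition Lp_dist (v w : Lp) : R :=
  fine (bochner_norm I p (fun t => Lp_repr v t - Lp_repr w t)).

Lemma measurable_cc : measurable I.
Proof. by apply: sub_caratheodory; exact: measurable_itv. Qed.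

Let Lp_dist_fin (v w : Lp) :
  bochner_norm I p (fun t => Lp_repr v t - Lp_repr w t) \is a fin_num.
Proof.
rewrite ge0_fin_numE ?bochner_norm_ge0//.
have [mv vp] := Lp_reprP v; have [mw wp] := Lp_reprP w.
have m0 : strongly_measurable I (cst 0 : R -> V) := strongly_measurable0 _.
have sub0 (f : R -> V) : (fun t => f t - (cst 0 : R -> V) t) = f.
  by apply/funext => t; rewrite /= subr0.
apply: le_lt_trans (bochner_norm_triangle measurable_cc p1 mv m0 mw) _.
by rewrite [X in (_ + X)%E]bochner_normC !sub0 lte_add_pinfty.
Qed.

Let Lp_distxx v : Lp_dist v v = 0.
Proof. by rewrite /Lp_dist eq_bochner_norm0// => t; rewrite subrr. Qed.

Let Lp_dist_eq0 v w : Lp_dist v w = 0 -> v = w.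
Proof.
move=> vw0; have : bochner_norm I p (fun t => Lp_repr v t - Lp_repr w t) = 0%E.
  by rewrite -(fineK (Lp_dist_fin v w)) -/(Lp_dist v w) vw0.
have [mv _] := Lp_reprP v; have [mw _] := Lp_reprP w.
move=> /(bochner_norm_eq0 measurable_cc p1 (strongly_measurableB mv mw)) vw.
rewrite -[v]reprK -[w]reprK; apply/eqmodP/asboolP.
by apply: filterS vw => t vw It; apply/eqP; rewrite -subr_eq0; exact/eqP/vw.
Qed.

Let Lp_distC v w : Lp_dist v w = Lp_dist w v.
Proof. by rewrite /Lp_dist bochner_normC. Qed.

Let Lp_dist_triangle w v u : Lp_dist v u <= Lp_dist v w + Lp_dist w u.
Proof.
have [mv _] := Lp_reprP v; have [mw _] := Lp_reprP w.
have [mu _] := Lp_reprP u; rewrite -lee_fin EFinD !fineK//.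
exact: (bochner_norm_triangle measurable_cc p1).
Qed.

HB.instance Definition _ :=
  isMetric.Build R Lp Lp_distxx Lp_dist_eq0 Lp_distC Lp_dist_triangle.

End Lp_space.

Section set_distances.
Context {R : realType} {E : normedModType R}.

Definition dist_set (x : E) (A : set E) : \bar R :=
  ereal_inf [set `|x - y|%:E | y in A].

Definition hausdorff_dist (A B : set E) : \bar R :=
  maxe (ereal_sup [set dist_set x B | x in A])
       (ereal_sup [set dist_set y A | y in B]).

End set_distances.

Definition separable (X : topologicalType) :=
  exists2 A : set X, countable A & dense A.

Section absolute_retracts.

Definition closed_embedding {X Y : topologicalType} (i : X -> Y) :=
  [/\ injective i, continuous i,
      forall U, open U -> exists2 W, open W & U = i @^-1` W
    & closed (range i)].

Definition retract {Y : topologicalType} (A : set Y) :=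
  exists r : Y -> Y, [/\ continuous r, forall y, A (r y)
                       & forall y, A y -> r y = y].

(* Absolute retracts for metrizable spaces: a subset [A] of a metric space, with
   the induced topology, is a retract of every metrizable space in which it is
   embedded as a closed subset. As the singleton space is among these, the empty
   set is not an absolute retract. *)
Definition absolute_retract {R : realType} {M : metricType R} (A : set M) :=
  forall (Y : metricType R) (i : set_type A -> Y),
    closed_embedding i -> retract (range i).

End absolute_retracts.

Section integral_inclusion.
Context {R : realType} {E : normedModType R}.

(* [k t] on [0, t], extended by 0. *)
Definition kernel_ext (k : R -> R -> endoL E) (t s : R) : endoL E :=
  if s \in `[0, t] then k t s else 0.

Definition solution_set (T p : R) (p1 : 1 <= p) (F : R -> E -> set E)
    (k : R -> R -> endoL E) (h : R -> E) : set (Lp_space 0 T E p1) :=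
  [set w | {ae lebesgueR R, forall t, t \in `[0, T] ->
    F t (h t + bochner_integral `[0, t]%classic (fun s => k t s (Lp_repr w s)))
      (Lp_repr w t)}].

End integral_inclusion.
Arguments solution_set {R E} T {p} p1 F k h _.

(* Main.v *)
(** Let [Phi u t = h t + \int_0^t k(t, s) u(s) ds] and let [rho u v] be the norm
of [t |-> d(v t, F(t, Phi u t))], so that the solutions are the zeros of
[u |-> rho u u]. As [Phi] is causal, a Bielecki-type norm of L^p, giving
geometrically decreasing weights to successive short intervals, makes
[rho u v] Lipschitz in [u] with a small constant; moreover [rho u v] is convex
and 1-Lipschitz in [v], and an approximate measurable selection gives [v] with
[rho u v < rho u u / 2] and [|v - u| < 2 rho u u]. For a continuous [f] from a
metric space to L^p, a partition of unity turns such choices into a continuous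
[g] with the same bounds, so [rho (g y) (g y) <= 3/4 rho (f y) (f y)], and [g]
agrees with [f] where [f] already takes solutions as values. Iterating gives a
continuous map into the solution set; starting from a Dugundji extension of the
inverse of a closed embedding of the solution set, it yields the retraction. *)

From HB Require Import structures.
Require Import Defs.
From mathcomp Require Import finmap.
From mathcomp Require Import all_boot all_order all_algebra.
From mathcomp Require Import all_classical all_reals all_analysis.
From mathcomp Require Import measurable_realfun.
From mathcomp Require Import ring lra.
Set Implicit Arguments.
Unset Strict Implicit.
Unset Printing Implicit Defensive.
Import Order.TTheory GRing.Theory Num.Theory.
Import numFieldNormedType.Exports.
Local Open Scope classical_set_scope.
Local Open Scope ring_scope.

(** * Continuous extension to fixed points *)

(** The rate [3/4] is [1/2 + 2/8]: the selection halves the defect, and moving the first argument by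
    at most twice the defect costs an eighth of that. The eighth cannot come from the data, since
    [alpha] and the kernel may be large. It comes from cutting [[0, T]] so finely that [alpha] has
    small norm on each piece; the weights keep the resulting constant independent of the number of
    pieces.

    The partition of unity rests on separability of [L^p]: the candidates [v] are taken from one
    fixed dense sequence, so countably many weights suffice, each an explicit continuous function
    that is positive exactly where its candidate passes. For this the requirements on [v] have to be
    strict inequalities, stable under small changes, and this is why approximate selections are the
    right notion. Convexity of [rho] in [v] then lets the candidates be averaged without losing the
    bounds.

    The abstract part knows only a seminorm [N] and a function [rho]; points at [N]-distance 0 are
    never told apart there, and equality is recovered only after passing to classes. *)

Definition seminorm {R : realType} {X : lmodType R} (N : X -> R) :=
  (forall x y, N (x + y) <= N x + N y) /\ (forall a x, N (a *: x) = `|a| * N x).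

Section seminorm_theory.
Context {R : realType} {X : lmodType R} (N : X -> R) (sN : seminorm N).

Lemma seminorm0 : N 0 = 0.
Proof. by have := sN.2 0 0; rewrite scaler0 normr0 mul0r. Qed.

Lemma seminormN x : N (- x) = N x.
Proof. by rewrite -scaleN1r sN.2 normrN1 mul1r. Qed.

Lemma seminorm_ge0 x : 0 <= N x.
Proof.
have := sN.1 x (- x); rewrite subrr seminorm0 seminormN => ?; lra.
Qed.

Lemma seminormC x y : N (x - y) = N (y - x).
Proof. by rewrite -seminormN opprB. Qed.

Lemma seminorm_triangle y x z : N (x - z) <= N (x - y) + N (y - z).
Proof. by rewrite -[x - z](subrKA y) sN.1. Qed.

Lemma seminorm_sum n (v : nat -> X) : N (\sum_(j < n) v j) <= \sum_(j < n) N (v j).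
Proof.
elim: n => [|n IH]; first by rewrite !big_ord0 seminorm0.
by rewrite !big_ord_recr/= (le_trans (sN.1 _ _))// lerD2r.
Qed.

Lemma seminorm_ball_convex x r a u v : 0 <= a <= 1 ->
  N (u - x) <= r -> N (v - x) <= r -> N (a *: u + (1 - a) *: v - x) <= r.
Proof.
move=> /andP[a0 a1] ur vr.
have -> : a *: u + (1 - a) *: v - x = a *: (u - x) + (1 - a) *: (v - x).
  rewrite !scalerBr addrACA; congr (_ + _).
  by rewrite -opprD -scalerDl addrC subrK scale1r.
rewrite (le_trans (sN.1 _ _))// !sN.2 !ger0_norm ?subr_ge0//.
have : a * N (u - x) <= a * r by rewrite ler_wpM2l.
have : (1 - a) * N (v - x) <= (1 - a) * r by rewrite ler_wpM2l// subr_ge0.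
by move=> ? ?; lra.
Qed.

End seminorm_theory.

(** Peel off the last term and renormalise the others by their sum. [P (v j)] is asked only where
    the weight is positive, because in a partition of unity nothing is known about the other
    points. *)
Lemma convex_combination {R : realType} {X : lmodType R} (P : X -> Prop) n
    (w : nat -> R) (v : nat -> X) :
  (forall a x y, 0 <= a <= 1 -> P x -> P y -> P (a *: x + (1 - a) *: y)) ->
  (forall j, 0 <= w j) -> \sum_(j < n) w j = 1 ->
  (forall j, 0 < w j -> P (v j)) -> P (\sum_(j < n) w j *: v j).
Proof.
move=> cP; elim: n w => [|n IH] w w0 w1 Pv.
  by move: w1; rewrite big_ord0 => /eqP; rewrite eq_sym oner_eq0.
rewrite big_ord_recr/=; move: w1; rewrite big_ord_recr/=.
set s := \sum_(j < n) w j => sw.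
have s0 : 0 <= s by exact: sumr_ge0.
have [se|sn0] := eqVneq s 0.
  have wn : w n = 1 by rewrite -sw se add0r.
  rewrite big1; first by rewrite add0r wn scale1r; apply: Pv; rewrite wn.
  move=> j _; have /psumr_eq0P := se.
  by move=> H; rewrite H// scale0r.
have sgt : 0 < s by rewrite lt_neqAle eq_sym sn0.
have IHs : P (\sum_(j < n) (w j / s) *: v j).
  apply: (IH (fun j => w j / s)).
  - by move=> j; rewrite divr_ge0.
  - by rewrite -mulr_suml divff.
  - by move=> j; rewrite pmulr_lgt0 ?invr_gt0//; exact: Pv.
have -> : \sum_(j < n) w j *: v j = s *: \sum_(j < n) (w j / s) *: v j.
  rewrite scaler_sumr; apply: eq_bigr => j _.
  by rewrite scalerA mulrC divfK.
have [wn0|wn0] := eqVneq (w n) 0.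
  rewrite wn0 scale0r addr0.
  have s1 : s = 1 by rewrite -sw wn0 addr0.
  by move: IHs; rewrite s1 scale1r.
have -> : w n = 1 - s by rewrite -sw [s + _]addrC addrK.
apply: cP => //; last by apply: Pv; rewrite lt_neqAle eq_sym wn0 w0.
by rewrite s0/= -sw lerDl w0.
Qed.

Lemma cvg_sum_ord {R : realType} {T : Type} (G : set_system T) {FG : Filter G} n
    (f : nat -> T -> R) (l : nat -> R) :
  (forall j, f j z @[z --> G] --> l j) ->
  \sum_(j < n) f j z @[z --> G] --> \sum_(j < n) l j.
Proof.
move=> fl; apply: (@cvg_big _ _ +%R 0 xpredT _ _ G _ (fun (j : 'I_n) z => f j z)).
  exact: add_continuous.
by move=> j _; exact: fl.
Qed.

Section continuous_combinations.
Context {R : realType} {X : lmodType R} (N : X -> R) (sN : seminorm N).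
Context {Y : topologicalType}.

Definition scontinuous_at (f : Y -> X) (y : Y) :=
  forall eps, 0 < eps -> \forall z \near y, N (f z - f y) < eps.

(* Rudin's trick: subtracting [j] times the previous functions makes the family
   locally finite without any appeal to paracompactness. *)
Let psi (phi : nat -> Y -> R) j y :=
  Num.max 0 (phi j y - j%:R * \sum_(i < j) phi i y).

(** Claims are made only on the open set where some [phi j] is positive. Quantifying over convex
    predicates [P] means that any convex bound shared by the points [e j] active at [y] passes to
    [f y]. *)
Lemma continuous_combination (phi : nat -> Y -> R) (e : nat -> X) :
  (forall j, continuous (phi j)) -> (forall j y, 0 <= phi j y <= 1) ->
  exists f : Y -> X,
    (forall y, (exists j, 0 < phi j y) -> scontinuous_at f y) /\
    (forall y, (exists j, 0 < phi j y) -> forall P : X -> Prop,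
       (forall a x z, 0 <= a <= 1 -> P x -> P z -> P (a *: x + (1 - a) *: z)) ->
       (forall j, 0 < phi j y -> P (e j)) -> P (f y)).
Proof.
move=> cphi phi01.
pose ps := psi phi.
have ps0 j y : 0 <= ps j y by rewrite /ps /psi le_max lexx.
have sum0 j y : 0 <= \sum_(i < j) phi i y.
  by apply: sumr_ge0 => i _; have /andP[] := phi01 i y.
have ps_phi j y : 0 < ps j y -> 0 < phi j y.
  rewrite /ps /psi lt_max ltxx/= subr_gt0; apply: le_lt_trans.
  by apply: mulr_ge0; [exact: ler0n|exact: sum0].
have csum n : continuous (fun y => \sum_(i < n) phi i y).
  by move=> y; exact: (@cvg_sum_ord _ _ (nbhs y) _ n phi (phi^~ y) (fun i => cphi i y)).
have cps j : continuous (ps j).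
  move=> y; rewrite /ps /psi.
  apply: (@continuous_max _ _ (fun=> 0)
    (fun y => phi j y - j%:R * \sum_(i < j) phi i y)); first exact: cvg_cst.
  by apply: cvgB; [exact: cphi|apply: cvgM; [exact: cvg_cst|exact: csum]].
(* Near [y] one has [phi i z > phi i y / 2]. Once [j > i] and [j] exceeds [2 / phi i y], the
   subtracted multiple of the earlier sum is at least 1, hence at least [phi j z], and [ps j z]
   vanishes. *)
have lf y : (exists j, 0 < phi j y) ->
    exists n, \forall z \near y, forall j, (n <= j)%N -> ps j z = 0.
  move=> [i yi].
  have : \forall z \near y, phi i y / 2 < phi i z.
    apply: (cvgr_gt (phi i y)); last by rewrite ltr_pdivrMr// ltr_pMr// ltr1n.
    exact: cphi.
  have [m ym] : exists m : nat, (phi i y / 2)^-1 < m%:R.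
    exists (Num.bound (phi i y / 2)^-1).
    by apply: archi_boundP; rewrite invr_ge0 divr_ge0// ltW.
  move=> H; exists (maxn i.+1 m); apply: filterS H => z zi j.
  rewrite geq_max => /andP[ij mj].
  apply/max_idPl; rewrite subr_le0.
  have /andP[_ /le_trans -> //] := phi01 j z.
  have hi : phi i y / 2 <= \sum_(l < j) phi l z.
    rewrite (bigD1 (Ordinal ij))//= (le_trans (ltW zi))// lerDl.
    by apply: sumr_ge0 => l _; have /andP[] := phi01 l z.
  have p2 : 0 < phi i y / 2 by rewrite divr_gt0.
  rewrite -[leLHS](@mulVf _ (phi i y / 2)) ?gt_eqF//.
  apply: ler_pM => //; rewrite ?invr_ge0 ?ltW//.
  by rewrite (lt_le_trans ym)// ler_nat.
pose bd y n := forall j, (n <= j)%N -> ps j y = 0.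
(* Any rank beyond which all weights vanish at [y] will do; [sum_eq] shows that the finite sums do
   not depend on the choice. *)
pose n y := xget 0%N [set m | bd y m].
have nP y m : bd y m -> bd y (n y) by move=> H; apply: (@xgetPex _ 0%N (bd y)); exists m.
have sum_eq (V : lmodType R) (v : nat -> V) y m : bd y m ->
    \sum_(j < n y) ps j y *: v j = \sum_(j < m) ps j y *: v j.
  move=> bm; have bn := nP _ _ bm.
  have aux a b : bd y a -> (a <= b)%N ->
      \sum_(j < b) ps j y *: v j = \sum_(j < a) ps j y *: v j.
    move=> ba ab; rewrite -!(big_mkord xpredT (fun j => ps j y *: v j)).
    rewrite (big_cat_nat (leq0n a) ab)/= [X in _ + X]big_nat_cond [X in _ + X]big1 ?addr0//.
    by move=> j /andP[/andP[aj _] _]; rewrite ba// scale0r.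
  have [nm|mn] := leqP (n y) m; first by rewrite [RHS](aux (n y)).
  by rewrite [LHS](aux m)// ltnW.
pose S y := \sum_(j < n y) ps j y.
have S_eq y m : bd y m -> S y = \sum_(j < m) ps j y.
  (* [R^o] views the scalars as a module, so that [sum_eq] also covers the plain sum of the
     weights. *)
  have E k : \sum_(j < k) ps j y = \sum_(j < k) ps j y *: (1 : R^o).
    by apply: eq_bigr => j _; rewrite -[RHS]/(_ * _) mulr1.
  by move=> bm; rewrite /S !E; exact: (sum_eq R^o (fun=> 1)).
have Sgt y : (exists j, 0 < phi j y) -> 0 < S y.
  move=> yj; have [m /nbhs_singleton ym] := lf y yj.
  have exj : exists j, 0 < phi j y by [].
  (* At the least index with [phi j y > 0] nothing is subtracted, so [ps j y = phi j y] and the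
     total weight is positive. *)
  have pj := ex_minnP exj; case: pj => j pj jmin.
  have psj : 0 < ps j y.
    rewrite /ps /psi big1 ?mulr0 ?subr0 ?lt_max ?pj ?orbT// => i _.
    have /andP[p0 _] := phi01 i y; apply/eqP; rewrite eq_le p0 andbT leNgt.
    by apply/negP => /jmin; rewrite leqNgt ltn_ord.
  have jn : (j < n y)%N.
    by rewrite ltnNge; apply/negP => /(nP _ _ ym) E; move: psj; rewrite E ltxx.
  by rewrite /S (bigD1 (Ordinal jn))//= ltr_pwDl// sumr_ge0.
exists (fun y => \sum_(j < n y) (ps j y / S y) *: e j); split; last first.
  move=> y yU P cP Pe.
  apply: (convex_combination cP (w := fun j => ps j y / S y)).
  - by move=> j; rewrite divr_ge0// ltW// Sgt.
  - by rewrite -mulr_suml divff// gt_eqF// Sgt.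
  - by move=> j; rewrite pmulr_lgt0 ?invr_gt0 ?Sgt// => /ps_phi/Pe.
move=> y yU eps eps0; have [m ym] := lf y yU.
(* A single [m] works for all [z] near [y], so there [f] is a sum of a fixed number of terms with
   continuous coefficients. *)
have f_eq z : bd z m -> \sum_(j < n z) (ps j z / S z) *: e j =
    \sum_(j < m) (ps j z / \sum_(j < m) ps j z) *: e j.
  move=> zm; rewrite -(S_eq _ _ zm).
  under eq_bigr do rewrite mulrC -scalerA.
  by rewrite -scaler_sumr (sum_eq X e _ _ zm) scaler_sumr;
    under eq_bigr do rewrite scalerA mulrC.
have ymm := nbhs_singleton ym.
pose g z := \sum_(j < m) ps j z.
have gy0 : g y != 0 by rewrite gt_eqF// /g -S_eq// Sgt.
have cg : g z @[z --> y] --> g y.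
  exact: (@cvg_sum_ord _ _ (nbhs y) _ m ps (ps^~ y) (fun i => cps i y)).
have cK : \sum_(j < m) `|ps j z / g z - ps j y / g y| * N (e j) @[z --> y] --> 0.
  rewrite [X in _ --> X](_ : 0 = \sum_(j < m)
    `|ps j y / g y - ps j y / g y| * N (e j)); last first.
    by rewrite big1// => j _; rewrite subrr normr0 mul0r.
  apply: (@cvg_sum_ord _ _ (nbhs y) _ m
    (fun j z => `|ps j z / g z - ps j y / g y| * N (e j))
    (fun j => `|ps j y / g y - ps j y / g y| * N (e j))).
  move=> j; apply: cvgM; last exact: cvg_cst.
  apply: cvg_norm; apply: cvgB; last exact: cvg_cst.
  by apply: cvgM; [exact: cps|exact: cvgV].
have cKe : \forall z \near y,
    \sum_(j < m) `|ps j z / g z - ps j y / g y| * N (e j) < eps.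
  exact: (cvgr_lt 0 cK).
apply: filterS2 ym cKe => z zm; apply: le_lt_trans.
rewrite !f_eq// -sumrB (le_trans (seminorm_sum sN _
  (fun j => (ps j z / g z) *: e j - (ps j y / g y) *: e j)))//.
by apply: ler_sum => j _; rewrite -scalerBl sN.2.
Qed.

End continuous_combinations.

Lemma continuous_eps {R : realType} {Y : topologicalType} (f : Y -> R) :
  (forall y eps, 0 < eps -> \forall z \near y, `|f z - f y| < eps) -> continuous f.
Proof.
by move=> H y; apply/cvgrPdist_lt => eps /(H y); apply: filterS => z;
  rewrite distrC.
Qed.

Lemma exp_lt_eps {R : realType} (a M eps : R) : 0 <= a < 1 -> 0 < eps ->
  exists n, M * a ^+ n < eps.
Proof.
move=> /andP[a0 a1] eps0.
have c : M * a ^+ n @[n --> \oo] --> M * 0.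
  by apply: cvgM; [exact: cvg_cst|apply: cvg_expr; rewrite ger0_norm].
rewrite mulr0 in c; have [n _ H] := cvgr_lt _ c _ eps0.
by exists n; exact: H (leqnn n).
Qed.

(** * Extension of maps from closed subsets *)

Section extension.
Context {R : realType} {X : lmodType R} (N : X -> R) (sN : seminorm N).

(** Clipping turns any continuous function into an admissible weight in [[0, 1]] without changing
    where it is positive. *)
Let truncated (x : R) := Num.min 1 (Num.max 0 x).

Let truncated01 x : 0 <= truncated x <= 1.
Proof. by rewrite /truncated le_min le_max lexx ler01 ge_min lexx. Qed.

Let truncated_gt0 x : (0 < truncated x) = (0 < x).
Proof. by rewrite /truncated lt_min lt_max ltxx ltr01. Qed.

Let continuous_truncated (Y : topologicalType) (f : Y -> R) :
  continuous f -> continuous (fun y => truncated (f y)).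
Proof.
move=> cf y; apply: (@continuous_min _ _ (fun=> 1) (fun y => Num.max 0 (f y))).
  exact: cvg_cst.
by apply: (@continuous_max _ _ (fun=> 0) f); [exact: cvg_cst|exact: cf].
Qed.

(* Dugundji's extension theorem for a separable domain: the weights
   [2 d(y, A) - d(y, a_j)] come from the points of a dense sequence. *)
Lemma extension_from_closed {Y : metricType R} {Z : Type} (i : Z -> Y) (u : Z -> X)
    (a : nat -> Z) :
  closed (range i) ->
  (forall z eps, 0 < eps -> exists2 d, 0 < d &
     forall z', mdist (i z) (i z') < d -> N (u z' - u z) < eps) ->
  (forall z eps, 0 < eps -> exists j, mdist (i z) (i (a j)) < eps) ->
  exists f : Y -> X,
    (forall y, scontinuous_at N f y) /\ forall z, N (f (i z) - u z) = 0.
Proof.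
move=> cA iu da.
(* This is the distance from [y] to the range of [i], since the points [i (a j)] are dense in that
   range ([Dadh]). *)
pose D y := inf (range (fun j => mdist y (i (a j)))).
have hD y : has_inf (range (fun j => mdist y (i (a j)))).
  split; first by exists (mdist y (i (a 0%N))), 0%N.
  by exists 0 => _ [j _ <-]; exact: mdist_ge0.
have Dle y j : D y <= mdist y (i (a j)).
  by apply: ge_inf; [exact: (hD y).2|exists j].
have D_lip y z : D y <= D z + mdist y z.
  rewrite -lerBlDr; apply: lb_le_inf; first exact: (hD z).1.
  move=> _ [j _ <-]; rewrite lerBlDr (le_trans (Dle _ j))//.
  by rewrite addrC metric_triangle.
have Dadh y z : D y <= mdist (i z) y.
  apply/ler_addgt0Pr => eps /(da z)[j zj].
  rewrite (le_trans (Dle _ j))// (le_trans (metric_triangle _ (i z) _))//.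
  by rewrite metric_sym lerD2l ltW.
have Dgt y d : D y < d -> exists j, mdist y (i (a j)) < d.
  by move=> /inf_lt[|_ [j _ <-] ?]; [exact: (hD y).1|exists j].
have Dpos y : ~ range i y -> 0 < D y.
  move=> Ay; rewrite lt_neqAle; apply/andP; split; last first.
    by apply: lb_le_inf; [exact: (hD y).1|move=> _ [j _ <-]; exact: mdist_ge0].
  apply/eqP => D0; apply: Ay; apply: cA => B /nbhs_ballP[eps eps0 yB].
  have [|j yj] := Dgt y eps; first by rewrite -D0.
  exists (i (a j)); split; first by exists (a j).
  by apply: yB; rewrite ballEmdist.
have near_lt (y : Y) d : 0 < d -> \forall z \near y, mdist y z < d.
  move=> d0; apply/nbhs_ballP; exists d => // z.
  by rewrite ballEmdist.
have cD : continuous D.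
  apply: continuous_eps => y eps /near_lt-/(_ y); apply: filterS => z yz.
  have := D_lip y z; have := D_lip z y; rewrite (metric_sym z y) ltr_norml.
  by move=> ? ?; apply/andP; split; lra.
have cdist (x : Y) : continuous (fun y : Y => mdist y x).
  apply: continuous_eps => y eps /near_lt-/(_ y); apply: filterS => z yz.
  have := metric_triangle y z x; have := metric_triangle z y x.
  rewrite (metric_sym z y) ltr_norml.
  by move=> ? ?; apply/andP; split; lra.
pose phi j y := truncated (2 * D y - mdist y (i (a j))).
have [||f [cf fP]] := continuous_combination sN (phi := phi) (u \o a).
- move=> j; apply: continuous_truncated => y.
  apply: cvgB; last exact: cdist.
  by apply: cvgM; [exact: cvg_cst|exact: cD].
- by move=> j y; exact: truncated01.
have phi_ex y : ~ range i y -> exists j, 0 < phi j y.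
  move=> /Dpos Dy; have [|j yj] := Dgt y (2 * D y); first lra.
  by exists j; rewrite truncated_gt0 subr_gt0.
(* On the range a preimage is chosen arbitrarily; by [iu] two preimages of one point have values at
   [N]-distance 0, whence [gA]. *)
pose g y := if pselect (range i y) is left A then u (s2val (cid2 A)) else f y.
have gA z : N (g (i z) - u z) = 0.
  rewrite /g; case: pselect => [A|[]]; last by exists z.
  case: (cid2 A) => z' _ /= z'z.
  apply/eqP; rewrite eq_le (seminorm_ge0 sN) andbT.
  apply/ler_addgt0Pr => eps /(iu z)[d d0] /(_ z').
  by rewrite z'z mdistxx add0r => /(_ d0)/ltW.
exists g; split => // y.
have [[z _ zy]|Ay] := pselect (range i y); last first.
  have /open_nbhs_nbhs : open_nbhs y (~` range i).
    by split => //; exact: closed_openC.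
  move=> nA eps eps0; have := cf y (phi_ex y Ay) _ eps0.
  apply: filterS2 nA => y' Ay'; rewrite /g.
  by case: pselect => // _; case: pselect.
move=> eps eps0; have [d d0 zd] := iu z (eps / 2) ltac:(by rewrite divr_gt0).
(* An active [a j] satisfies [d(y', i (a j)) < 2 D y' <= 2 d(y, y')], so it lies within
   [3 d(y, y') < d] of [y = i z]. *)
have d3 : 0 < d / 3 by rewrite divr_gt0.
have := near_lt y _ d3; apply: filterS => y' yy'.
suff : N (g y' - u z) <= eps / 2.
  have := gA z; rewrite zy => gz H.
  rewrite (le_lt_trans (seminorm_triangle sN (u z) _ _))//.
  by rewrite (seminormC sN (u z)) gz addr0 (le_lt_trans H)// gtr_pMr// invf_lt1// ltr1n.
have [[z' _ z'y]|Ay'] := pselect (range i y').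
  rewrite (le_trans (seminorm_triangle sN (u z') _ _))//.
  have -> : N (g y' - u z') = 0 by rewrite -z'y gA.
  by rewrite add0r; apply/ltW/zd; rewrite zy z'y; lra.
rewrite /g; case: pselect => // _.
apply: (fP y' (phi_ex _ Ay') (fun x => N (x - u z) <= eps / 2)).
  by move=> c x w c01; exact: seminorm_ball_convex.
move=> j; rewrite truncated_gt0 subr_gt0 => H /=; apply/ltW/zd.
rewrite (le_lt_trans (metric_triangle _ y' _))// zy.
have := Dadh y' z; rewrite zy; lra.
Qed.

(** * Iterated approximate projections onto the zeros of [rho x x] *)

Context (e : nat -> X) (rho : X -> X -> R).
Hypothesis e_dense : forall x eps, 0 < eps -> exists j, N (x - e j) < eps.
Hypothesis N_complete : forall (v : nat -> X) C a, 0 <= a < 1 ->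
  (forall n, N (v n.+1 - v n) <= C * a ^+ n) ->
  exists x, forall eps, 0 < eps -> exists n0, forall n, (n0 <= n)%N -> N (x - v n) < eps.
Hypothesis rho_ge0 : forall x v, 0 <= rho x v.
Hypothesis rho_lip : forall x v x' v',
  rho x v <= rho x' v' + N (v - v') + 8^-1 * N (x - x').
Hypothesis rho_convex : forall x a v w, 0 <= a <= 1 ->
  rho x (a *: v + (1 - a) *: w) <= a * rho x v + (1 - a) * rho x w.
Hypothesis rho_sel : forall x, 0 < rho x x ->
  exists2 v, rho x v < rho x x / 2 & N (v - x) < 2 * rho x x.

Let continuous_rho (Y : topologicalType) (f g : Y -> X) :
  (forall y, scontinuous_at N f y) -> (forall y, scontinuous_at N g y) ->
  continuous (fun y => rho (f y) (g y)).
Proof.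
move=> cf cg; apply: continuous_eps => y eps eps0.
apply: filterS2 (cf y _ (divr_gt0 eps0 (ltr0n _ 3)))
  (cg y _ (divr_gt0 eps0 (ltr0n _ 3))) => z fz gz.
have := rho_lip (f z) (g z) (f y) (g y).
have := rho_lip (f y) (g y) (f z) (g z).
rewrite (seminormC sN (f y)) (seminormC sN (g y)) ltr_norml.
by move=> ? ?; apply/andP; split; lra.
Qed.

Let continuous_N (Y : topologicalType) (f : Y -> X) v :
  (forall y, scontinuous_at N f y) -> continuous (fun y => N (v - f y)).
Proof.
move=> cf; apply: continuous_eps => y eps /(cf y); apply: filterS => z fz.
have := seminorm_triangle sN (f z) v (f y).
have := seminorm_triangle sN (f y) v (f z).
rewrite (seminormC sN (f y) (f z)) ltr_norml.
by move=> ? ?; apply/andP; split; lra.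
Qed.

(** Where [rho (f y) (f y)] is positive, a member of the dense sequence close to the point given by
    [rho_sel] still meets both strict bounds, and the bounds are convex. Where it vanishes, [g]
    equals [f]; continuity at such points follows from the second bound, which forces [g - f] to
    0. *)
Lemma approximate_projection {Y : topologicalType} (f : Y -> X) :
  (forall y, scontinuous_at N f y) -> exists g : Y -> X,
    (forall y, scontinuous_at N g y) /\
    forall y, rho (f y) (g y) <= rho (f y) (f y) / 2 /\
              N (g y - f y) <= 2 * rho (f y) (f y).
Proof.
move=> cf; pose r y := rho (f y) (f y).
have cr : continuous r by exact: continuous_rho.
pose phi j y := truncated (Num.min (r y / 2 - rho (f y) (e j))
  (2 * r y - N (e j - f y))).
have [||h [ch hP]] := continuous_combination sN (phi := phi) e.
- move=> j; apply: continuous_truncated => y.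
  apply: (@continuous_min _ _ (fun y => r y / 2 - rho (f y) (e j))
    (fun y => 2 * r y - N (e j - f y))).
    apply: cvgB; first by apply: cvgM; [exact: cr|exact: cvg_cst].
    apply: (continuous_rho (g := fun=> e j)) => //.
    by move=> x eps eps0; apply: nearW => z; rewrite subrr (seminorm0 sN).
  apply: cvgB; last exact: continuous_N.
  by apply: cvgM; [exact: cvg_cst|exact: cr].
- by move=> j y; exact: truncated01.
have phi_ex y : 0 < r y -> exists j, 0 < phi j y.
  move=> ry; have [v v1 v2] := rho_sel ry.
  (* The slack left by [v] in the two strict inequalities; a point of the sequence closer to [v]
     than this still satisfies both. *)
  pose eps := Num.min (r y / 2 - rho (f y) v) (2 * r y - N (v - f y)).
  have eps0 : 0 < eps by rewrite /eps lt_min !subr_gt0 v1 v2.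
  have [j vj] := e_dense v eps0; exists j.
  move: vj; rewrite truncated_gt0 /eps !lt_min !subr_gt0 => /andP[vj1 vj2].
  have := rho_lip (f y) (e j) (f y) v.
  have := seminorm_triangle sN v (e j) (f y).
  rewrite subrr (seminorm0 sN) (seminormC sN (e j) v) => ? ?.
  by apply/andP; split; lra.
pose g y := if 0 < r y then h y else f y.
have gP y : rho (f y) (g y) <= r y / 2 /\ N (g y - f y) <= 2 * r y.
  rewrite /g; case: ifPn => ry; last first.
    have -> : rho (f y) (f y) = 0.
      by apply/eqP; rewrite eq_le rho_ge0 andbT leNgt.
    by rewrite subrr (seminorm0 sN) divr_ge0 ?rho_ge0// mulr_ge0 ?rho_ge0.
  apply: (hP y (phi_ex y ry)
    (fun x => rho (f y) x <= r y / 2 /\ N (x - f y) <= 2 * r y)).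
    move=> a x z a01 [x1 x2] [z1 z2]; split; last exact: seminorm_ball_convex.
    rewrite (le_trans (rho_convex _ _ _ a01))//; move/andP : a01 => [a0 a1].
    have : a * rho (f y) x <= a * (r y / 2) by rewrite ler_wpM2l.
    have : (1 - a) * rho (f y) z <= (1 - a) * (r y / 2).
      by rewrite ler_wpM2l// subr_ge0.
    by move=> ? ?; lra.
  move=> j; rewrite truncated_gt0 lt_min !subr_gt0 => /andP[? ?].
  by split; exact: ltW.
exists g; split => // y eps eps0.
have [ry|] := boolP (0 < r y).
  have : \forall z \near y, 0 < r z by exact: (cvgr_gt (r y) (cr y)).
  apply: filterS2 (ch y (phi_ex y ry) _ eps0) => z + rz.
  by rewrite /g rz ry.
rewrite -leNgt => ry0.
have : \forall z \near y, r z < eps / 4.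
  by apply: (cvgr_lt (r y) (cr y)); rewrite (le_lt_trans ry0)// divr_gt0.
apply: filterS2 (cf y _ (divr_gt0 eps0 (ltr0n _ 2))) => z fz rz.
have [_ gz] := gP z.
have gy : g y = f y by rewrite /g ltNge ry0.
rewrite gy (le_lt_trans (seminorm_triangle sN (f z) _ _))//.
lra.
Qed.

Lemma fixed_point_extension {Y : topologicalType} (f0 : Y -> X) :
  (forall y, scontinuous_at N f0 y) -> exists f : Y -> X,
    [/\ forall y, scontinuous_at N f y, forall y, rho (f y) (f y) = 0 &
        forall y, rho (f0 y) (f0 y) = 0 -> N (f y - f0 y) = 0].
Proof.
move=> cf0.
(* One improvement step as a total operation on maps, with [f] itself as default for discontinuous
   [f], so that it can be iterated. *)
have /choice[st stP] (f : Y -> X) : exists g : Y -> X,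
    (forall y, scontinuous_at N f y) ->
    (forall y, scontinuous_at N g y) /\
    forall y, rho (f y) (g y) <= rho (f y) (f y) / 2 /\
              N (g y - f y) <= 2 * rho (f y) (f y).
  have [/approximate_projection[g gP]|] := pselect (forall y, scontinuous_at N f y).
    by exists g.
  by exists f.
pose u n := iter n st f0.
have cu n y : scontinuous_at N (u n) y.
  by elim: n y => [//|n IH] y; exact: (stP (u n) IH).1.
(* [q = 1/2 + 8^-1 * 2]: the halved defect plus the cost of moving the first argument by at most
   twice the defect. *)
pose r0 y := rho (f0 y) (f0 y); pose q : R := 3 / 4.
have q0 : 0 <= q by rewrite /q; lra.
have q1 : 0 <= q < 1 by rewrite /q; lra.
have ru n y : rho (u n y) (u n y) <= r0 y * q ^+ n.
  elim: n => [|n IH]; first by rewrite expr0 mulr1.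
  have [H1 H2] := (stP (u n) (cu n)).2 y.
  rewrite -[u n.+1]/(st (u n)) exprSr mulrA.
  have := rho_lip (st (u n) y) (st (u n) y) (u n y) (st (u n) y).
  rewrite subrr (seminorm0 sN) => H3.
  apply: (@le_trans _ _ (rho (u n y) (u n y) * q)); first by rewrite /q; lra.
  by rewrite ler_wpM2r.
have du n y : N (u n.+1 y - u n y) <= (2 * r0 y) * q ^+ n.
  have [_ H2] := (stP (u n) (cu n)).2 y.
  by rewrite (le_trans H2)// -mulrA ler_wpM2l.
have /choice[f fP] y : exists x, forall eps, 0 < eps ->
    exists n0, forall n, (n0 <= n)%N -> N (x - u n y) < eps.
  exact: (N_complete q1 (fun n => du n y)).
(* [8 = 2 / (1 - q)] sums the geometric series of the steps; the difference of powers is the form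
   that telescopes. *)
have du2 n k y : N (u (n + k)%N y - u n y) <= 8 * r0 y * (q ^+ n - q ^+ (n + k)).
  elim: k => [|k IH]; first by rewrite addn0 !subrr (seminorm0 sN) mulr0.
  rewrite addnS (le_trans (seminorm_triangle sN (u (n + k)%N y) _ _))//.
  have := du (n + k)%N y; rewrite exprSr.
  by move: IH; move: (q ^+ n) (q ^+ (n + k)) => A B; rewrite /q => ? ?; lra.
have fu n y : N (f y - u n y) <= 8 * r0 y * q ^+ n.
  apply/ler_addgt0Pr => eps /(fP y)[n0] /(_ (n + n0)%N (leq_addl _ _)) H.
  rewrite (le_trans (seminorm_triangle sN (u (n + n0)%N y) _ _))//.
  rewrite addrC lerD ?(ltW H)// (le_trans (du2 _ _ _))// ler_wpM2l//.
    by apply: mulr_ge0; [exact: ler0n|exact: rho_ge0].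
  by rewrite gerBl exprn_ge0.
exists f; split.
- move=> y eps eps0.
  (* Near [y] the bound [r0 z < r0 y + 1] makes the convergence of the iterates locally uniform,
     hence the limit continuous. *)
  have [n] := exp_lt_eps (8 * (r0 y + 1)) q1 (divr_gt0 eps0 (ltr0n _ 3)).
  move=> nM; have cr := continuous_rho cf0 cf0.
  have : \forall z \near y, r0 z < r0 y + 1.
    by apply: (cvgr_lt (r0 y) (cr y)); rewrite ltrDl.
  apply: filterS2 (cu n y _ (divr_gt0 eps0 (ltr0n _ 3))) => z uz rz.
  have := seminorm_triangle sN (u n y) (f z) (f y).
  have := seminorm_triangle sN (u n z) (f z) (u n y).
  have := fu n z; have := fu n y; rewrite (seminormC sN (f y)).
  have : 8 * r0 z * q ^+ n <= 8 * (r0 y + 1) * q ^+ n.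
    by rewrite ler_wpM2r ?exprn_ge0// ler_wpM2l// ltW.
  have : 8 * r0 y * q ^+ n <= 8 * (r0 y + 1) * q ^+ n.
    by rewrite ler_wpM2r ?exprn_ge0// ler_wpM2l// lerDl.
  by move=> ? ? ? ? ? ?; lra.
- move=> y; apply/eqP; rewrite eq_le rho_ge0 andbT.
  apply/ler_addgt0Pr => eps eps0; rewrite add0r.
  (* [rho_lip] compares [f y] with [u n y]: one [r0 y * q ^+ n] from the defect of [u n y], and
     [(1 + 1/8) * 8 = 9] more from the distance. *)
  have [n nM] := exp_lt_eps (10 * r0 y) q1 eps0.
  have := rho_lip (f y) (f y) (u n y) (u n y).
  have := ru n y; have := fu n y; move: nM; move: (q ^+ n) => B.
  by move=> ? ? ? ?; lra.
- move=> y ry; apply/eqP; rewrite eq_le (seminorm_ge0 sN) andbT.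
  by have := fu 0%N y; rewrite /r0 ry mulr0 mul0r.
Qed.

(** The Dugundji extension of [u] agrees with [u] on the range up to [N]-distance 0, so by [rho_lip]
    its defect vanishes there and [fixed_point_extension] leaves it in place. The hypotheses [iu]
    and [ui] say that [i] and [u] induce the same topology on [Z]; with separability of [X] this
    gives [Z] a dense sequence. *)
Lemma fixed_point_absolute_extensor {Y : metricType R} {Z : Type}
    (i : Z -> Y) (u : Z -> X) :
  closed (range i) ->
  (forall z eps, 0 < eps -> exists2 d, 0 < d &
     forall z', mdist (i z) (i z') < d -> N (u z' - u z) < eps) ->
  (forall z eps, 0 < eps -> exists2 d, 0 < d &
     forall z', N (u z' - u z) < d -> mdist (i z) (i z') < eps) ->
  (forall z, rho (u z) (u z) = 0) ->
  exists f : Y -> X,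
    [/\ forall y, scontinuous_at N f y, forall y, rho (f y) (f y) = 0 &
        forall z, N (f (i z) - u z) = 0].
Proof.
move=> cA iu ui uF.
have [f0 [cf0 f0u]] : exists f : Y -> X,
    (forall y, scontinuous_at N f y) /\ forall z, N (f (i z) - u z) = 0.
  have [[z0]|Z0] := pselect (inhabited Z); last first.
    exists (fun=> 0); split.
      by move=> y eps eps0; apply: nearW => z; rewrite subrr (seminorm0 sN).
    by move=> z; case: Z0; split.
  (* A subspace of a separable space is separable: for each ball of radius [1 / (n + 1)] around
     [e j], pick a point of [Z] whose value lies in it, or [z0] if there is none. *)
  have /choice[a aP] (m : nat * nat) : exists z, forall z',
      N (u z' - e m.1) < m.2.+1%:R^-1 -> N (u z - e m.1) < m.2.+1%:R^-1.
    have [[z zP]|H] := pselect (exists z, N (u z - e m.1) < m.2.+1%:R^-1).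
      by exists z.
    by exists z0 => z' z'm; case: H; exists z'.
  apply: (extension_from_closed (a := fun k => a (odflt (0, 0)%N (unpickle k)))) => //.
  move=> z eps /(ui z)[d d0 dP].
  have [n nd] : exists n : nat, n.+1%:R^-1 < d / 2.
    have [n] := ltr_add_invr (y := 0) (x := d / 2) ltac:(by rewrite divr_gt0).
    by rewrite add0r => ?; exists n.
  have [j zj] := e_dense (u z) (eps := n.+1%:R^-1) ltac:(by rewrite invr_gt0 ltr0n).
  exists (pickle (j, n)); rewrite pickleK/=; apply: dP.
  have := aP (j, n) z zj => /= H.
  rewrite (le_lt_trans (seminorm_triangle sN (e j) _ _))//.
  rewrite (seminormC sN (e j)); move: H zj nd.
  by move: (n.+1%:R^-1) => x ? ? ?; lra.
have [f [cf f_fix f_f0]] := fixed_point_extension cf0.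
exists f; split => // z.
have f0_fix : rho (f0 (i z)) (f0 (i z)) = 0.
  apply/eqP; rewrite eq_le rho_ge0 andbT.
  by have := rho_lip (f0 (i z)) (f0 (i z)) (u z) (u z); rewrite uF f0u mulr0 !addr0.
apply/eqP; rewrite eq_le (seminorm_ge0 sN) andbT.
rewrite (le_trans (seminorm_triangle sN (f0 (i z)) _ _))//.
by rewrite f_f0// f0u addr0.
Qed.

End extension.

(** * L^p norms of vector-valued maps *)

(** [bochner_norm] is convertible to the instance at Lebesgue measure; working over an arbitrary
    measure keeps the inequalities free of the topology of the line. *)
Definition vnorm {d} {T : measurableType d} {R : realType}
    (mu : {measure set T -> \bar R}) {V : normedModType R}
    (D : set T) (p : R) (f : T -> V) : \bar R :=
  'N[mu]_(p%:E)[EFin \o ((fun t => `|f t|) \_ D)].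

Section vnorm_inequalities.
Context d (T : measurableType d) {R : realType} (mu : {measure set T -> \bar R}).
Implicit Types (D : set T) (p : R).

Lemma vnormE (V : normedModType R) D p (f : T -> V) : 0 < p ->
  vnorm mu D p f =
  ((\int[mu]_(t in D) (`|f t| `^ p)%:E) `^ p^-1)%E.
Proof.
move=> p0; rewrite /vnorm unlock [in RHS]integral_mkcond.
apply: (congr1 (fun x => (x `^ p^-1)%E)).
apply: eq_integral => t _ /=.
rewrite !patchE; case: ifPn => _; first by rewrite normr_id.
by rewrite -[LHS]/((`|0| `^ p)%:E) normr0 powR0// gt_eqF.
Qed.

Lemma vnorm0 (V : normedModType R) D p : 0 < p ->
  vnorm mu D p (fun=> 0 : V) = 0%E.
Proof.
move=> p0; rewrite vnormE//; under eq_integral do rewrite normr0 powR0 ?gt_eqF//.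
by rewrite integral0 poweR0r// invr_neq0// gt_eqF.
Qed.

Lemma measurable_norm_powR (V : normedModType R) D p (g : T -> V) :
  measurable_fun D ((fun t => `|g t|) : T -> R) ->
  measurable_fun D (fun t : T => (`|g t| `^ p)%:E).
Proof.
move=> mg; apply/measurable_EFinP.
apply: (@measurableT_comp _ _ _ _ _ _ (fun y : R => y `^ p) _
  (fun t : T => `|g t|)) => //; exact: measurable_powR.
Qed.

Lemma le_vnorm (V W : normedModType R) D p (f : T -> V) (g : T -> W) :
  measurable D -> 0 < p ->
  measurable_fun D ((fun t => `|f t|) : T -> R) ->
  measurable_fun D ((fun t => `|g t|) : T -> R) ->
  {ae mu, forall t, D t -> `|f t| <= `|g t|} ->
  (vnorm mu D p f <= vnorm mu D p g)%E.
Proof.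
move=> mD p0 mf mg fg.
rewrite !(vnormE _ _ p0).
have int0 (h : T -> R) : (0 <= \int[mu]_(t in D) (h t `^ p)%:E)%E.
  by apply: integral_ge0 => t _; rewrite lee_fin powR_ge0.
apply: gt0_ler_poweR.
  by rewrite invr_ge0 ltW.
- by rewrite in_itv/= leey andbT.
- by rewrite in_itv/= leey andbT.
apply: ae_ge0_le_integral => //.
- exact: measurable_norm_powR.
- exact: measurable_norm_powR.
apply: filterS fg => t fg Dt; rewrite lee_fin.
by apply: ge0_ler_powR; rewrite ?nnegrE ?(ltW p0)// fg.
Qed.

(** Minkowski's inequality for the real functions [|g|] and [|h|]. Only norms are compared, so the
    three maps may take values in different spaces. *)
Lemma le_vnormD (U V W : normedModType R) D p
    (f : T -> U) (g : T -> V) (h : T -> W) :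
  measurable D -> 1 <= p ->
  measurable_fun D ((fun t => `|f t|) : T -> R) ->
  measurable_fun D ((fun t => `|g t|) : T -> R) ->
  measurable_fun D ((fun t => `|h t|) : T -> R) ->
  {ae mu, forall t, D t -> `|f t| <= `|g t| + `|h t|} ->
  (vnorm mu D p f <= vnorm mu D p g + vnorm mu D p h)%E.
Proof.
move=> mD p1 mf mg mh fgh; have p0 : 0 < p by rewrite (lt_le_trans _ p1).
have mgh : measurable_fun D ((fun t => `|g t| + `|h t|) : T -> R).
  exact: measurable_funD.
apply: (@le_trans _ _ (vnorm mu D p (fun t => `|g t| + `|h t|))).
  apply: (le_vnorm mD p0 mf); first exact: measurableT_comp.
  by apply: filterS fgh => t H Dt; rewrite [leRHS]ger0_norm ?addr_ge0// H.
have p1E : (1 <= p%:E)%E by rewrite lee_fin.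
have mD' (u : T -> R) : measurable_fun D (u : T -> R) ->
    measurable_fun setT ((u \_ D) : T -> R).
  by move=> /(measurable_restrictT _ mD).
have := @eminkowski _ _ _ mu _ _ p%:E (mD' _ mg) (mD' _ mh) p1E.
rewrite /vnorm; congr (_ <= _)%E; congr Lnorm; apply/funext => t /=.
rewrite !patchE; case: ifPn => _; last by rewrite addr0.
by rewrite ger0_norm ?addr_ge0.
Qed.

Lemma vnormZ (V : normedModType R) D p (f : T -> V) (c : R) :
  measurable D -> 0 < p -> measurable_fun D ((fun t => `|f t|) : T -> R) ->
  vnorm mu D p (fun t => c *: f t) = (`|c|%:E * vnorm mu D p f)%E.
Proof.
move=> mD p0 mf; rewrite !vnormE//.
under eq_integral do rewrite normrZ powRM// EFinM.
have mfp : measurable_fun D (fun t : T => (`|f t| `^ p)%:E).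
  exact: measurable_norm_powR.
rewrite ge0_integralZl_EFin ?powR_ge0//.
rewrite poweRM ?lee_fin ?powR_ge0//; last first.
  by apply: integral_ge0 => t _; rewrite lee_fin powR_ge0.
by rewrite poweR_EFin -powRrM divff ?gt_eqF// powRr1.
Qed.

Lemma sub_vnorm (V : normedModType R) J D p (f : T -> V) :
  measurable J -> measurable D -> 0 < p -> J `<=` D ->
  measurable_fun D ((fun t => `|f t|) : T -> R) ->
  (vnorm mu J p f <= vnorm mu D p f)%E.
Proof.
move=> mJ mD p0 JD mf; rewrite !vnormE//.
have int0 (K : set T) : (0 <= \int[mu]_(t in K) (`|f t| `^ p)%:E)%E.
  by apply: integral_ge0 => t _; rewrite lee_fin powR_ge0.
apply: gt0_ler_poweR; rewrite ?invr_ge0 ?(ltW p0)//.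
- by rewrite in_itv/= leey andbT.
- by rewrite in_itv/= leey andbT.
apply: ge0_subset_integral => //.
exact: measurable_norm_powR.
Qed.

Lemma vnorm_patch (V : normedModType R) J D p (f : T -> V) : J `<=` D ->
  vnorm mu J p f = vnorm mu D p ((fun t => `|f t|) \_ J).
Proof.
move=> JD; rewrite /vnorm; congr Lnorm; apply/funext => t /=.
rewrite !patchE; case: ifPn => tJ; last by rewrite normr0 if_same.
by rewrite mem_set ?normr_id//; apply: JD; rewrite inE in tJ.
Qed.

(** [|f|] is at most the sum of its restrictions to the [J i]; overlaps are harmless, which matters
    for adjacent closed intervals. *)
Lemma vnorm_bigcup (V : normedModType R) m (J : nat -> set T) D p
    (f : T -> V) :
  (forall i, measurable (J i)) -> measurable D -> 1 <= p ->
  (forall i, J i `<=` D) -> (forall t, D t -> exists2 i, (i < m)%N & J i t) ->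
  measurable_fun D ((fun t => `|f t|) : T -> R) ->
  (vnorm mu D p f <= \sum_(i < m) vnorm mu (J i) p f)%E.
Proof.
move=> mJ mD p1 JD DJ mf; have p0 : 0 < p by rewrite (lt_le_trans _ p1).
pose g i : T -> R := (fun t => `|f t|) \_ (J i).
have g0 i t : 0 <= g i t by rewrite /g patchE; case: ifP.
have mg i : measurable_fun D (g i : T -> R).
  apply: measurable_funTS; apply/(measurable_restrictT _ (mJ i)).
  exact: measurable_funS mf.
have G k : (vnorm mu D p (fun t => \sum_(i < k) g i t)%R <=
            \sum_(i < k) vnorm mu (J i) p f)%E.
  elim: k => [|k IH].
    rewrite big_ord0 (_ : (fun _ => _) = fun=> 0); last first.
      by apply/funext => t; rewrite big_ord0.
    by rewrite vnorm0.
  rewrite big_ord_recr/= (le_trans _ (leeD IH (lexx _)))//.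
  rewrite (vnorm_patch p f (JD k)).
  have ms n : measurable_fun D
      ((fun t => `|\sum_(i < n) g i t|) : T -> R).
    apply: measurableT_comp; first exact: normr_measurable.
    by apply: measurable_sum => i; exact: mg.
  apply: (le_vnormD mD p1 (ms _) (ms _)).
    exact: (measurableT_comp (@normr_measurable _ _) (mg k)).
  by apply: nearW => t _; rewrite big_ord_recr/= ler_normD.
apply: (le_trans _ (G m)); apply: (le_vnorm mD p0 mf).
  apply: measurableT_comp; first exact: normr_measurable.
  by apply: measurable_sum => i; exact: mg.
apply: nearW => t /DJ[i im Jt].
rewrite [leRHS]ger0_norm ?sumr_ge0// (bigD1 (Ordinal im))//=.
by rewrite {1}/g patchE mem_set// lerDl sumr_ge0.
Qed.

Lemma hoelder_vnorm (V W : normedModType R) D p q (f : T -> V) (g : T -> W) :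
  measurable D -> 0 < p -> 0 < q -> p^-1 + q^-1 = 1 ->
  measurable_fun D ((fun t => `|f t|) : T -> R) ->
  measurable_fun D ((fun t => `|g t|) : T -> R) ->
  (\int[mu]_(t in D) (`|f t| * `|g t|)%:E <=
   vnorm mu D p f * vnorm mu D q g)%E.
Proof.
move=> mD p0 q0 pq mf mg.
have mD' (u : T -> R) : measurable_fun D (u : T -> R) ->
    measurable_fun setT ((u \_ D) : T -> R).
  by move=> /(measurable_restrictT _ mD).
have := hoelder mu (mD' _ mf) (mD' _ mg) p0 q0 pq; congr (_ <= _)%E.
rewrite Lnorm1 [RHS]integral_mkcond; apply: eq_integral => t _ /=.
rewrite !patchE; case: ifPn => _; last by rewrite mulr0 normr0.
by rewrite ger0_norm ?mulr_ge0.
Qed.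

End vnorm_inequalities.

Lemma cvg_norm_powR {R : realType} {T : Type} (G : set_system T) {FG : Filter G}
    (u : T -> R) (l p : R) : 0 < p -> u x @[x --> G] --> l ->
  `|u x| `^ p @[x --> G] --> `|l| `^ p.
Proof.
move=> p0 ul; have [l0|l0] := eqVneq `|l| 0.
  rewrite l0 powR0 ?gt_eqF//; apply/cvgr0Pnorm_lt => eps eps0.
  have e0 : 0 < eps `^ p^-1 by rewrite powR_gt0.
  have : u x @[x --> G] --> 0 by move/normr0_eq0 : l0 => <-.
  move=> /cvgr0Pnorm_lt/(_ _ e0); apply: filterS => x ux.
  rewrite ger0_norm ?powR_ge0//.
  have := gt0_ltr_powR p0 _ _ ux; rewrite !nnegrE normr_ge0 powR_ge0.
  by move=> /(_ isT isT); rewrite -powRrM mulVf ?gt_eqF// powRr1// ltW.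
have lp : 0 < `|l| by rewrite lt_neqAle eq_sym l0 normr_ge0.
have nul : `|u x| @[x --> G] --> `|l| by exact: cvg_norm.
have c : expR (p * ln `|u x|) @[x --> G] --> expR (p * ln `|l|).
  apply: (@continuous_cvg T R R G FG (fun x => p * ln `|u x|) expR); first exact: continuous_expR.
  apply: cvgM; first exact: cvg_cst.
  exact: (@continuous_cvg T R R G FG (fun x => `|u x|) (@ln R) _ (continuous_ln lp) nul).
rewrite [X in _ --> X](_ : _ = expR (p * ln `|l|)); last first.
  by rewrite /powR (negPf l0).
apply: cvg_trans c; apply: near_eq_cvg.
have : \forall x \near G, 0 < `|u x| by exact: (cvgr_gt _ nul).
by apply: filterS => x ux; rewrite /powR gt_eqF.
Qed.

Lemma cvg_powR {R : realType} {T : Type} (G : set_system T) {FG : Filter G}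
    (u : T -> R) (l p : R) : 0 < p -> (forall x, 0 <= u x) -> 0 <= l ->
  u x @[x --> G] --> l -> u x `^ p @[x --> G] --> l `^ p.
Proof.
move=> p0 u0 l0 /(cvg_norm_powR p0); rewrite ger0_norm//.
by rewrite (_ : (fun x => `|u x| `^ p) = (fun x => u x `^ p))//;
  apply/funext => x; rewrite ger0_norm.
Qed.

Section vnorm_limits.
Context d (T : measurableType d) {R : realType} (mu : {measure set T -> \bar R}).
Implicit Types (D : set T) (p : R).

Lemma vnorm_ge0 (V : normedModType R) D p (f : T -> V) : (0 <= vnorm mu D p f)%E.
Proof. exact: Lnorm_ge0. Qed.

Lemma vnorm_le_int (V : normedModType R) D p B (f : T -> V) : 0 < p -> 0 <= B ->
  (vnorm mu D p f <= B%:E)%E = (\int[mu]_(t in D) (`|f t| `^ p)%:E <= (B `^ p)%:E)%E.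
Proof.
move=> p0 B0; rewrite vnormE//.
have : (0 <= \int[mu]_(t in D) (`|f t| `^ p)%:E)%E.
  by apply: integral_ge0 => t _; rewrite lee_fin powR_ge0.
move: (\int[mu]_(t in D) (`|f t| `^ p)%:E)%E => [x| |]//; last first.
  by rewrite poweRyr ?invr_neq0 ?gt_eqF.
rewrite poweR_EFin !lee_fin => x0; apply/idP/idP => H.
  have := ge0_ler_powR (ltW p0) _ _ H; rewrite !nnegrE powR_ge0 => /(_ isT B0).
  by rewrite -powRrM mulVf ?gt_eqF// powRr1.
have pV0 : 0 <= p^-1 by rewrite invr_ge0 ltW.
have := ge0_ler_powR pV0 _ _ H; rewrite !nnegrE powR_ge0 => /(_ x0 isT).
by rewrite -powRrM divff ?gt_eqF// powRr1.
Qed.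

(** Fatou's lemma for the functions [|f n|^p], whose lower limit is [|g|^p] almost everywhere. *)
Lemma vnorm_fatou (V W : normedModType R) D p (f : nat -> T -> V) (g : T -> W) B :
  measurable D -> 0 < p -> 0 <= B ->
  (forall n, measurable_fun D ((fun t => `|f n t|) : T -> R)) ->
  measurable_fun D ((fun t => `|g t|) : T -> R) ->
  {ae mu, forall t, D t -> `|f n t| @[n --> \oo] --> `|g t|} ->
  (forall n, (vnorm mu D p (f n) <= B%:E)%E) ->
  (vnorm mu D p g <= B%:E)%E.
Proof.
move=> mD p0 B0 mf mg fg fB; rewrite vnorm_le_int//.
have mfp n := measurable_norm_powR p (mf n).
have nn (h : T -> R) t : (0 <= (h t `^ p)%:E)%E by rewrite lee_fin powR_ge0.
apply: (@le_trans _ _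
  (\int[mu]_(t in D) limn_einf (fun n => (`|f n t| `^ p)%:E))%E).
  apply: ae_ge0_le_integral => //.
  - exact: measurable_norm_powR.
  - move=> t _; rewrite limn_einf_lim; apply: lime_ge; first exact: is_cvg_einfs.
    by apply: nearW => n; apply: le_ereal_inf_tmp => _ [m _ <-].
  - apply: measurableT_comp; first exact: oppe_measurable.
    by apply: measurable_fun_limn_esup => n; exact: measurableT_comp.
  apply: filterS fg => t fg Dt.
  have -> : limn_einf (fun n => (`|f n t| `^ p)%:E) = (`|g t| `^ p)%:E.
    apply: (cvg_limn_einf_sup _).1; apply: cvg_EFin; first exact: nearW.
    by apply: cvg_powR => //; exact: fg.
  by [].
apply: (le_trans (fatou _ _ _ _)) => //.
rewrite limn_einf_lim; apply: lime_le; first exact: is_cvg_einfs.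
apply: nearW => n; apply: (@le_trans _ _ (\int[mu]_(t in D) (`|f n t| `^ p)%:E)%E).
  by apply: ereal_inf_lbound; exists n => //=.
by rewrite -vnorm_le_int.
Qed.

Lemma vnorm_eq0 (V : normedModType R) D p (f : T -> V) : measurable D -> 0 < p ->
  measurable_fun D ((fun t => `|f t|) : T -> R) -> vnorm mu D p f = 0%E ->
  {ae mu, forall t, D t -> f t = 0}.
Proof.
move=> mD p0 mf /Lnorm_eq0_eq0 H.
have p0E : (0 < p%:E)%E by rewrite lte_fin.
have {}H := H _ p0E; apply: filterS (H _).
  move=> t /(_ Logic.I) [] /=; rewrite patchE => ft Dt; apply/normr0_eq0.
  by move: ft; rewrite mem_set.
by apply/measurable_EFinP/(measurable_restrictT _ mD).
Qed.

Lemma ae_eq0_vnorm (V : normedModType R) D p (f : T -> V) : measurable D -> 0 < p ->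
  measurable_fun D ((fun t => `|f t|) : T -> R) ->
  {ae mu, forall t, D t -> f t = 0} -> vnorm mu D p f = 0%E.
Proof.
move=> mD p0 mf f0; apply/eqP; rewrite eq_le vnorm_ge0 andbT.
rewrite -(vnorm0 mu R D p0); apply: (le_vnorm mD p0 mf) => //.
by apply: filterS f0 => t f0 /f0 ->; rewrite !normr0.
Qed.

Lemma vnorm_cst D p (M : R) : measurable D -> 0 < p -> (mu D < +oo)%E ->
  (vnorm mu D p (fun=> M) < +oo)%E.
Proof.
move=> mD p0 muD; rewrite vnormE//; apply: poweR_lty.
by rewrite (integral_cst _ mD) lte_mul_pinfty// lee_fin powR_ge0.
Qed.

(** Absolute continuity of the integral of [|f|^p], with threshold [eps^p]. *)
Lemma vnorm_absolute_continuity (V : normedModType R) D p (f : T -> V) eps :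
  measurable D -> 0 < p -> measurable_fun D ((fun t => `|f t|) : T -> R) ->
  (vnorm mu D p f < +oo)%E -> 0 < eps ->
  exists2 del, 0 < del & forall J, measurable J -> J `<=` D ->
    (mu J < del%:E)%E -> (vnorm mu J p f <= eps%:E)%E.
Proof.
move=> mD p0 mf fy eps0.
pose g : T -> R := (fun t => `|f t| `^ p) \_ D.
have mfp : measurable_fun D (fun t => `|f t| `^ p).
  by apply/measurable_EFinP; exact: measurable_norm_powR.
have ig : mu.-integrable setT (EFin \o g).
  apply/integrableP; split.
    by apply/measurable_EFinP/(measurable_restrictT _ mD).
  move: fy; rewrite vnormE// => /lty_poweRy H.
  have := H (invr_neq0 (lt0r_neq0 p0)); congr (_ < _)%E.
  rewrite integral_mkcond; apply: eq_integral => t _ /=.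
  rewrite /g !patchE; case: ifPn => _ /=; first by rewrite ger0_norm ?powR_ge0.
  by rewrite -[RHS]/(`|0|%:E) normr0.
have [del [del0 H]] := integral_normr_continuous ig (powR_gt0 p eps0).
exists del => // J mJ JD muJ; rewrite vnorm_le_int ?(ltW eps0)//.
have mfJ : measurable_fun J (fun t => `|f t| `^ p) by exact: measurable_funS mfp.
have -> : (\int[mu]_(t in J) (`|f t| `^ p)%:E = (\int[mu]_(t in J) `|g t|)%:E)%E.
  rewrite /Rintegral fineK; last first.
    have /integrableP[_ Hi] := ig.
    rewrite ge0_fin_numE; last by apply: integral_ge0 => t _; rewrite lee_fin.
    apply: le_lt_trans Hi; apply: ge0_subset_integral => //.
    apply/measurable_EFinP; apply: measurableT_comp; first exact: normr_measurable.
    exact/(measurable_restrictT _ mD).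
  apply: eq_integral => t; rewrite inE => /JD Dt.
  by rewrite /g patchE mem_set// ger0_norm ?powR_ge0.
by rewrite lee_fin ltW// H.
Qed.

Lemma vnorm_dominated (V W : normedModType R) D p (f : nat -> T -> V) (g : T -> W) eps :
  measurable D -> 0 < p ->
  (forall n, measurable_fun D ((fun t => `|f n t|) : T -> R)) ->
  measurable_fun D ((fun t => `|g t|) : T -> R) ->
  (vnorm mu D p g < +oo)%E ->
  (forall n t, D t -> `|f n t| <= `|g t|) ->
  {ae mu, forall t, D t -> `|f n t| @[n --> \oo] --> 0} -> 0 < eps ->
  exists n0, forall n, (n0 <= n)%N -> (vnorm mu D p (f n) <= eps%:E)%E.
Proof.
move=> mD p0 mf mg gy fg f0 eps0.
have mfp n := measurable_norm_powR p (mf n).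
have ig : mu.-integrable D (fun t => (`|g t| `^ p)%:E).
  apply/integrableP; split; first exact: measurable_norm_powR.
  move: gy; rewrite vnormE// => /lty_poweRy H.
  have := H (invr_neq0 (lt0r_neq0 p0)); congr (_ < _)%E.
  by apply: eq_integral => t _ /=; rewrite ger0_norm ?powR_ge0.
have [||_ _ H] := dominated_convergence mD mfp (measurable_cst 0%E) _ ig.
- apply: filterS f0 => t f0 Dt; apply: cvg_EFin; first exact: nearW.
  rewrite -[X in _ --> X](powR0 (lt0r_neq0 p0)).
  by apply: cvg_powR => //; exact: f0.
- apply: nearW => t n Dt /=; rewrite lee_fin ger0_norm ?powR_ge0//.
  by apply: ge0_ler_powR; rewrite ?nnegrE ?(ltW p0)// fg.
rewrite integral0 in H.
have : \forall n \near \oo, (\int[mu]_(t in D) (`|f n t| `^ p)%:E < (eps `^ p)%:E)%E.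
  have e0 : (0%:E < (eps `^ p)%:E)%E by rewrite lte_fin powR_gt0.
  exact: (H _ (open_ereal_lt' e0)).
move=> [n0 _ Hn]; exists n0 => n n0n; rewrite vnorm_le_int ?(ltW eps0)//.
exact/ltW/Hn.
Qed.

End vnorm_limits.

(** Index 0 is reserved for the vector 0: the best approximation of [x] among [e 0, ..., e n] is
    then never farther from [x] than 0 is, which provides the dominating function for limits of
    simple maps. *)
Lemma separable_dense_sequence {R : realType} (E : normedModType R) : separable E ->
  exists e : nat -> E, e 0%N = 0 /\
    forall x eps, 0 < eps -> exists j, `|x - e j| < eps.
Proof.
move=> [A cA dA].
have ball_A (x : E) eps : 0 < eps -> exists2 a, A a & `|x - a| < eps.
  move=> eps0; have [||a [xa Aa]] := dA (ball x eps).
  - by exists x; exact: ballxx.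
  - exact: ball_open.
  by exists a => //; move: xa; rewrite -ball_normE.
have /countable_injP[f fA] := cA.
pose u k := xget 0 [set a | A a /\ f a = k].
exists (fun n => if n is m.+1 then u m else 0); split=> // x eps /(ball_A x)[a Aa xa].
exists (f a).+1; rewrite /u; case: xgetP => [y _ [Ay fy]|/(_ a)[]//].
by rewrite (fA _ _ _ _ fy) ?inE.
Qed.

(** For separable [E] this is a form of strong measurability that refers only to real functions and
    holds everywhere on [D]. [strongly_vmeasurable] and [vmeasurable_strongly] give the equivalence
    for Lebesgue sets. *)
Definition vmeasurable {d} {T : measurableType d} {R : realType}
    {E : normedModType R} (D : set T) (f : T -> E) :=
  forall e : E, measurable_fun D (fun t => `|f t - e|).

(** * Measurability through nearest points of a dense sequence *)

Section vmeasurable_theory.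
Context d (T : measurableType d) {R : realType} {E : normedModType R}.
Variable e : nat -> E.
Hypothesis e0 : e 0%N = 0.
Hypothesis e_dense : forall x eps, 0 < eps -> exists j, `|x - e j| < eps.
Implicit Types (D : set T) (f g : T -> E).

(** Least index of a point closest to [x] among [e 0, ..., e n]: the strict comparison settles ties
    in favour of the earlier one. *)
Fixpoint nearest (n : nat) (x : E) : nat :=
  if n is m.+1 then
    (if `|x - e m.+1| < `|x - e (nearest m x)| then m.+1 else nearest m x)
  else 0%N.

Lemma nearest_le n x : (nearest n x <= n)%N.
Proof. by elim: n => //= n IH; case: ifPn => // _; exact: leqW. Qed.

Lemma nearest_dist n j x : (j <= n)%N -> `|x - e (nearest n x)| <= `|x - e j|.
Proof.
elim: n => [|n IH]; first by rewrite leqn0 => /eqP ->.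
rewrite leq_eqVlt => /predU1P[->|/IH jn] /=; case: ifPn => //.
  by rewrite -leNgt.
by move=> /ltW/le_trans; apply.
Qed.

Lemma nearest_norm n x : `|x - e (nearest n x)| <= `|x|.
Proof. by rewrite (le_trans (nearest_dist x (leq0n n)))// e0 subr0. Qed.

Lemma cvg_nearest x : e (nearest n x) @[n --> \oo] --> x.
Proof.
apply/cvgrPdist_lt => eps /(e_dense x)[j xj].
exists j => // n /= jn; exact: le_lt_trans (nearest_dist _ jn) xj.
Qed.

(** [G] is arbitrary because the induction uses it twice: with the distances [|f t - e j|] for the
    test, and with the given family for the values. *)
Lemma measurable_nearest D f (G : nat -> T -> R) n : vmeasurable D f ->
  (forall j, measurable_fun D (G j)) ->
  measurable_fun D (fun t => G (nearest n (f t)) t).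
Proof.
move=> mf; elim: n G => [|n IH] G mG /=; first exact: mG.
rewrite (_ : (fun t => _) = fun t =>
    if `|f t - e n.+1| < `|f t - e (nearest n (f t))| then G n.+1 t
    else G (nearest n (f t)) t); last by apply/funext => t; case: ifP.
move=> mD; apply: (measurable_fun_if mD _ _ _ mD).
- apply: measurable_fun_ltr; first exact: mf.
  exact: (IH (fun j t => `|f t - e j|)).
- by apply: measurable_funS (mG _); [exact: mD|exact: subIsetl].
- by apply: measurable_funS (IH _ mG); [exact: mD|exact: subIsetl].
Qed.

(** Replace [f t] by its nearest point among the first [e j], where measurability in [t] alone
    suffices, and pass to the limit by continuity in the second variable. *)
Lemma measurable_caratheodory D f (H : T -> E -> R) : vmeasurable D f ->
  (forall x, measurable_fun D (H^~ x)) -> (forall t, D t -> continuous (H t)) ->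
  measurable_fun D (fun t => H t (f t)).
Proof.
move=> mf mH cH.
apply: (@measurable_fun_cvg _ _ _ _ (fun n t => H t (e (nearest n (f t))))).
  by move=> n; apply: (measurable_nearest (G := fun j t => H t (e j))).
move=> t Dt; apply: continuous_cvg; first exact: cH.
exact: cvg_nearest.
Qed.

Lemma vmeasurable_norm D f : vmeasurable D f -> measurable_fun D (fun t => `|f t|).
Proof.
by move=> /(_ 0); rewrite (_ : (fun t => _) = fun t => `|f t|)//;
  apply/funext => t; rewrite subr0.
Qed.

Lemma vmeasurableD D f g : vmeasurable D f -> vmeasurable D g ->
  vmeasurable D (fun t => f t + g t).
Proof.
move=> mf mg x; apply: (@measurable_caratheodory D f (fun t y => `|y + g t - x|)) => //.
  move=> y; have := mg (x - y); congr (measurable_fun D _).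
  by apply/funext => t; rewrite opprB addrCA addrA.
move=> t _ y; apply: cvg_norm; apply: cvgB; last exact: cvg_cst.
by apply: cvgD; [exact: cvg_id|exact: cvg_cst].
Qed.

Lemma vmeasurableZ D f (c : R) : vmeasurable D f -> vmeasurable D (fun t => c *: f t).
Proof.
move=> mf x; apply: (@measurable_caratheodory D f (fun t y => `|c *: y - x|)) => //.
move=> t _ y; apply: cvg_norm; apply: cvgB; last exact: cvg_cst.
by apply: cvgZr; exact: cvg_id.
Qed.

Lemma vmeasurableB D f g : vmeasurable D f -> vmeasurable D g ->
  vmeasurable D (fun t => f t - g t).
Proof.
move=> mf mg; have := vmeasurableD mf (vmeasurableZ (-1) mg).
by congr vmeasurable; apply/funext => t; rewrite scaleN1r.
Qed.

Lemma vmeasurable_cst D x : vmeasurable D (fun=> x : E).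
Proof. by move=> y; exact: measurable_cst. Qed.

Lemma vmeasurable_cvg D (f : nat -> T -> E) g : (forall n, vmeasurable D (f n)) ->
  (forall t, D t -> f n t @[n --> \oo] --> g t) -> vmeasurable D g.
Proof.
move=> mf fg x.
apply: (@measurable_fun_cvg _ _ _ _ (fun n t => `|f n t - x|)).
  by move=> n; exact: mf.
move=> t Dt; apply: cvg_norm; apply: cvgB; last exact: cvg_cst.
exact: fg.
Qed.

End vmeasurable_theory.

(** * The Bochner integral *)

Definition sint {d} {T : measurableType d} {R : realType}
    (mu : {measure set T -> \bar R}) {V : normedModType R} (D : set T) (s : T -> V) : V :=
  \sum_(v \in range s) fine (mu (D `&` s @^-1` [set v])) *: v.

Section sint_theory.
Context d (T : measurableType d) {R : realType} (mu : {measure set T -> \bar R}).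
Context {V : normedModType R}.
Variable (D : set T).
Hypotheses (mD : measurable D) (muD : (mu D < +oo)%E).

Let m A : (mu (D `&` A) < +oo)%E \/ ~ measurable (D `&` A).
Proof.
have [mA|] := pselect (measurable (D `&` A)); [left|by right].
by apply: le_lt_trans muD; exact: (le_measure mu (mem_set mA) (mem_set mD) (@subIsetl _ D A)).
Qed.

Let fin A : measurable (D `&` A) -> mu (D `&` A) \is a fin_num.
Proof. by move=> mA; rewrite ge0_fin_numE//; case: (m A). Qed.

(** The fibre of [h \o z] over [v] is the disjoint union of the fibres of [z] over the [c] with
    [h c = v]. Taking a pair for [z] puts two simple maps on a common partition, which gives
    additivity. *)
Lemma sint_comp (Z : choiceType) (z : T -> Z) (h : Z -> V) :
  finite_set (range z) -> (forall c, measurable (D `&` z @^-1` [set c])) ->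
  sint mu D (h \o z) =
  \sum_(c <- fset_set (range z)) fine (mu (D `&` z @^-1` [set c])) *: h c.
Proof.
move=> fz mz; set A := fset_set (range z).
have memA c : (c \in A) = (c \in range z) by rewrite in_fset_set.
have fhz : finite_set (range (h \o z)).
  rewrite (_ : range _ = h @` range z); first exact: finite_image.
  apply/seteqP; split=> [_ [t _ <-]|_ [_ [t _ <-] <-]]; last by exists t.
  by exists (z t) => //; exists t.
have fib v : fine (mu (D `&` (h \o z) @^-1` [set v])) =
    \sum_(c <- A | h c == v) fine (mu (D `&` z @^-1` [set c])).
  have -> : D `&` (h \o z) @^-1` [set v] =
      \big[setU/set0]_(c <- [fset c in A | h c == v]%fset) (D `&` z @^-1` [set c]).
    rewrite -bigcup_fset; apply/seteqP; split=> [t [Dt /= hv]|t [c /=]].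
      exists (z t) => //=; rewrite !inE/= memA hv eqxx andbT.
      by apply/mem_set; exists t.
    by rewrite !inE/= => /andP[_ /eqP hc] [Dt /= ->].
  rewrite measure_fbigsetU//; last first.
    by move=> c c' _ _ [t [[_ /= <-] [_ /= <-]]].
  rewrite (eq_bigr (fun c => (fine (mu (D `&` z @^-1` [set c])))%:E)); last first.
    by move=> c _; rewrite fineK ?fin.
  rewrite sumEFin/=.
  by rewrite [RHS]big_fset_condE.
rewrite /sint fsbig_finite//=.
under eq_bigr do rewrite fib scaler_suml.
rewrite (exchange_big_dep xpredT)//=; apply: eq_big_seq => c cA.
rewrite big_mkcond/=.
rewrite (bigD1_seq (h c))//= ?fset_uniq//; last first.
  rewrite in_fset_set//; apply/mem_set.
  by move: cA; rewrite memA => /set_mem[t _ <-]; exists t.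
rewrite eqxx big1 ?addr0// => v /negPf; by rewrite eq_sym => ->.
Qed.

Lemma sint_norm (s : T -> V) :
  finite_set (range s) -> (forall v, measurable (D `&` s @^-1` [set v])) ->
  (`|sint mu D s|%:E <= \int[mu]_(t in D) `|s t|%:E)%E.
Proof.
move=> fs ms; rewrite /sint fsbig_finite//=.
set A := fset_set (range s).
have DA : D = \big[setU/set0]_(v <- A) (D `&` s @^-1` [set v]).
  rewrite -bigcup_fset; apply/seteqP; split=> [t Dt|t [v _ []//]].
  by exists (s t) => //=; rewrite in_fset_set//; apply/mem_set; exists t.
have -> : (\int[mu]_(t in D) `|s t|%:E =
    \sum_(v <- A) (fine (mu (D `&` s @^-1` [set v])) * `|v|)%:E)%E.
  rewrite [in LHS]DA ge0_integral_bigsetU//=.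
  - apply: eq_bigr => v _; rewrite EFinM fineK ?fin// muleC -integral_cst//.
    by apply: eq_integral => t; rewrite inE => -[_ /= ->].
  - by move=> v w _ _ [t [[_ /= <-] [_ /= <-]]].
  - rewrite -DA; apply/measurable_EFinP => _ B mB.
    rewrite (_ : _ `&` _ = \bigcup_(v in range s `&` [set v | B `|v|])
      (D `&` s @^-1` [set v])).
      by apply: fin_bigcup_measurable => //; exact: finite_setIl.
    apply/seteqP; split=> [t [Dt /= Bt]|t [v [_ Bv] [Dt /= sv]]].
      by exists (s t) => //; split => //; exists t.
    by split => //=; rewrite sv.
rewrite sumEFin lee_fin (le_trans (ler_norm_sum _ _ _))//.
by apply: ler_sum => v _; rewrite normrZ ger0_norm// fine_ge0.
Qed.

End sint_theory.

Definition extend0 {T : Type} {V : nmodType} (D : set T) (f : T -> V) : T -> V :=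
  fun t => if t \in D then f t else 0.

Section extend0_theory.
Context d (T : measurableType d) {R : realType} (mu : {measure set T -> \bar R}).
Context {V : normedModType R}.
Variables (D I : set T).
Hypotheses (mD : measurable D) (mI : measurable I) (DI : D `<=` I).

Lemma vmeasurable_extend0 (f : T -> V) : vmeasurable D f -> vmeasurable I (extend0 D f).
Proof.
move=> mf e; rewrite /extend0.
rewrite (_ : (fun t => _) = fun t => if t \in D then `|f t - e| else `|0 - e|); last first.
  by apply/funext => t; case: ifP.
have mID : measurable_fun I (fun t => t \in D).
  move=> _; apply: (@measurable_fun_bool _ _ _ _ true) => //.
  rewrite (_ : _ @^-1` _ = D); last first.
    by apply/seteqP; split=> t /=; [exact: set_mem|exact: mem_set].
  exact: measurableI.
apply: (measurable_fun_if mI mID); last exact: measurable_cst.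
have -> : I `&` (fun t => t \in D) @^-1` [set true] = D.
  apply/seteqP; split=> [t [_ /set_mem]//|t Dt]; split; first exact: DI.
  exact: mem_set.
exact: mf.
Qed.

Lemma integral_extend0 (f : T -> V) :
  (\int[mu]_(t in I) `|extend0 D f t|%:E = \int[mu]_(t in D) `|f t|%:E)%E.
Proof.
rewrite -[in RHS](setIidr DI) integral_mkcondr; apply: eq_integral => t _.
rewrite patchE /extend0; case: ifP => // _; by rewrite normr0.
Qed.

(** Pairing [s t] with the membership [t \in D] separates the value 0 taken inside [D] from the 0
    created by the extension; the parts outside [D] contribute nothing to either sum. *)
Lemma sint_extend0 (s : T -> V) : (mu I < +oo)%E -> finite_set (range s) ->
  (forall v, measurable (D `&` s @^-1` [set v])) ->
  (forall v, measurable (I `&` s @^-1` [set v])) ->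
  sint mu I (extend0 D s) = sint mu D s.
Proof.
move=> muI fs msD msI.
have muD : (mu D < +oo)%E.
  by apply: le_lt_trans muI; exact: (le_measure mu (mem_set mD) (mem_set mI) DI).
pose z t := (s t, t \in D).
have fz : finite_set (range z).
  apply: sub_finite_set (finite_image2 (fun a b => (a, b)) fs (@finite_finset bool setT)).
  by move=> _ [t _ <-] /=; exists (s t); [exists t|exists (t \in D)].
have zD v b : D `&` z @^-1` [set (v, b)] = if b then D `&` s @^-1` [set v] else set0.
  case: b; apply/seteqP; split=> t //=.
  - by move=> [Dt [<- _]].
  - by move=> [Dt <-]; split => //; rewrite /z mem_set.
  - by move=> [Dt [_]]; rewrite mem_set.
have zI v b : I `&` z @^-1` [set (v, b)] =
    if b then D `&` s @^-1` [set v] else (I `\` D) `&` s @^-1` [set v].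
  case: b; apply/seteqP; split=> t //=.
  - by move=> [_ [<-]] /set_mem.
  - by move=> [Dt <-]; split; [exact: DI|rewrite /z mem_set].
  - by move=> [It [<-]] /negbT; rewrite notin_setE.
  - by move=> [[It Dt] <-]; split => //; rewrite /z memNset.
rewrite (sint_comp mI muI (z := z) (fun c => if c.2 then c.1 else 0)) //; last first.
  move=> [v []]; rewrite zI//.
  rewrite (_ : _ `&` _ = (I `&` s @^-1` [set v]) `\` D).
    exact: measurableD.
  by apply/seteqP; split=> t /= [[]].
rewrite -[RHS]/(sint mu D (fst \o z)).
rewrite (sint_comp mD muD (z := z) fst) //; last first.
  by move=> [v []]; rewrite zD.
apply: eq_bigr => -[v b] _; rewrite zD zI.
by case: b => //=; rewrite measure0 scaler0 scale0r.
Qed.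

End extend0_theory.

Section bochner_integral_theory.
Context {R : realType}.
Local Notation mu := (lebesgueR R).
Local Notation Leb := (lebR R).

Lemma strongly_vmeasurable {V : normedModType R} (D : set Leb) (f : R -> V) :
  measurable D -> strongly_measurable D f -> vmeasurable D (f : Leb -> V).
Proof.
move=> mD mf e.
have me : strongly_measurable D (fun=> e : V).
  exists (fun n t => e); split=> [_|]; last by apply: nearW => t _; exact: cvg_cst.
  split=> [|v]; first exact: finite_image_cst.
  by rewrite preimage_cst; case: ifP.
have := measurable_norm_strongly_measurable mD (strongly_measurableB mf me).
by move=> /(measurable_restrictT _ mD).
Qed.

Lemma simple_function_comp2 {U V W : normedModType R} (s : R -> U) (r : R -> V)
    (h : U -> V -> W) :
  simple_function s -> simple_function r -> simple_function (fun t => h (s t) (r t)).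
Proof.
move=> [fs ms] [fr mr]; split.
  apply: sub_finite_set (finite_image2 h fs fr).
  by move=> _ [t _ <-] /=; exists (s t); [exists t|exists (r t) => //; exists t].
move=> v; rewrite (_ : _ @^-1` _ = \bigcup_(c in (range s `*` range r) `&`
    [set c | h c.1 c.2 = v]) (s @^-1` [set c.1] `&` r @^-1` [set c.2])).
  apply: fin_bigcup_measurable => [|c _]; last exact: measurableI.
  by apply: finite_setIl; exact: finite_setX.
apply/seteqP; split=> [t /= tv|t [[a b] [_ /= abv] [/= -> ->]]//].
by exists (s t, r t) => //; split => //; split; exists t.
Qed.

Lemma simple_function_extend0 {V : normedModType R} (D : set Leb) (s : R -> V) :
  measurable D -> simple_function s -> simple_function (extend0 D s).
Proof.
move=> mD [fs ms]; split.
  apply: (@sub_finite_set _ _ (0 |` range s)); last by rewrite finite_setU; split.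
  move=> _ [t _ <-] /=; rewrite /extend0; case: ifP => _; last by left.
  by right; exists t.
move=> v; have [->|v0] := eqVneq v 0.
  rewrite (_ : _ @^-1` _ = ~` D `|` (D `&` s @^-1` [set 0])).
    by apply: measurableU; [exact: measurableC|exact: measurableI].
  apply/seteqP; split=> t /=; rewrite /extend0.
    by case: ifP => [/set_mem Dt ->|/negbT/negP Dt _]; [right|left; move: Dt; rewrite inE].
  by move=> [Dt|[Dt st]]; [rewrite memNset|rewrite mem_set].
rewrite (_ : _ @^-1` _ = D `&` s @^-1` [set v]); first exact: measurableI.
apply/seteqP; split=> t /=; rewrite /extend0.
  by case: ifP => [/set_mem Dt ->//|_ /esym/eqP]; rewrite (negPf v0).
by move=> [Dt <-]; rewrite mem_set.
Qed.

End bochner_integral_theory.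

Lemma vnorm1 d (T : measurableType d) {R : realType} (mu : {measure set T -> \bar R})
    (V : normedModType R) (D : set T) (f : T -> V) :
  vnorm mu D 1 f = (\int[mu]_(t in D) `|f t|%:E)%E.
Proof.
rewrite vnormE// invr1 poweRe1.
  by apply: eq_integral => t _; rewrite powRr1.
by apply: integral_ge0 => t _; rewrite lee_fin powR_ge0.
Qed.

Lemma le_integral_normD d (T : measurableType d) {R : realType}
    (mu : {measure set T -> \bar R}) (U V W : normedModType R) (D : set T)
    (f : T -> U) (g : T -> V) (h : T -> W) : measurable D ->
  measurable_fun D (fun t => `|f t|) -> measurable_fun D (fun t => `|g t|) ->
  measurable_fun D (fun t => `|h t|) ->
  (forall t, D t -> `|f t| <= `|g t| + `|h t|) ->
  (\int[mu]_(t in D) `|f t|%:E <=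
   \int[mu]_(t in D) `|g t|%:E + \int[mu]_(t in D) `|h t|%:E)%E.
Proof.
move=> mD mf mg mh fgh; rewrite -!vnorm1.
by apply: le_vnormD => //; exact: nearW.
Qed.

Section bochner_integral.
Context {R : realType} {E : completeNormedModType R}.
Local Notation mu := (lebesgueR R).
Local Notation Leb := (lebR R).
Variable e : nat -> E.
Hypothesis e0 : e 0%N = 0.
Hypothesis e_dense : forall x eps, 0 < eps -> exists j, `|x - e j| < eps.

Lemma simple_vmeasurable (D : set Leb) (s : R -> E) : measurable D ->
  simple_function s -> vmeasurable D (s : Leb -> E).
Proof.
move=> mD ss; apply: strongly_vmeasurable => //.
by exists (fun=> s); split => //; apply: nearW => t _; exact: cvg_cst.
Qed.

Lemma simple_nearest (D : set Leb) (f : R -> E) n : measurable D ->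
  vmeasurable D (f : Leb -> E) ->
  simple_function (extend0 D (fun t : Leb => e (nearest e n (f t)))).
Proof.
move=> mD mf; split.
  apply: (@sub_finite_set _ _ (0 |` (e @` `I_n.+1))).
    move=> _ [t _ <-]; rewrite /extend0; case: ifP => _; last by left.
    by right; exists (nearest e n (f t)) => //=; rewrite ltnS nearest_le.
  by rewrite finite_setU; split => //; apply: finite_image; exact: finite_II.
(* The level set is the preimage of 1 under a 0-1 function of the index of the nearest point, which
   [measurable_nearest] handles. *)
have mDv v : measurable (D `&` (fun t : Leb => e (nearest e n (f t))) @^-1` [set v]).
  have := @measurable_nearest _ _ _ _ e D f (fun j t => (e j == v)%:R) n mf
    (fun j => measurable_cst _) mD [set 1] (measurable_set1 _).
  congr measurable; congr (_ `&` _); apply/seteqP; split=> t /=.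
    by case: eqP => // _ /esym/eqP; rewrite oner_eq0.
  by move=> ->; rewrite eqxx.
move=> v; have [->|v0] := eqVneq v 0.
  rewrite (_ : _ @^-1` _ =
      ~` D `|` (D `&` (fun t : Leb => e (nearest e n (f t))) @^-1` [set 0])).
    by apply: measurableU; [exact: measurableC|exact: mDv].
  apply/seteqP; split=> t /=; rewrite /extend0.
    by case: ifP => [/set_mem Dt ->|/negbT/negP Dt _]; [right|left; move: Dt; rewrite inE].
  by move=> [Dt|[Dt st]]; [rewrite memNset|rewrite mem_set].
rewrite (_ : _ @^-1` _ = D `&` (fun t : Leb => e (nearest e n (f t))) @^-1` [set v]).
  exact: mDv.
apply/seteqP; split=> t /=; rewrite /extend0.
  by case: ifP => [/set_mem Dt ->//|_ /esym/eqP]; rewrite (negPf v0).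
by move=> [Dt <-]; rewrite mem_set.
Qed.

Lemma vmeasurable_strongly (D : set Leb) (f : R -> E) : measurable D ->
  vmeasurable D (f : Leb -> E) -> strongly_measurable D f.
Proof.
move=> mD mf.
exists (fun n => extend0 D (fun t : Leb => e (nearest e n (f t)))); split => [n|].
  exact: simple_nearest.
apply: nearW => t Dt; rewrite /extend0 mem_set//; exact: (cvg_nearest e_dense).
Qed.

Lemma sintB (D : set Leb) (s r : R -> E) : measurable D -> (mu D < +oo)%E ->
  simple_function s -> simple_function r ->
  sint mu D (fun t => s t - r t) = sint mu D s - sint mu D r.
Proof.
move=> mD muD [fs ms] [fr mr].
pose z (t : Leb) := (s t, r t).
have fz : finite_set (range z).
  apply: sub_finite_set (finite_image2 (fun a b => (a, b)) fs fr).
  by move=> _ [t _ <-] /=; exists (s t); [exists t|exists (r t) => //; exists t].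
have mz c : measurable (D `&` z @^-1` [set c]).
  apply: measurableI => //; rewrite (_ : _ @^-1` _ =
    s @^-1` [set c.1] `&` r @^-1` [set c.2]); first exact: measurableI.
  by case: c => a b; apply/seteqP; split=> t /=; rewrite /z; [case=> -> ->|case=> -> ->].
have H (h : (E * E)%type -> E) := sint_comp mD muD (z := z) h fz mz.
have H1 := H (fun c => c.1 - c.2); have H2 := H fst; have H3 := H snd.
rewrite -[LHS]/(sint mu D ((fun c => c.1 - c.2) \o z)) H1.
rewrite -[sint mu D s]/(sint mu D (fst \o z)) H2.
rewrite -[sint mu D r]/(sint mu D (snd \o z)) H3.
by rewrite -sumrB; apply: eq_bigr => c _; rewrite scalerBr.
Qed.

(** The estimate passes to the limit from simple maps, where it is [sintB] and [sint_norm]. It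
    stands in for linearity of the integral and, with [f = g], contains its uniqueness. *)
Lemma bochner_integral_dist (D : set Leb) (f g : R -> E) v w :
  measurable D -> (mu D < +oo)%E ->
  is_bochner_integral D f v -> is_bochner_integral D g w ->
  (`|v - w|%:E <= \int[mu]_(t in D) `|f t - g t|%:E)%E.
Proof.
move=> mD muD [mf [s [ss _ sf sv]]] [mg [r [sr _ rg rw]]].
have vf := strongly_vmeasurable mD mf; have vg := strongly_vmeasurable mD mg.
have vs n := simple_vmeasurable mD (ss n); have vr n := simple_vmeasurable mD (sr n).
have mn (u u' : Leb -> E) : vmeasurable D u -> vmeasurable D u' ->
    measurable_fun D (fun t => `|u t - u' t|).
  by move=> mu mu'; exact/vmeasurable_norm/(vmeasurableB e_dense).
apply/lee_addgt0Pr => eps eps_gt0.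
(* Four errors of [eps / 4]: two for replacing the maps by simple ones, two for replacing the
   integrals. *)
have e4 : (0%:E < (eps / 4)%:E)%E by rewrite lte_fin divr_gt0.
have [n1 _ H1] := sf _ (open_ereal_lt' e4).
have [n2 _ H2] := rg _ (open_ereal_lt' e4).
have e4' : 0 < eps / 4 by rewrite divr_gt0.
have /cvgrPdist_lt/(_ _ e4')[n3 _ H3] := sv.
have /cvgrPdist_lt/(_ _ e4')[n4 _ H4] := rw.
pose n := (n1 + n2 + n3 + n4)%N.
have {}H1 := H1 n ltac:(by rewrite /= /n -!addnA leq_addr).
have {}H2 := H2 n ltac:(by rewrite /= /n -!addnA addnCA leq_addr).
have {}H3 : `|v - sint mu D (s n)| < eps / 4 := H3 n ltac:(by rewrite /= /n addnAC leq_addl).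
have {}H4 : `|w - sint mu D (r n)| < eps / 4 := H4 n ltac:(by rewrite /= /n leq_addl).
have Hs : (`|sint mu D (s n) - sint mu D (r n)|%:E <=
    \int[mu]_(t in D) `|s n t - r n t|%:E)%E.
  rewrite -sintB//; apply: sint_norm => //.
    by have [] := simple_functionB (ss n) (sr n).
  by move=> c; apply: measurableI => //; have [_] := simple_functionB (ss n) (sr n).
have Hi : (\int[mu]_(t in D) `|s n t - r n t|%:E <=
    \int[mu]_(t in D) `|f t - s n t|%:E + (\int[mu]_(t in D) `|f t - g t|%:E +
    \int[mu]_(t in D) `|g t - r n t|%:E))%E.
  apply: (@le_trans _ _ (\int[mu]_(t in D) `|f t - s n t|%:E +
      \int[mu]_(t in D) `|f t - r n t|%:E)%E).
    apply: le_integral_normD (mD) (mn _ _ _ _) (mn _ _ _ _) (mn _ _ _ _) _ => //.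
    by move=> t _; rewrite (distrC (f t)) ler_distD.
  apply: leeD => //.
  apply: le_integral_normD (mD) (mn _ _ _ _) (mn _ _ _ _) (mn _ _ _ _) _ => //.
  by move=> t _; rewrite ler_distD.
have Hv : `|v - w| <= eps / 2 + `|sint mu D (s n) - sint mu D (r n)|.
  rewrite (le_trans (ler_distD (sint mu D (s n)) _ _))//.
  rewrite (le_trans (lerD (lexx _) (ler_distD (sint mu D (r n)) _ _)))//.
  by rewrite (distrC _ w); clear - H3 H4; lra.
apply: (@le_trans _ _ ((eps / 2)%:E + `|sint mu D (s n) - sint mu D (r n)|%:E)%E).
  by rewrite -EFinD lee_fin.
have C0 : (0 <= \int[mu]_(t in D) `|f t - g t|%:E)%E.
  by apply: integral_ge0 => t _; rewrite lee_fin.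
move: H1 H2 Hs Hi C0 => /=.
move: (\int[mu]_(t in D) `|f t - s n t|%:E)%E => A.
move: (\int[mu]_(t in D) `|g t - r n t|%:E)%E => B.
move: (\int[mu]_(t in D) `|f t - g t|%:E)%E => [c| |]// A4 B4 Hs Hi _;
  last by rewrite addye// leey.
have {Hi}Hs := le_trans Hs Hi.
have : (A + (c%:E + B) <= (eps / 4)%:E + (c%:E + (eps / 4)%:E))%E.
  by apply: leeD; [exact: ltW|apply: leeD => //; exact: ltW].
move=> /(le_trans Hs); rewrite -!EFinD !lee_fin => {}Hs.
by clear - Hs; lra.
Qed.

End bochner_integral.

Lemma cvg_ereal0 {R : realType} (u : nat -> \bar R) : (forall n, (0 <= u n)%E) ->
  (forall eps, 0 < eps -> exists n0, forall n, (n0 <= n)%N -> (u n <= eps%:E)%E) ->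
  u n @[n --> \oo] --> 0%E.
Proof.
move=> u0 uP; apply/fine_cvgP; split.
  have [n0 H] := uP 1 ltr01; exists n0 => // n /H un.
  by rewrite ge0_fin_numE// (le_lt_trans un)// ltry.
apply/cvgrPdist_le => eps /uP[n0 H]; exists n0 => // n /H un.
rewrite sub0r normrN /= ger0_norm ?fine_ge0// -lee_fin fineK//.
by rewrite ge0_fin_numE// (le_lt_trans un)// ltry.
Qed.

Lemma cauchy_sequence_cvg {R : realType} {E : completeNormedModType R} (u : nat -> E) :
  (forall eps, 0 < eps -> exists n0, forall n m, (n0 <= n)%N -> (n0 <= m)%N ->
     `|u n - u m| < eps) ->
  exists l : E, u n @[n --> \oo] --> l.
Proof.
move=> uC; apply/(@cvg_ex E).
have : cauchy_ex (u @ \oo); last by move=> /(cauchy_exP (u @ \oo))/cauchy_cvg.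
move=> eps /uC[n0 H].
exists (u n0); exists n0 => // n n0n.
by rewrite -ball_normE /ball_/=; exact: H.
Qed.

Lemma third_lt {R : realType} (x : R) : 0 < x -> x / 3 + x / 3 < x.
Proof. by move=> x0; lra. Qed.

Section bochner_integral_existence.
Context {R : realType} {E : completeNormedModType R}.
Local Notation mu := (lebesgueR R).
Local Notation Leb := (lebR R).
Variable e : nat -> E.
Hypothesis e0 : e 0%N = 0.
Hypothesis e_dense : forall x eps, 0 < eps -> exists j, `|x - e j| < eps.

(** Extending the approximating simple maps by 0 changes neither errors nor integrals. In this way
    integrals over the varying intervals [[0, t]] become integrals over one interval and can be
    compared. *)
Lemma is_bochner_integral_extend0 (D I : set Leb) (f : R -> E) v :
  measurable D -> measurable I -> D `<=` I -> (mu I < +oo)%E ->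
  is_bochner_integral D f v -> is_bochner_integral I (extend0 D f) v.
Proof.
move=> mD mI DI muI [[s' [ss' sf']] [s [ss _ sf sv]]]; split.
  exists (fun n => extend0 D (s' n)); split.
    by move=> n; exact: simple_function_extend0.
  apply: filterS sf' => t H It; rewrite /extend0; case: ifP => [/set_mem//|_].
  exact: cvg_cst.
exists (fun n => extend0 D (s n)); split.
- by move=> n; exact: simple_function_extend0.
- move=> n u _; apply: le_lt_trans muI.
  have mu' : measurable (I `&` extend0 D (s n) @^-1` [set u]).
    by apply: measurableI => //; have [_] := simple_function_extend0 mD (ss n).
  exact: (le_measure mu (mem_set mu') (mem_set mI) (@subIsetl _ _ _)).
- rewrite (_ : (fun n => _) = fun n => (\int[mu]_(t in D) `|f t - s n t|%:E)%E) //.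
  apply/funext => n; rewrite -(integral_extend0 mu (D := D) (I := I))//.
  apply: eq_integral => t _; rewrite /extend0; case: ifP => //.
  by rewrite subr0.
- rewrite (_ : (fun n => _) = fun n => simple_integral D (s n)) //.
  apply/funext => n; have [fs ms] := ss n.
  exact: (sint_extend0 mD mI DI muI fs (fun u => measurableI _ _ mD (ms u))
    (fun u => measurableI _ _ mI (ms u))).
Qed.

(** The nearest-point maps [s n] satisfy [|f - s n| <= |f|] because [e 0 = 0], so dominated
    convergence makes them converge in mean. Their integrals are then Cauchy by [sint_norm], and [E]
    is complete. *)
Lemma bochner_integral_exists (D : set Leb) (f : R -> E) :
  measurable D -> (mu D < +oo)%E -> vmeasurable D (f : Leb -> E) ->
  (\int[mu]_(t in D) `|f t|%:E < +oo)%E -> exists v, is_bochner_integral D f v.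
Proof.
move=> mD muD mf fy.
have sf := vmeasurable_strongly e_dense mD mf.
pose s n := extend0 D (fun t : Leb => e (nearest e n (f t))).
have ss n : simple_function (s n) by exact: simple_nearest.
have vs n : vmeasurable D (s n : Leb -> E) := simple_vmeasurable mD (ss n).
have mn (u u' : Leb -> E) : vmeasurable D u -> vmeasurable D u' ->
    measurable_fun D (fun t => `|u t - u' t|).
  by move=> mu mu'; exact/vmeasurable_norm/(vmeasurableB e_dense).
have H eps : 0 < eps -> exists n0, forall n, (n0 <= n)%N ->
    (\int[mu]_(t in D) `|f t - s n t|%:E <= eps%:E)%E.
  move=> eps0.
  have [|||n0 H] := @vnorm_dominated _ Leb R mu E E D 1 (fun n t => f t - s n t) f eps
    mD ltr01 (fun n => mn _ _ mf (vs n)) (vmeasurable_norm mf) _ _ _ eps0.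
  - by rewrite vnorm1.
  - move=> n t Dt; rewrite /s /extend0 mem_set//; exact: nearest_norm.
  - apply: nearW => t Dt; apply/cvgr0Pnorm_lt => d d0.
    have /cvgrPdist_lt/(_ _ d0) := @cvg_nearest R E e e_dense (f t).
    by apply: filterS => n; rewrite /s /extend0 mem_set// normr_id.
  by exists n0 => n /H; rewrite vnorm1.
have int0 n : (0 <= \int[mu]_(t in D) `|f t - s n t|%:E)%E.
  by apply: integral_ge0 => t _; rewrite lee_fin.
have [v sv] : exists v : E, simple_integral D (s n) @[n --> \oo] --> v.
  apply: (@cauchy_sequence_cvg R E (fun n => simple_integral D (s n))) => eps eps0.
  have [n0 Hn0] := H (eps / 3) ltac:(by rewrite divr_gt0).
  exists n0 => n m /Hn0 Hn /Hn0 Hm.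
  rewrite -/(sint mu D (s n)) -/(sint mu D (s m)) -sintB//.
  have sB := simple_functionB (ss n) (ss m).
  rewrite -lte_fin; apply: (@le_lt_trans _ _ (eps / 3 + eps / 3)%:E); last first.
    by rewrite lte_fin; exact: third_lt.
  apply: (le_trans (sint_norm mD muD _ _)).
  - by case: sB.
  - by move=> c; apply: measurableI => //; case: sB.
  rewrite EFinD; apply: le_trans (leeD Hn Hm).
  apply: le_integral_normD (mD) (mn _ _ _ _) (mn _ _ _ _) (mn _ _ _ _) _ => //.
  by move=> t _; rewrite (distrC (f t)) ler_distD.
exists v; split => //; exists s; split => //.
- move=> n u _; apply: le_lt_trans muD.
  have mu' : measurable (D `&` s n @^-1` [set u]).
    by apply: measurableI => //; have [_] := ss n.
  exact: (le_measure mu (mem_set mu') (mem_set mD) (@subIsetl _ _ _)).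
- exact: cvg_ereal0.
Qed.

Lemma bochner_integralP (D : set Leb) (f : R -> E) :
  measurable D -> (mu D < +oo)%E -> vmeasurable D (f : Leb -> E) ->
  (\int[mu]_(t in D) `|f t|%:E < +oo)%E ->
  is_bochner_integral D f (bochner_integral D f).
Proof.
move=> mD muD mf fy; have [v vP] := bochner_integral_exists mD muD mf fy.
by apply: (@xgetPex _ 0 (is_bochner_integral D f)); exists v.
Qed.

End bochner_integral_existence.

Lemma endoL_norm_le {R : realType} {E : normedModType R} (f : endoL E) (x : E) :
  `|f x| <= `|f| * `|x|.
Proof.
have [->|x0] := eqVneq x 0; first by rewrite linear0 !normr0 mulr0.
have nx : 0 < `|x| by rewrite normr_gt0.
have : `|f (`|x|^-1 *: x)| <= `|f|.
  by apply: opnorm_ub; rewrite normrZ normfV normr_id mulVf ?gt_eqF.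
by rewrite linearZ normrZ normfV normr_id ler_pdivrMl// mulrC.
Qed.

Lemma endoLBE {R : realType} {E : normedModType R} (f g : endoL E) (x : E) :
  (f - g) x = f x - g x.
Proof. by []. Qed.

Section bochner_norm_bridge.
Context {R : realType}.
Local Notation mu := (lebesgueR R).
Local Notation Leb := (lebR R).

Lemma bochner_normV {V : normedModType R} (D : set Leb) p (f : R -> V) :
  bochner_norm D p f = vnorm mu D p (f : Leb -> V).
Proof. by []. Qed.

Lemma strongly_measurable_norm {V : normedModType R} (D : set Leb) (f : R -> V) :
  measurable D -> strongly_measurable D f ->
  measurable_fun D ((fun t => `|f t|) : Leb -> R).
Proof. by move=> mD mf; apply: vmeasurable_norm; exact: strongly_vmeasurable. Qed.

Lemma strongly_measurable_apply {E : normedModType R} (D : set Leb)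
    (f : R -> endoL E) (g : R -> E) :
  strongly_measurable D f -> strongly_measurable D g ->
  strongly_measurable D (fun s => f s (g s)).
Proof.
move=> [s [ss sf]] [r [sr rg]]; exists (fun n t => s n t (r n t)); split.
  by move=> n; exact: (@simple_function_comp2 R (endoL E) E E _ _ (fun f => f) (ss n) (sr n)).
apply: filterS2 sf rg => t sf rg Dt; have {}sf := sf Dt; have {}rg := rg Dt.
have c : `|f t| * `|r n t - g t| + `|s n t - f t| * `|r n t| @[n --> \oo] --> 0.
  rewrite [X in _ --> X](_ : 0 = `|f t| * `|g t - g t| + `|f t - f t| * `|g t|); last first.
    by rewrite !subrr !normr0 mulr0 mul0r addr0.
  apply: cvgD; apply: cvgM.
  - exact: cvg_cst.
  - by apply: cvg_norm; apply: cvgB; [exact: rg|exact: cvg_cst].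
  - by apply: cvg_norm; apply: cvgB; [exact: sf|exact: cvg_cst].
  - exact: cvg_norm.
apply/cvgrPdist_lt => eps eps0.
have : \forall n \near \oo, `|f t| * `|r n t - g t| + `|s n t - f t| * `|r n t| < eps.
  exact: (cvgr_lt 0 c).
apply: filterS => n; apply: le_lt_trans.
rewrite distrC (_ : s n t (r n t) - f t (g t) =
  f t (r n t - g t) + (s n t - f t) (r n t)); last first.
  by rewrite endoLBE linearB [RHS]addrC addrA subrK.
by rewrite (le_trans (ler_normD _ _))// lerD// endoL_norm_le.
Qed.

End bochner_norm_bridge.

Section Lp_space_theory.
Context {R : realType} (a b p : R) (p1 : 1 <= p) {V : normedModType R}.
Local Notation mu := (lebesgueR R).
Local Notation I := (`[a, b]%classic : set (lebR R)).
Local Notation Lp := (Lp_space a b V p1).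

Lemma Lp_repr_class (f : R -> V) : Lp_fun I p f ->
  {ae mu, forall t, I t -> Lp_repr (Lp_class a b p1 f) t = f t}.
Proof.
move=> fL; rewrite /Lp_repr /Lp_class.
set g := insubd _ f; have gf : val g = f by rewrite insubdK//; exact: mem_set.
have : (repr (\pi_(Lp) g) = g %[mod Lp])%qT by rewrite reprK.
by move=> /eqmodP/asboolP; apply: filterS => t H It; rewrite H// gf.
Qed.

Lemma Lp_eq_class (w : Lp) (f : R -> V) : Lp_fun I p f ->
  {ae mu, forall t, I t -> Lp_repr w t = f t} -> Lp_class a b p1 f = w.
Proof.
move=> fL wf; rewrite -[w]reprK /Lp_class; apply/eqmodP/asboolP.
rewrite insubdK ?mem_set//.
by apply: filterS wf => t wf It; rewrite -wf.
Qed.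

Lemma Lp_mdistE (v w : Lp) (f g : R -> V) : Lp_fun I p f -> Lp_fun I p g ->
  {ae mu, forall t, I t -> Lp_repr v t = f t} ->
  {ae mu, forall t, I t -> Lp_repr w t = g t} ->
  mdist v w = fine (bochner_norm I p (fun t => f t - g t)).
Proof.
move=> [mf _] [mg _] vf wg; rewrite -[LHS]/(fine _); congr fine.
have [mv _] := Lp_reprP v; have [mw _] := Lp_reprP w.
have p0 : 0 < p by rewrite (lt_le_trans _ p1).
have mI := measurable_cc a b : measurable I.
have m1 := strongly_measurable_norm mI (strongly_measurableB mv mw).
have m2 := strongly_measurable_norm mI (strongly_measurableB mf mg).
apply/eqP; rewrite eq_le; apply/andP; split.
  apply: (le_vnorm mI p0 m1 m2).
  by apply: filterS2 vf wg => t vf wg It; rewrite vf// wg.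
apply: (le_vnorm mI p0 m2 m1).
by apply: filterS2 vf wg => t vf wg It; rewrite vf// wg.
Qed.

End Lp_space_theory.

Lemma within_continuousP {R : realType} {V : normedModType R} (A : set R) (f : R -> V) :
  {within A, continuous f} <-> forall t eps, A t -> 0 < eps ->
    exists2 del, 0 < del & forall t', A t' -> `|t - t'| < del -> `|f t - f t'| < eps.
Proof.
rewrite subspace_continuousP; split=> [H t eps At eps0|H t At].
  have /cvgrPdist_lt/(_ _ eps0)/nbhs_ballP[del /= del0 D] := H t At.
  by exists del => // t' At' tt'; exact: D.
apply/cvgrPdist_lt => eps eps0; have [del del0 D] := H t eps At eps0.
by apply/nbhs_ballP; exists del => // t' tt' At'; exact: D.
Qed.

Lemma within_continuous_bounded {R : realType} {V : normedModType R} (a b : R)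
    (f : R -> V) : a <= b -> {within `[a, b], continuous f} ->
  exists C, forall t, t \in `[a, b] -> `|f t| <= C.
Proof.
move=> ab /within_continuousP cf.
have [c _ cP] : exists2 c, c \in `[a, b]%R &
    forall t, t \in `[a, b]%R -> `|f t| <= `|f c|.
  apply: (@EVT_max _ (fun t => `|f t|)) => //; apply/within_continuousP => t eps At eps0.
  have [del del0 H] := cf t eps At eps0; exists del => // t' At' /(H t' At').
  by apply: le_lt_trans; exact: ler_dist_dist.
by exists `|f c|.
Qed.

Section vnorm_extend0.
Context d (T : measurableType d) {R : realType} (mu : {measure set T -> \bar R}).

Lemma vnorm_extend0 {V : normedModType R} (D I : set T) p (f : T -> V) : D `<=` I ->
  vnorm mu I p (extend0 D f) = vnorm mu D p f.
Proof.
move=> DI; apply: eq_Lnorm => t /=; rewrite !patchE /extend0.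
have [tD|tD] := boolP (t \in D); first by rewrite mem_set//; exact/DI/set_mem.
by rewrite normr0; case: ifP.
Qed.

Lemma integral_le_hoelder {U V W : normedModType R} (D : set T) p q
    (f : T -> U) (g : T -> V) (h : T -> W) :
  measurable D -> 0 < p -> 0 < q -> p^-1 + q^-1 = 1 ->
  measurable_fun D (fun t => `|f t|) -> measurable_fun D (fun t => `|g t|) ->
  measurable_fun D (fun t => `|h t|) -> (forall t, D t -> `|f t| <= `|g t| * `|h t|) ->
  (\int[mu]_(t in D) `|f t|%:E <= vnorm mu D p g * vnorm mu D q h)%E.
Proof.
move=> mD p0 q0 pq mf mg mh fgh.
apply: le_trans (hoelder_vnorm mu mD p0 q0 pq mg mh).
apply: ge0_le_integral => //.
- exact/measurable_EFinP.
- by apply/measurable_EFinP; exact: measurable_funM.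
Qed.

End vnorm_extend0.

(** * The Volterra operator *)

Section volterra.
Context {R : realType} (T p q : R) (T0 : 0 <= T) (p1 : 1 < p) (q1 : 1 < q).
Hypothesis pq : p^-1 + q^-1 = 1.
Context {E : completeNormedModType R}.
Local Notation mu := (lebesgueR R).
Local Notation Leb := (lebR R).
Local Notation I := (`[0, T]%classic : set Leb).
Local Notation J t := (`[0, t]%classic : set Leb).
Variable e : nat -> E.
Hypothesis e0 : e 0%N = 0.
Hypothesis e_dense : forall x eps, 0 < eps -> exists j, `|x - e j| < eps.
Variable k : R -> R -> endoL E.
Hypothesis k5 : forall t : R, t \in `[0, T] -> Lp_fun (J t) q (k t).
Hypothesis k6 : {within `[0, T], continuous
  (fun t : R => Lp_class 0 T (ltW q1) (kernel_ext k t))}.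

Let p0 : 0 < p := lt_trans ltr01 p1.
Let q0 : 0 < q := lt_trans ltr01 q1.

Lemma finite_measure_cc (a b : R) : (mu (`[a, b]%classic : set Leb) < +oo)%E.
Proof.
rewrite (_ : mu _ = lebesgue_measure `[a, b]%classic)//.
by rewrite lebesgue_measure_itv/=; case: ifP => _; rewrite ltry.
Qed.

Lemma sub_cc t : t \in `[0, T] -> J t `<=` I.
Proof.
rewrite in_itv/= => /andP[_ tT] s /=; rewrite !in_itv/= => /andP[-> st].
exact: le_trans st tT.
Qed.

Lemma kernel_extE t : kernel_ext k t = extend0 (J t) (k t).
Proof.
apply/funext => s; rewrite /kernel_ext /extend0 (_ : (s \in J t) = (s \in `[0, t]))//.
by apply/idP/idP => [/set_mem//|st]; exact: mem_set.
Qed.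

Lemma strongly_measurable_extend0 {V : normedModType R} (D D' : set Leb) (f : R -> V) :
  measurable D -> strongly_measurable D f -> strongly_measurable D' (extend0 D f).
Proof.
move=> mD [s [ss sf]]; exists (fun n => extend0 D (s n)); split.
  by move=> n; exact: simple_function_extend0.
apply: filterS sf => t H _; rewrite /extend0; case: ifP => [/set_mem//|_].
exact: cvg_cst.
Qed.

Lemma kernel_ext_Lp t : t \in `[0, T] -> Lp_fun I q (kernel_ext k t).
Proof.
move=> tI; have [mk kq] := k5 tI; rewrite kernel_extE; split.
  by apply: strongly_measurable_extend0 => //; exact: measurable_cc.
by rewrite bochner_normV vnorm_extend0//; exact: sub_cc.
Qed.

(** Translates continuity into the quotient space into a bound on the maps themselves. Finiteness of
    the norm has to be shown because the distance is its [fine] part. *)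
Lemma kernel_continuous t eps : t \in `[0, T] -> 0 < eps ->
  exists2 del, 0 < del & forall t', t' \in `[0, T] -> `|t - t'| < del ->
    (bochner_norm I q (fun s => kernel_ext k t s - kernel_ext k t' s)%R < eps%:E)%E.
Proof.
move=> tI eps0.
have /subspace_continuousP/(_ t tI) := k6.
move=> /(_ (ball (Lp_class 0 T (ltW q1) (kernel_ext k t)) eps) (nbhsx_ballx _ _ eps0)).
move=> /nbhs_ballP[del /= del0 H]; exists del => // t' t'I tt'.
have /= := H t' tt' t'I.
rewrite ballEmdist /=.
have Lt := kernel_ext_Lp tI; have Lt' := kernel_ext_Lp t'I.
rewrite (Lp_mdistE Lt Lt' (Lp_repr_class (ltW q1) Lt) (Lp_repr_class (ltW q1) Lt')).
set x := bochner_norm _ _ _ => xe; rewrite -(@fineK _ x) ?lte_fin//.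
have := @bochner_norm_triangle R (endoL E) I q _ (cst 0) _ (measurable_cc 0 T) (ltW q1)
  Lt.1 (@strongly_measurable0 _ _ _) Lt'.1.
rewrite (bochner_normC I q (cst 0)).
rewrite (_ : (fun s => kernel_ext k t s - cst 0 s) = kernel_ext k t); last first.
  by apply/funext => s; rewrite subr0.
rewrite (_ : (fun s => kernel_ext k t' s - cst 0 s) = kernel_ext k t'); last first.
  by apply/funext => s; rewrite subr0.
move=> xle; rewrite ge0_fin_numE ?bochner_norm_ge0// (le_lt_trans xle)//.
by rewrite lte_add_pinfty//; [case: Lt|case: Lt'].
Qed.

Lemma kernel_fin_num t : t \in `[0, T] -> bochner_norm I q (kernel_ext k t) \is a fin_num.
Proof.
by move=> tI; rewrite ge0_fin_numE ?bochner_norm_ge0//; case: (kernel_ext_Lp tI).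
Qed.

(** The norm of the extended kernel depends continuously on [t] in a compact interval. *)
Lemma kernel_bounded : exists2 C, 0 <= C & forall t, t \in `[0, T] ->
  (bochner_norm I q (kernel_ext k t) <= C%:E)%E.
Proof.
pose n t := fine (bochner_norm I q (kernel_ext k t)).
have nD t t' : t \in `[0, T] -> t' \in `[0, T] -> (bochner_norm I q (kernel_ext k t) <=
    bochner_norm I q (fun s => kernel_ext k t s - kernel_ext k t' s)%R +
    bochner_norm I q (kernel_ext k t'))%E.
  move=> tI t'I; have [mt _] := kernel_ext_Lp tI; have [mt' _] := kernel_ext_Lp t'I.
  have mI := measurable_cc 0 T : measurable I.
  apply: (le_vnormD mI (ltW q1) (strongly_measurable_norm mI mt)
    (strongly_measurable_norm mI (strongly_measurableB mt mt'))
    (strongly_measurable_norm mI mt')).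
  apply: nearW => s _.
  by rewrite -[X in `|X| <= _](subrK (kernel_ext k t' s)) ler_normD.
have cn : {within `[0, T], continuous n}.
  apply/within_continuousP => t eps tI eps0.
  have [del del0 H] := kernel_continuous tI eps0; exists del => // t' t'I /(H _ t'I) tt'.
  rewrite ltr_norml; apply/andP; split.
    rewrite ltrNl opprB ltrBlDr -lte_fin EFinD !fineK ?kernel_fin_num//.
    apply: le_lt_trans (nD _ _ t'I tI) _.
    by rewrite lteD2rE ?kernel_fin_num// bochner_normC.
  rewrite ltrBlDr -lte_fin EFinD !fineK ?kernel_fin_num//.
  apply: le_lt_trans (nD _ _ tI t'I) _.
  by rewrite lteD2rE ?kernel_fin_num.
have [C CP] := within_continuous_bounded T0 cn.
have C0 : 0 <= C by apply: le_trans (CP 0 _); rewrite // in_itv/= lexx.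
exists C => // t tI; rewrite -(fineK (kernel_fin_num tI)) lee_fin.
by rewrite (le_trans (ler_norm _))// CP.
Qed.

Definition volterra (w : R -> E) (t : R) : E :=
  bochner_integral (J t) (fun s => k t s (w s)).

Lemma strongly_measurableS {V : normedModType R} (D D' : set Leb) (f : R -> V) :
  D' `<=` D -> strongly_measurable D f -> strongly_measurable D' f.
Proof.
move=> D'D [s [ss sf]]; exists s; split => //.
by apply: filterS sf => t H /D'D.
Qed.

Lemma volterraP t (w : R -> E) : t \in `[0, T] -> Lp_fun I p w ->
  is_bochner_integral I (fun s => kernel_ext k t s (w s)) (volterra w t).
Proof.
move=> tI [mw wp]; have [mk kq] := k5 tI.
have mI := measurable_cc 0 T : measurable I.
have mJ := measurable_cc 0 t : measurable (J t).
have mwJ := strongly_measurableS (sub_cc tI) mw.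
have mkw := strongly_measurable_apply mk mwJ.
have wJ : (bochner_norm (J t) p w < +oo)%E.
  apply: le_lt_trans wp; apply: (sub_vnorm mu mJ mI p0 (sub_cc tI)).
  exact: strongly_measurable_norm.
have -> : (fun s => kernel_ext k t s (w s)) = extend0 (J t) (fun s => k t s (w s)).
  by apply/funext => s; rewrite kernel_extE /extend0; case: ifP.
apply: (is_bochner_integral_extend0 mJ mI (sub_cc tI) (finite_measure_cc 0 T)).
apply: (bochner_integralP e0 e_dense mJ (finite_measure_cc 0 t)).
  exact: strongly_vmeasurable.
apply: (@le_lt_trans _ _ (bochner_norm (J t) q (k t) * bochner_norm (J t) p w)%E).
  have qp : q^-1 + p^-1 = 1 by rewrite addrC.
  apply: (integral_le_hoelder mu mJ q0 p0 qp (strongly_measurable_norm mJ mkw)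
    (strongly_measurable_norm mJ mk) (strongly_measurable_norm mJ mwJ)).
  by move=> s _; exact: endoL_norm_le.
rewrite -[X in (X * _)%E]fineK; last by rewrite ge0_fin_numE// bochner_norm_ge0.
rewrite -[X in (_ * X)%E]fineK; last by rewrite ge0_fin_numE// bochner_norm_ge0.
by rewrite -EFinM ltry.
Qed.

Lemma volterra_dist_time t t' (w : R -> E) : t \in `[0, T] -> t' \in `[0, T] ->
  Lp_fun I p w -> (`|volterra w t - volterra w t'|%:E <=
    bochner_norm I q (fun s => kernel_ext k t s - kernel_ext k t' s)%R *
    bochner_norm I p w)%E.
Proof.
move=> tI t'I wL; have [mw _] := wL.
have mI := measurable_cc 0 T : measurable I.
apply: le_trans (bochner_integral_dist e_dense mI (finite_measure_cc 0 T)
  (volterraP tI wL) (volterraP t'I wL)) _.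
have [mt _] := kernel_ext_Lp tI; have [mt' _] := kernel_ext_Lp t'I.
have qp : q^-1 + p^-1 = 1 by rewrite addrC.
apply: (integral_le_hoelder mu mI q0 p0 qp _
  (strongly_measurable_norm mI (strongly_measurableB mt mt'))
  (strongly_measurable_norm mI mw)).
  apply: strongly_measurable_norm => //.
  by apply: strongly_measurableB; exact: strongly_measurable_apply.
by move=> s _; rewrite -endoLBE; exact: endoL_norm_le.
Qed.

(** The extension by 0 is moved from the kernel to [w - w'] before Hölder's inequality is applied,
    so that only the norm over [[0, t]] appears: the operator is causal. *)
Lemma volterra_dist C t (w w' : R -> E) :
  (forall t, t \in `[0, T] -> (bochner_norm I q (kernel_ext k t) <= C%:E)%E) ->
  t \in `[0, T] -> Lp_fun I p w -> Lp_fun I p w' ->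
  (`|volterra w t - volterra w' t|%:E <=
    C%:E * bochner_norm (J t) p (fun s => w s - w' s)%R)%E.
Proof.
move=> CP tI wL w'L; have [mw _] := wL; have [mw' _] := w'L.
have mI := measurable_cc 0 T : measurable I.
have mJ := measurable_cc 0 t : measurable (J t).
apply: le_trans (bochner_integral_dist e_dense mI (finite_measure_cc 0 T)
  (volterraP tI wL) (volterraP tI w'L)) _.
have [mt _] := kernel_ext_Lp tI.
have qp : q^-1 + p^-1 = 1 by rewrite addrC.
rewrite [X in (_ <= _ * X)%E]bochner_normV.
rewrite -(vnorm_extend0 mu p (fun s => w s - w' s : E) (sub_cc tI)).
have mB := strongly_measurableS (sub_cc tI) (strongly_measurableB mw mw').
apply: (@le_trans _ _ (bochner_norm I q (kernel_ext k t) *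
    vnorm mu I p (extend0 (J t) (fun s => w s - w' s)%R))%E); last first.
  by apply: lee_wpmul2r; [exact: vnorm_ge0|exact: CP].
apply: (integral_le_hoelder mu mI q0 p0 qp _ (strongly_measurable_norm mI mt)
  (strongly_measurable_norm mI (strongly_measurable_extend0 _ mJ mB))).
  apply: strongly_measurable_norm => //.
  by apply: strongly_measurableB; exact: strongly_measurable_apply.
move=> s _; rewrite -linearB kernel_extE /extend0; case: ifP => _.
  exact: endoL_norm_le.
by rewrite -[leLHS]/(`|0 : E|) !normr0 mulr0.
Qed.

Lemma volterra_continuous (w : R -> E) : Lp_fun I p w ->
  {within `[0, T], continuous (volterra w)}.
Proof.
move=> wL; have [_ wp] := wL; apply/within_continuousP => t eps tI eps0.
have wfin : bochner_norm I p w \is a fin_num.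
  by rewrite ge0_fin_numE ?bochner_norm_ge0.
(* Adding 1 keeps the divisor positive when [w] has norm 0. *)
pose M := fine (bochner_norm I p w) + 1.
have M0 : 0 < M by rewrite ltr_pwDr// fine_ge0 ?bochner_norm_ge0.
have [del del0 H] := kernel_continuous tI (divr_gt0 eps0 M0).
exists del => // t' t'I /(H _ t'I) tt'; rewrite -lte_fin.
apply: le_lt_trans (volterra_dist_time tI t'I wL) _.
apply: (@le_lt_trans _ _ ((eps / M)%:E * (fine (bochner_norm I p w))%:E)%E).
  by rewrite fineK//; apply: lee_wpmul2r; [exact: bochner_norm_ge0|exact: ltW].
rewrite -EFinM lte_fin mulrAC ltr_pdivrMr// ltr_pM2l//.
by rewrite /M ltrDl.
Qed.

End volterra.

(** * Weighted norms and distances to sets *)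

Section weighted_norm.
Context d (T : measurableType d) {R : realType} (mu : {measure set T -> \bar R}).
Variables (p : R) (I : set T) (m : nat) (J : nat -> set T).
Hypotheses (p1 : 1 <= p) (mI : measurable I) (mJ : forall i, measurable (J i)).
Hypotheses (JI : forall i, J i `<=` I)
  (IJ : forall t, I t -> exists2 i, (i < m)%N & J i t).

Let p0 : 0 < p := lt_le_trans ltr01 p1.

(** Only [|f|] is required to be measurable, since the weighted norms see nothing else. *)
Definition lebesgue_class {V : normedModType R} (f : T -> V) :=
  measurable_fun I (fun t => `|f t|) /\ (vnorm mu I p f < +oo)%E.

Definition piece_norm {V : normedModType R} i (f : T -> V) : R :=
  fine (vnorm mu (J i) p f).

(* The pieces [J i] will be successive intervals; giving the i-th one the weight
   [2^-i] turns causal operators into contractions (Bielecki's trick). *)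
Definition weighted_norm {V : normedModType R} (f : T -> V) : R :=
  \sum_(i < m) 2^-1 ^+ i * piece_norm i f.

Let w0 i : 0 <= 2^-1 ^+ i :> R. Proof. by rewrite exprn_ge0// invr_ge0. Qed.

Lemma piece_norm_ge0 {V : normedModType R} i (f : T -> V) : 0 <= piece_norm i f.
Proof. by rewrite fine_ge0// vnorm_ge0. Qed.

Lemma weighted_norm_ge0 {V : normedModType R} (f : T -> V) : 0 <= weighted_norm f.
Proof. by apply: sumr_ge0 => i _; rewrite mulr_ge0// piece_norm_ge0. Qed.

Lemma piece_norm_fin {V : normedModType R} i (f : T -> V) : lebesgue_class f ->
  vnorm mu (J i) p f \is a fin_num.
Proof.
move=> [mf fy]; rewrite ge0_fin_numE ?vnorm_ge0//.
exact: le_lt_trans (sub_vnorm mu (mJ i) mI p0 (JI (i := i)) mf) fy.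
Qed.

Let mS i (f : T -> R) : measurable_fun I f -> measurable_fun (J i) f.
Proof. exact: measurable_funS (JI (i := i)). Qed.

Lemma le_piece_norm {V W : normedModType R} i (f : T -> V) (g : T -> W) :
  measurable_fun I (fun t => `|f t|) -> lebesgue_class g ->
  {ae mu, forall t, J i t -> `|f t| <= `|g t|} -> piece_norm i f <= piece_norm i g.
Proof.
move=> mf Lg fg; have H := le_vnorm (mJ i) p0 (mS mf) (mS Lg.1) fg.
apply: fine_le => //; last exact: piece_norm_fin.
rewrite ge0_fin_numE ?vnorm_ge0// (le_lt_trans H)//.
by have := piece_norm_fin i Lg; rewrite ge0_fin_numE ?vnorm_ge0.
Qed.

Lemma le_weighted_norm {V W : normedModType R} (f : T -> V) (g : T -> W) :
  measurable_fun I (fun t => `|f t|) -> lebesgue_class g ->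
  {ae mu, forall t, I t -> `|f t| <= `|g t|} -> weighted_norm f <= weighted_norm g.
Proof.
move=> mf Lg fg; apply: ler_sum => i _; apply: ler_wpM2l => //.
apply: le_piece_norm => //; apply: filterS fg => t H /(JI (i := i)); exact: H.
Qed.

Lemma weighted_normD {U V W : normedModType R} (f : T -> U) (g : T -> V) (h : T -> W) :
  measurable_fun I (fun t => `|f t|) -> lebesgue_class g -> lebesgue_class h ->
  {ae mu, forall t, I t -> `|f t| <= `|g t| + `|h t|} ->
  weighted_norm f <= weighted_norm g + weighted_norm h.
Proof.
move=> mf Lg Lh fgh; rewrite -big_split/=; apply: ler_sum => i _.
rewrite -mulrDr; apply: ler_wpM2l => //.
have H : (vnorm mu (J i) p f <= vnorm mu (J i) p g + vnorm mu (J i) p h)%E.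
  apply: (le_vnormD (mJ i) p1 (mS mf) (mS Lg.1) (mS Lh.1)).
  by apply: filterS fgh => t H /(JI (i := i)); exact: H.
have ffin : vnorm mu (J i) p f \is a fin_num.
  rewrite ge0_fin_numE ?vnorm_ge0// (le_lt_trans H)//.
  by rewrite -ge0_fin_numE ?adde_ge0 ?vnorm_ge0// fin_numD !piece_norm_fin.
rewrite -lee_fin EFinD /piece_norm (fineK ffin).
by rewrite (fineK (piece_norm_fin i Lg)) (fineK (piece_norm_fin i Lh)).
Qed.

Lemma weighted_normZ {V : normedModType R} (f : T -> V) (c : R) :
  lebesgue_class f -> weighted_norm (fun t => c *: f t) = `|c| * weighted_norm f.
Proof.
move=> Lf; rewrite mulr_sumr; apply: eq_bigr => i _.
rewrite /piece_norm (vnormZ mu c (mJ i) p0 (mS Lf.1)).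
by rewrite fineM ?piece_norm_fin// mulrCA.
Qed.

(** The weights add up to [2 - 2 * 2^-m]. Together with [le_vnorm_weighted], whose constant comes
    from the weights being at least [2^-m], this makes the weighted norm equivalent to the [L^p]
    norm. *)
Lemma weighted_norm_le {V : normedModType R} (f : T -> V) : lebesgue_class f ->
  weighted_norm f <= 2 * fine (vnorm mu I p f).
Proof.
move=> Lf; have [mf fy] := Lf.
have ffin : vnorm mu I p f \is a fin_num by rewrite ge0_fin_numE ?vnorm_ge0.
have H i : piece_norm i f <= fine (vnorm mu I p f).
  apply: fine_le => //; first exact: piece_norm_fin.
  exact: (sub_vnorm mu (mJ i) mI p0 (JI (i := i)) mf).
apply: (@le_trans _ _ (\sum_(i < m) 2^-1 ^+ i * fine (vnorm mu I p f))).
  by apply: ler_sum => i _; exact: ler_wpM2l.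
rewrite -mulr_suml; apply: ler_wpM2r; first by rewrite fine_ge0// vnorm_ge0.
suff -> : \sum_(i < m) 2^-1 ^+ i = 2 - 2 * 2^-1 ^+ m :> R.
  by rewrite gerBl mulr_ge0.
elim: m => [|n IH]; first by rewrite big_ord0 expr0 mulr1 subrr.
rewrite big_ord_recr/= IH exprS; lra.
Qed.

Lemma le_vnorm_weighted {V : normedModType R} (f : T -> V) : lebesgue_class f ->
  fine (vnorm mu I p f) <= 2 ^+ m * weighted_norm f.
Proof.
move=> Lf; have [mf fy] := Lf.
have ffin : vnorm mu I p f \is a fin_num by rewrite ge0_fin_numE ?vnorm_ge0.
rewrite -lee_fin fineK//.
apply: (le_trans (vnorm_bigcup mu mJ mI p1 JI IJ mf)).
apply: (@le_trans _ _ (\sum_(i < m) piece_norm i f)%:E).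
  rewrite -sumEFin; apply: lee_sum => i _.
  by rewrite fineK ?piece_norm_fin.
rewrite lee_fin mulr_sumr; apply: ler_sum => i _.
rewrite mulrA ler_peMl ?piece_norm_ge0// exprVn ler_pdivlMr ?exprn_gt0// mul1r.
by rewrite ler_eXn2l ?ltr1n// ltnW.
Qed.

Lemma weighted_norm_eq0 {V : normedModType R} (f : T -> V) : lebesgue_class f ->
  weighted_norm f = 0 -> {ae mu, forall t, I t -> f t = 0}.
Proof.
move=> Lf f0; apply: (vnorm_eq0 mI p0 Lf.1).
have := le_vnorm_weighted Lf; rewrite f0 mulr0 => H.
have ffin : vnorm mu I p f \is a fin_num by rewrite ge0_fin_numE ?vnorm_ge0// Lf.2.
rewrite -(fineK ffin); congr EFin; apply/eqP.
by rewrite eq_le H fine_ge0// vnorm_ge0.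
Qed.

Lemma ae_eq0_weighted_norm {V : normedModType R} (f : T -> V) :
  measurable_fun I (fun t => `|f t|) ->
  {ae mu, forall t, I t -> f t = 0} -> weighted_norm f = 0.
Proof.
move=> mf f0; apply: big1 => i _; rewrite /piece_norm.
rewrite (ae_eq0_vnorm (mJ i) p0 (mS mf)) ?mulr0//.
by apply: filterS f0 => t H /(JI (i := i)); exact: H.
Qed.

(** On piece [i] the norm of [f] is at most [eta C] times the sum of the norms of [u] on the pieces
    up to [i]. Exchanging the two sums, piece [j] of [u] receives the weight
    [2^-j + 2^-(j+1) + ... <= 2 * 2^-j]. The factor 2 does not depend on [m], so refining the pieces
    to shrink [eta] gives a contraction. *)
Lemma weighted_norm_causal {U V W : normedModType R} (f : T -> U) (a : T -> V)
    (u : T -> W) (C eta : R) :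
  0 <= C -> 0 <= eta -> measurable_fun I (fun t => `|f t|) -> lebesgue_class a ->
  lebesgue_class u -> (forall i, piece_norm i a <= eta) ->
  (forall i t, J i t -> `|f t| <= C * (\sum_(j < i.+1) piece_norm j u) * `|a t|) ->
  weighted_norm f <= 2 * eta * C * weighted_norm u.
Proof.
move=> C0 eta0 mf La Lu aeta fau.
pose S i := \sum_(j < i.+1) piece_norm j u.
have S0 i : 0 <= S i by apply: sumr_ge0 => j _; exact: piece_norm_ge0.
have fi i : piece_norm i f <= eta * C * S i.
  have := @le_vnorm _ _ _ mu _ _ (J i) p f (fun t => (C * S i) *: a t) (mJ i) p0
    (mS mf) _ _.
  have mCa : measurable_fun (J i) (fun t => `|(C * S i) *: a t|).
    rewrite (_ : (fun t => _) = fun t => (C * S i) * `|a t|).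
      exact: measurable_funM (measurable_cst _) (mS La.1).
    by apply/funext => t; rewrite normrZ ger0_norm// mulr_ge0.
  move=> /(_ mCa) H.
  have {}H : (vnorm mu (J i) p f <= ((C * S i) * piece_norm i a)%:E)%E.
    apply: (le_trans (H _)).
      apply: nearW => t Jt; rewrite normrZ [in leRHS]ger0_norm ?mulr_ge0//.
      exact: fau.
    rewrite (vnormZ mu _ (mJ i) p0 (mS La.1)) ger0_norm ?mulr_ge0//.
    by rewrite [X in (_ <= X)%E]EFinM fineK ?piece_norm_fin.
  apply: (@le_trans _ _ ((C * S i) * piece_norm i a)).
    rewrite -lee_fin {1}/piece_norm fineK// ge0_fin_numE ?vnorm_ge0//.
    by rewrite (le_lt_trans H)// ltry.
  rewrite [leRHS](_ : _ = C * S i * eta); last by ring.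
  by apply: ler_wpM2l; [exact: mulr_ge0|exact: aeta].
apply: (@le_trans _ _ (eta * C * \sum_(i < m) 2^-1 ^+ i * S i)).
  rewrite mulr_sumr; apply: ler_sum => i _; rewrite mulrCA.
  exact: ler_wpM2l.
have -> : 2 * eta * C * weighted_norm u = eta * C * (2 * weighted_norm u) by ring.
apply: ler_wpM2l; first exact: mulr_ge0.
(* The subtracted term is the tail of the geometric series, kept explicit for the induction. *)
have G n : \sum_(i < n) 2^-1 ^+ i * S i <=
    2 * (\sum_(i < n) 2^-1 ^+ i * piece_norm i u) -
    2^-1 ^+ n * 2 * \sum_(j < n) piece_norm j u.
  elim: n => [|n IH]; first by rewrite !big_ord0 !mulr0 subrr.
  rewrite !big_ord_recr/= /S [\sum_(j < n.+1) _]big_ord_recr/= exprS.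
  rewrite -/(S n); move: IH; rewrite -/S.
  move: (2^-1 ^+ n) (\sum_(j < n) piece_norm j u) (piece_norm n u) => w B x.
  move: (\sum_(i < n) 2^-1 ^+ i * piece_norm i u) => A.
  move: (\sum_(i < n) _) => D IH.
  by lra.
by apply: (le_trans (G m)); rewrite gerBl !mulr_ge0// sumr_ge0// => j _;
  exact: piece_norm_ge0.
Qed.

End weighted_norm.

(** * Distances to sets *)

Section distance_to_set.
Context {R : realType} {E : normedModType R}.
Implicit Types (x y : E) (G : set E).

(** For empty [G] the infimum is infinite and [fine] returns 0; the lemmas that would fail in that
    case assume [G !=set0]. *)
Definition set_dist x G : R := fine (dist_set x G).

Lemma dist_set_ge0 x G : (0 <= dist_set x G)%E.
Proof. by apply: le_ereal_inf_tmp => _ [y _ <-]; rewrite lee_fin. Qed.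

Lemma dist_set_le x G y : G y -> (dist_set x G <= `|x - y|%:E)%E.
Proof. by move=> Gy; apply: ereal_inf_lbound; exists y. Qed.

Lemma dist_setE x G : G !=set0 -> dist_set x G = (set_dist x G)%:E.
Proof.
move=> [y Gy]; rewrite fineK// ge0_fin_numE ?dist_set_ge0//.
by rewrite (le_lt_trans (dist_set_le x Gy))// ltry.
Qed.

Lemma set_dist_ge0 x G : 0 <= set_dist x G.
Proof. by rewrite fine_ge0// dist_set_ge0. Qed.

Lemma set_dist_le x G y : G y -> set_dist x G <= `|x - y|.
Proof. by move=> Gy; rewrite -lee_fin -dist_setE ?dist_set_le//; exists y. Qed.

Lemma set_dist_lt x G r : G !=set0 -> set_dist x G < r -> exists2 y, G y & `|x - y| < r.
Proof.
move=> G0; rewrite -lte_fin -dist_setE// => /ereal_inf_lt[_ [y Gy <-]].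
by rewrite lte_fin => ?; exists y.
Qed.

Lemma set_dist_leP x G r : G !=set0 ->
  (forall eps, 0 < eps -> exists2 y, G y & `|x - y| <= r + eps) -> set_dist x G <= r.
Proof.
move=> G0 H; apply/ler_addgt0Pr => eps /H[y Gy]; apply: le_trans.
exact: set_dist_le.
Qed.

Lemma set_dist_approx x G eps : G !=set0 -> 0 < eps ->
  exists2 y, G y & `|x - y| < set_dist x G + eps.
Proof. by move=> G0 eps0; apply: set_dist_lt => //; rewrite ltrDl. Qed.

Lemma set_dist_lip x y G : G !=set0 -> set_dist x G <= set_dist y G + `|x - y|.
Proof.
move=> G0; apply: set_dist_leP => // eps /(set_dist_approx y G0)[z Gz yz].
exists z => //; rewrite (le_trans (ler_distD y _ _))//; move: yz => /ltW.
by move=> ?; lra.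
Qed.

Lemma set_dist_convex x y G a : G !=set0 ->
  convex_set (G : set (convex_lmodType E)) -> 0 <= a <= 1 ->
  set_dist (a *: x + (1 - a) *: y) G <= a * set_dist x G + (1 - a) * set_dist y G.
Proof.
move=> G0 cG /andP[a0 a1]; apply: set_dist_leP => // eps eps0.
have [u Gu xu] := set_dist_approx x G0 eps0.
have [v Gv yv] := set_dist_approx y G0 eps0.
exists (a *: u + (1 - a) *: v).
  have := cG u v (Itv01 a0 a1) (mem_set Gu) (mem_set Gv).
  by move/set_mem.
have -> : a *: x + (1 - a) *: y - (a *: u + (1 - a) *: v) =
    a *: (x - u) + (1 - a) *: (y - v).
  by rewrite !scalerBr opprD addrACA.
rewrite (le_trans (ler_normD _ _))// !normrZ (ger0_norm a0) ger0_norm ?subr_ge0//.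
have H1 : a * `|x - u| <= a * (set_dist x G + eps) by rewrite ler_wpM2l// ltW.
have H2 : (1 - a) * `|y - v| <= (1 - a) * (set_dist y G + eps).
  by rewrite ler_wpM2l ?subr_ge0// ltW.
by lra.
Qed.

Lemma set_dist_eq0 x G : G !=set0 -> closed G -> set_dist x G = 0 -> G x.
Proof.
move=> G0 cG x0; apply: cG => B /nbhs_ballP[eps eps0 xB].
have [|y Gy xy] := @set_dist_lt x G eps G0; first by rewrite x0.
by exists y; split => //; apply: xB; rewrite -ball_normE.
Qed.

Lemma set_dist_mem x G : G x -> set_dist x G = 0.
Proof.
move=> Gx; apply/eqP; rewrite eq_le set_dist_ge0 andbT.
by have := set_dist_le x Gx; rewrite subrr normr0.
Qed.

Lemma set_dist_hausdorff x G G' r : G !=set0 -> G' !=set0 ->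
  (hausdorff_dist G G' <= r%:E)%E -> set_dist x G <= set_dist x G' + r.
Proof.
move=> G0 G'0; rewrite ge_max => /andP[_ H].
apply: set_dist_leP => // eps eps0.
have eps2 : 0 < eps / 2 by rewrite divr_gt0.
have [z G'z xz] := set_dist_approx x G'0 eps2.
have : (dist_set z G <= r%:E)%E.
  by apply: le_trans H; apply: ereal_sup_ubound; exists z.
rewrite dist_setE// lee_fin => zr.
have [y Gy zy] := set_dist_approx z G0 eps2.
by exists y => //; have := ler_distD z x y; lra.
Qed.

End distance_to_set.

Section measurable_distance.
Context d (T : measurableType d) {R : realType} {E : normedModType R}.
Variables (I : set T) (G : T -> set E).
Hypotheses (mI : measurable I) (G0 : forall t, I t -> G t !=set0)
  (mG : forall C, open C -> measurable [set t | I t /\ G t `<=` C]).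

(** The distance is below [r] iff, for some [n], [G t] meets the closed ball of radius
    [r - 1 / (n + 1)] around [x], that is, [G t] is not contained in the open complement [C n]. *)
Lemma measurable_set_dist x : measurable_fun I (fun t => set_dist x (G t)).
Proof.
have mlt r : measurable (I `&` [set t | set_dist x (G t) < r]).
  pose C n := [set y | r - n.+1%:R^-1 < `|x - y|].
  have oC n : open (C n).
    apply: (@open_comp _ _ (fun y => `|x - y|) [set s | r - n.+1%:R^-1 < s]).
      by move=> y _; apply: cvg_norm; apply: cvgB; [exact: cvg_cst|exact: cvg_id].
    exact: open_gt.
  rewrite (_ : _ `&` _ = \bigcup_n (I `\` [set t | I t /\ G t `<=` C n])).
    by apply: bigcupT_measurable => n; apply: measurableD => //; exact: mG.
  apply/seteqP; split=> [t [It /= tr]|t [n _ [It nt]]].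
    have [y Gy xy] := set_dist_lt (G0 It) tr.
    have [n nxy] := ltr_add_invr xy.
    exists n => //; split => // -[_ /(_ y Gy)]; rewrite /C /=; move: nxy.
    by move: (n.+1%:R^-1) => z ? ?; lra.
  split => //=; rewrite ltNge; apply/negP => rt; apply: nt; split => // y Gy.
  rewrite /C /= (lt_le_trans _ (set_dist_le x Gy))// (lt_le_trans _ rt)//.
  by rewrite ltrBlDr ltrDl invr_gt0.
move=> _; apply: (measurability _ (RGenInftyO.measurableE R)) => // _ [_ [r ->] <-].
have := mlt r; congr measurable; congr (_ `&` _); apply/seteqP; split=> t /=;
  by rewrite in_itv.
Qed.

End measurable_distance.

(** * The pointwise defect and its approximate selections *)

Section superposition.
Context d (T : measurableType d) {R : realType} {E : normedModType R}.
Variable e : nat -> E.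
Hypothesis e_dense : forall x eps, 0 < eps -> exists j, `|x - e j| < eps.
Variables (I N : set T) (F : T -> E -> set E) (al be : T -> R).
Hypotheses (mI : measurable I) (mN : measurable N).
Hypothesis F0 : forall t x, I t -> F t x !=set0.
Hypothesis F_convex : forall t x, I t -> convex_set (F t x : set (convex_lmodType E)).
Hypothesis mF : forall x C, open C -> measurable [set t | I t /\ F t x `<=` C].
Hypothesis F_lip : forall t, I t -> ~ N t -> forall x y,
  (hausdorff_dist (F t x) (F t y) <= (al t * `|x - y|)%:E)%E.
Hypothesis F_be : forall t, I t -> ~ N t -> (dist_set 0%R (F t 0%R) <= (be t)%:E)%E.

(* [N] collects the exceptional times, at which the distance is declared zero. *)
Definition defect t x v : R := if t \in N then 0 else set_dist v (F t x).

Lemma defect_ge0 t x v : 0 <= defect t x v.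
Proof. by rewrite /defect; case: ifP => // _; exact: set_dist_ge0. Qed.

Lemma defect_lip t x v v' : I t -> defect t x v <= defect t x v' + `|v - v'|.
Proof.
move=> It; rewrite /defect; case: ifP => _; first by rewrite add0r.
exact/set_dist_lip/F0.
Qed.

Lemma defect_lipx t x x' v : I t ->
  defect t x v <= defect t x' v + `|al t| * `|x - x'|.
Proof.
move=> It; rewrite /defect; case: ifPn => [_|/negP tN].
  by rewrite add0r mulr_ge0.
have Nt : ~ N t by move=> Nt; apply: tN; exact: mem_set.
have := set_dist_hausdorff v (F0 x It) (F0 x' It) (F_lip It Nt x x').
by move=> /le_trans -> //; rewrite lerD2l ler_wpM2r// ler_norm.
Qed.

Lemma defect_convex t x v w a : I t -> 0 <= a <= 1 ->
  defect t x (a *: v + (1 - a) *: w) <= a * defect t x v + (1 - a) * defect t x w.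
Proof.
move=> It a01; rewrite /defect; case: ifP => _; first by rewrite !mulr0 addr0.
by apply: set_dist_convex => //; [exact: F0|exact: F_convex].
Qed.

(** Compare with the state 0 and the value 0. This growth bound is what makes the defect
    [p]-integrable. *)
Lemma defect_le t x v : I t -> defect t x v <= `|v| + `|al t| * `|x| + `|be t|.
Proof.
move=> It; have := defect_lipx x 0 v It; rewrite subr0 => H.
have H2 := defect_lip 0 v 0 It; rewrite subr0 in H2.
have : defect t 0 0 <= `|be t|.
  rewrite /defect; case: ifPn => // /negP tN.
  have Nt : ~ N t by move=> Nt; apply: tN; exact: mem_set.
  rewrite (le_trans _ (ler_norm _))//.
  by have := F_be It Nt; rewrite dist_setE ?lee_fin//; exact: F0.
by move: H H2; lra.
Qed.

(** Half of [eps] goes into almost attaining the distance from [v] to [F t x], half into moving from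
    there to the dense sequence. *)
Lemma defect_select t x v eps : I t -> 0 < eps ->
  exists j, (defect t x (e j) < eps) && (`|v - e j| < defect t x v + eps).
Proof.
move=> It eps0; rewrite /defect; case: ifP => _.
  by have [j vj] := e_dense v eps0; exists j; rewrite eps0 add0r.
have eps2 : 0 < eps / 2 by rewrite divr_gt0.
have [y Fy vy] := set_dist_approx v (F0 x It) eps2.
have [j yj] := e_dense y eps2; exists j.
have := set_dist_le (e j) Fy; rewrite distrC.
have := ler_distD y v (e j).
by move=> ? ?; apply/andP; split; lra.
Qed.

(** Two applications of [measurable_caratheodory]: in the state for a fixed value [w], then in the
    value. The defect is Lipschitz in each. *)
Lemma measurable_defect u v : vmeasurable I u -> vmeasurable I v ->
  measurable_fun I (fun t => defect t (u t) (v t)).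
Proof.
move=> mu mv.
have mID : measurable_fun I (fun t => t \in N).
  move=> _; apply: (@measurable_fun_bool _ _ _ _ true) => //.
  rewrite (_ : _ @^-1` _ = N); last first.
    by apply/seteqP; split=> t /=; [exact: set_mem|exact: mem_set].
  exact: measurableI.
have mfix x w : measurable_fun I (fun t => defect t x w).
  rewrite /defect; apply: (measurable_fun_if mI mID); first exact: measurable_cst.
  apply: (measurable_funS mI (@subIsetl _ _ _)).
  by apply: measurable_set_dist => // [t|C]; [exact: F0|exact: mF].
have cont (g : E -> R) c : (forall y y', g y <= g y' + c * `|y - y'|) -> continuous g.
  move=> gc; apply: continuous_eps => y eps eps0.
  have c0 : 0 < `|c| + 1 by rewrite ltr_wpDl.
  apply/nbhs_ballP; exists (eps / (`|c| + 1)); first by rewrite /= divr_gt0.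
  move=> z; rewrite -ball_normE /= ltr_pdivlMr// => yz.
  have := gc y z; have := gc z y; rewrite (distrC z).
  have : c * `|y - z| <= `|c| * `|y - z| by rewrite ler_wpM2r// ler_norm.
  have : `|c| * `|y - z| <= `|y - z| * (`|c| + 1).
    by rewrite mulrC ler_wpM2l// lerDl.
  by move=> ? ? ? ?; rewrite ltr_norml; apply/andP; split; lra.
apply: (measurable_caratheodory e_dense (H := fun t => defect t (u t)) mv).
  move=> w; apply: (measurable_caratheodory e_dense (H := fun t x => defect t x w) mu).
    by move=> x; exact: mfix.
  by move=> t It; apply: (cont _ `|al t|) => y y'; exact: defect_lipx.
move=> t It; apply: (cont _ 1) => y y'; rewrite mul1r.
exact: defect_lip.
Qed.

(** At each time take the first [e j] that passes the two strict tests of [defect_select]. The map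
    has countably many values, and each of its level sets is cut out by finitely many measurable
    conditions. *)
Lemma measurable_approximate_selection u x eps :
  vmeasurable I u -> vmeasurable I x -> 0 < eps ->
  exists2 v, vmeasurable I v & forall t, I t ->
    defect t (x t) (v t) < eps /\ `|u t - v t| < defect t (x t) (u t) + eps.
Proof.
move=> mu mx eps0.
pose b j t := (defect t (x t) (e j) < eps) && (`|u t - e j| < defect t (x t) (u t) + eps).
pose j t := if pselect (exists j, b j t) is left H then ex_minn H else 0%N.
have jP t : I t -> b (j t) t /\ forall i, b i t -> (j t <= i)%N.
  move=> It; rewrite /j; case: pselect => [H|[]]; last exact: defect_select.
  by case: ex_minnP.
exists (fun t => e (j t)); last by move=> t /jP[/andP[? ?] _].
have mlt (f g : T -> R) : measurable_fun I f -> measurable_fun I g ->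
    measurable (I `&` [set t | f t < g t]).
  move=> mf mg; have := measurable_fun_ltr mf mg mI (Y := [set true]) Logic.I.
  by congr measurable; apply/seteqP; split=> t.
have mb i : measurable (I `&` [set t | b i t]).
  have m1 := mlt _ _ (measurable_defect mx (vmeasurable_cst (D := I) (e i)))
    (measurable_cst eps).
  have m2 := mlt _ _ (mu (e i)) (measurable_funD (measurable_defect mx mu) (measurable_cst eps)).
  rewrite (_ : _ `&` _ = (I `&` [set t | defect t (x t) (e i) < eps]) `&`
    (I `&` [set t | `|u t - e i| < defect t (x t) (u t) + eps])).
    exact: measurableI.
  apply/seteqP; split=> [t [It /= /andP[? ?]] //|t [[It /= H1] [_ H2]]].
  by split => //=; apply/andP.
have mj k : measurable (I `&` [set t | j t = k]).
  rewrite (_ : _ `&` _ = (I `&` [set t | b k t]) `\`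
    \bigcup_(i < k) (I `&` [set t | b i t])).
    apply: measurableD => //.
    by apply: bigcup_measurable => i _.
  apply/seteqP; split=> [t [It /= jk]|t [[It /= bk] nb]].
    have [bj jmin] := jP t It; rewrite -jk; split => // -[i /= ij [_ /jmin]].
    by rewrite leqNgt ij.
  split => //=; have [bj jmin] := jP t It.
  apply/eqP; rewrite eqn_leq (jmin _ bk) leqNgt; apply/negP => kj.
  by apply: nb; exists (j t).
move=> y _ B mB; rewrite (_ : _ `&` _ = \bigcup_(k in [set k | B `|e k - y|])
    (I `&` [set t | j t = k])).
  by apply: bigcup_measurable => k _.
apply/seteqP; split=> [t [It Bt]|t [k Bk [It /= jk]]]; first by exists (j t).
by split => //=; rewrite jk.
Qed.

End superposition.

(** * Completeness and separability of L^p *)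

Section Lp_completeness.
Context d (T : measurableType d) {R : realType} (mu : {measure set T -> \bar R}).
Context {E : completeNormedModType R}.
Variable e : nat -> E.
Hypothesis e0 : e 0%N = 0.
Hypothesis e_dense : forall x eps, 0 < eps -> exists j, `|x - e j| < eps.
Variables (I : set T) (p q : R).
Hypotheses (mI : measurable I) (muI : (mu I < +oo)%E) (p1 : 1 <= p) (q0 : 0 < q)
  (pq : p^-1 + q^-1 = 1).
Variables (f : nat -> T -> E) (C a : R).
Hypotheses (C0 : 0 <= C) (a01 : 0 <= a < 1) (mf : forall n, vmeasurable I (f n)).
Hypothesis f_fast : forall n,
  (vnorm mu I p (fun t => f n.+1 t - f n t)%R <= (C * a ^+ n)%:E)%E.

Let p0 : 0 < p := lt_le_trans ltr01 p1.
(** The sum of the geometric series bounding the steps. *)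
Let M := C / (1 - a).

Let M0 : 0 <= M.
Proof. by rewrite divr_ge0// subr_ge0 ltW//; case/andP: a01. Qed.

Let mB n m : measurable_fun I (fun t => `|f n t - f m t|).
Proof. exact/vmeasurable_norm/(vmeasurableB e_dense). Qed.

Let CM : C = M * (1 - a).
Proof. by rewrite divfK// gt_eqF// subr_gt0; case/andP: a01. Qed.

Let f_cauchy n k : (vnorm mu I p (fun t => f (n + k)%N t - f n t)%R <=
  (M * (a ^+ n - a ^+ (n + k)))%:E)%E.
Proof.
elim: k => [|k IH].
  rewrite addn0 subrr mulr0 (_ : (fun t => _) = fun=> 0) ?vnorm0//.
  by apply/funext => t; rewrite subrr.
have H : (vnorm mu I p (fun t => f (n + k.+1)%N t - f n t)%R <=
    vnorm mu I p (fun t => f (n + k).+1 t - f (n + k)%N t)%R +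
    vnorm mu I p (fun t => f (n + k)%N t - f n t)%R)%E.
  apply: (le_vnormD mI p1) => //; apply: nearW => t _.
  by rewrite addnS ler_distD.
apply: (le_trans H); apply: (le_trans (leeD (f_fast _) IH)).
rewrite -EFinD lee_fin CM addnS exprS.
by rewrite le_eqVlt; apply/orP; left; apply/eqP; ring.
Qed.

Let f_tail n m : (n <= m)%N ->
  (vnorm mu I p (fun t => f m t - f n t)%R <= (M * a ^+ n)%:E)%E.
Proof.
move=> /subnKC <-; apply: (le_trans (f_cauchy _ _)); rewrite lee_fin.
by apply: ler_wpM2l => //; rewrite gerBl exprn_ge0//; case/andP: a01.
Qed.

(** Hölder's inequality against the constant 1 on a set of finite measure turns the [p]-norm bounds
    into mean bounds. The sum of the [|f n.+1 - f n|] is then integrable, hence finite almost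
    everywhere, and absolute convergence gives convergence in [E]. *)
Let f_ae_cvg : {ae mu, forall t, I t -> cvgn (f^~ t)}.
Proof.
pose u n t := (`|f n.+1 t - f n t|)%:E.
have mu_ n : measurable_fun I (u n) by apply/measurable_EFinP.
have u0 n t : I t -> (0 <= u n t)%E by rewrite lee_fin.
pose K := fine (vnorm mu I q (fun=> 1 : R)).
have Kfin : vnorm mu I q (fun=> 1 : R) \is a fin_num.
  by rewrite ge0_fin_numE ?vnorm_ge0// vnorm_cst.
have K0 : 0 <= K by rewrite fine_ge0// vnorm_ge0.
have iu n : (\int[mu]_(t in I) u n t <= (C * a ^+ n * K)%:E)%E.
  have H : (\int[mu]_(t in I) u n t <= vnorm mu I p (fun t => f n.+1 t - f n t)%R *
      vnorm mu I q (fun=> 1%R : R))%E.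
    apply: (integral_le_hoelder mu mI p0 q0 pq (mB _ _) (mB _ _)).
      exact: (measurable_cst (`|1 : R|)).
    by move=> t _; rewrite normr1 mulr1.
  apply: (le_trans H); rewrite EFinM fineK//; apply: lee_wpmul2r => //; exact: vnorm_ge0.
have isum : (\int[mu]_(t in I) (\sum_(0 <= n <oo) u n t) < +oo)%E.
  rewrite integral_nneseries//.
  apply: (@le_lt_trans _ _ (M * K)%:E); last exact: ltry.
  apply: lime_le.
    by apply: is_cvg_nneseries => n _ _; apply: integral_ge0 => t; exact: u0.
  apply: nearW => n; rewrite big_mkord.
  apply: (@le_trans _ _ (\sum_(i < n) (C * a ^+ i * K)%:E)%E).
    by apply: lee_sum => i _.
  rewrite sumEFin lee_fin -mulr_suml ler_wpM2r//.
  have -> : \sum_(i < n) C * a ^+ i = M * (1 - a ^+ n).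
    elim: n => [|n IH]; first by rewrite big_ord0 expr0 subrr mulr0.
    by rewrite big_ord_recr/= IH exprS CM; ring.
  by rewrite ler_piMr// gerBl exprn_ge0//; case/andP: a01.
have sum0 t : I t -> (0 <= \sum_(0 <= n <oo) u n t)%E.
  by move=> It; apply: nneseries_ge0 => n _ _; exact: u0.
have iS : mu.-integrable I (fun t => (\sum_(0 <= n <oo) u n t)%E).
  apply/integrableP; split.
    by apply: ge0_emeasurable_sum => [k t It _|k _]; [exact: u0|exact: mu_].
  rewrite (eq_integral (fun t => \sum_(0 <= n <oo) u n t)%E)//.
  by move=> t; rewrite inE => It; rewrite gee0_abs// sum0.
apply: filterS (integrable_ae mI iS) => t H It; have {}H := H It.
have bnd n : \sum_(i < n) `|f i.+1 t - f i t| <= fine (\sum_(0 <= n <oo) u n t)%E.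
  rewrite -lee_fin fineK// -sumEFin -(big_mkord xpredT (fun i => u i t)).
  by apply: nneseries_lim_ge => i _ _; exact: u0.
have cn : cvgn [normed series (telescope (f^~ t))].
  have -> : [normed series (telescope (f^~ t))] =
      fun n => \sum_(i < n) `|f i.+1 t - f i t|.
    by apply/funext => n; rewrite /normed_series_of seriesEord.
  apply: nondecreasing_is_cvgn.
    by apply/nondecreasing_seqP => n; rewrite big_ord_recr/= lerDl.
  by exists (fine (\sum_(0 <= n <oo) u n t)%E) => _ [n _ <-].
have -> : f^~ t = fun n => f 0%N t + series (telescope (f^~ t)) n.
  by apply/funext => n; rewrite -eq_sum_telescope.
by apply: is_cvgD; [exact: is_cvg_cst|exact: normed_cvg].
Qed.

(** Fatou's lemma applied to [f (m + n) - f n] as [m] grows carries the tail bound over to the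
    pointwise limit. The single [f n] need not be [p]-integrable here, so integrability is asserted
    for [g - f 0]. *)
Lemma Lp_complete : exists g : T -> E,
  [/\ vmeasurable I g, (vnorm mu I p (fun t => g t - f 0%N t)%R < +oo)%E &
      forall eps, 0 < eps -> exists n0, forall n, (n0 <= n)%N ->
        (vnorm mu I p (fun t => g t - f n t)%R <= eps%:E)%E].
Proof.
have [N [mN N0 cN]] := f_ae_cvg.
have cvgN t : I t -> ~ N t -> cvgn (f^~ t).
  by move=> It Nt; apply: contrapT => ft; apply/Nt/cN => /(_ It).
have mIN : measurable (I `\` N) by exact: measurableD.
pose g0 t : E := lim (f n t @[n --> \oo]).
pose g := extend0 (I `\` N) g0.
have mg : vmeasurable I g.
  apply: vmeasurable_extend0 => //.
  apply: (@vmeasurable_cvg _ _ _ _ _ f) => [n y|t [It Nt]].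
    exact: measurable_funS (mf n y).
  exact: cvgN.
have gfB n : measurable_fun I (fun t => `|g t - f n t|).
  exact/vmeasurable_norm/(vmeasurableB e_dense).
have gN t : I t -> ~ N t -> f n t @[n --> \oo] --> g t.
  by move=> It Nt; rewrite /g /extend0 mem_set//; exact: cvgN.
have tail n : (vnorm mu I p (fun t => g t - f n t)%R <= (M * a ^+ n)%:E)%E.
  apply: (@vnorm_fatou _ _ _ mu _ _ I p (fun m t => f (m + n)%N t - f n t)) => //.
  - by rewrite mulr_ge0// exprn_ge0//; case/andP: a01.
  - exists N; split => // t /= /not_implyP[It Ht].
    apply: contrapT => Nt; apply: Ht; apply: cvg_norm; apply: cvgB; last exact: cvg_cst.
    by apply: (cvg_comp (addn^~ n) (f^~ t)); [exact: cvg_addnr|exact: gN].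
  - by move=> m; apply: f_tail; exact: leq_addl.
exists g; split => //; first by apply: le_lt_trans (tail 0%N) _; exact: ltry.
move=> eps eps0; have [n0 Hn0] := exp_lt_eps M a01 eps0.
exists n0 => n n0n; apply: le_trans (tail n) _; rewrite lee_fin.
rewrite (le_trans _ (ltW Hn0))//; apply: ler_wpM2l => //.
by case/andP: a01 => a0 /ltW a1; exact: ler_wiXn2l.
Qed.

End Lp_completeness.

(** * A countable family approximating the Lebesgue measurable sets *)

Section rational_approximation.
Context {R : realType}.
Local Notation mu := (lebesgueR R).
Local Notation Leb := (lebR R).

Definition rational_union (c : seq (rat * rat)) : set Leb :=
  [set t | has (fun q => (ratr q.1 < t) && (t < ratr q.2)) c].

Lemma measurable_rational_union c :
  @measurable _ (measurableTypeR R) (rational_union c).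
Proof.
elim: c => [|q c IH].
  by rewrite (_ : rational_union _ = set0)//; apply/seteqP; split=> t.
rewrite (_ : rational_union _ = `]ratr q.1, ratr q.2[%classic `|` rational_union c).
  by apply: measurableU => //; exact: measurable_itv.
by apply/seteqP; split=> t; rewrite /rational_union/= in_itv/=; [move/orP|move=> /orP].
Qed.

Lemma open_rational_union (W : set R) : open W ->
  exists c : nat -> seq (rat * rat), [/\ forall n, rational_union (c n) `<=` W,
    {homo c : n m / (n <= m)%N >-> {subset n <= m}} &
    W `<=` \bigcup_n rational_union (c n)].
Proof.
move=> oO.
pose good (q : rat * rat) := `[< `]ratr q.1, ratr q.2[%classic `<=` W >].
(* Among the first [n] pairs of rationals, those whose interval lies inside [W]. *)
pose c n := [seq q <- pmap unpickle (iota 0 n) | good q].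
exists c; split.
- move=> n t /hasP[q]; rewrite mem_filter => /andP[/asboolP qO _] qt.
  by apply: qO; rewrite /= in_itv.
- move=> n m nm q; rewrite !mem_filter => /andP[-> /=].
  rewrite !mem_pmap => /mapP[k]; rewrite mem_iota => /andP[_ kn] qk.
  apply/mapP; exists k => //; rewrite mem_iota /=.
  by rewrite (leq_trans kn)// add0n.
move=> t Ot; have /nbhs_ballP[r /= r0 rO] : nbhs t W by exact: open_nbhs_nbhs.
have [q1 Hq1] : exists q, ratr q \in `]t - r, t[ by apply: rat_in_itvoo; rewrite ltrBlDr ltrDl.
have [q2 Hq2] : exists q, ratr q \in `]t, t + r[ by apply: rat_in_itvoo; rewrite ltrDl.
move: Hq1 Hq2; rewrite !in_itv/= => /andP[a1 a2] /andP[b1 b2].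
exists (pickle (q1, q2)).+1 => //; apply/hasP; exists (q1, q2); last by rewrite /= a2 b1.
rewrite mem_filter; apply/andP; split.
  apply/asboolP => s /=; rewrite in_itv/= => /andP[s1 s2]; apply: rO.
  by rewrite /ball/= ltr_distlC; apply/andP; split; lra.
rewrite mem_pmap; apply/mapP; exists (pickle (q1, q2)); last by rewrite pickleK.
by rewrite mem_iota /= add0n ltnS.
Qed.

(** Up to a null set [A] is a Borel set [B]; outer regularity encloses [B] in an open [W] with
    excess below [eps / 2], and finite unions of rational intervals exhaust [W] up to another
    [eps / 2]. *)
Lemma rational_union_approx (A : set Leb) eps : measurable A -> (mu A < +oo)%E ->
  0 < eps -> exists c, (mu ((A `\` rational_union c) `|` (rational_union c `\` A)) < eps%:E)%E.
Proof.
move=> mA muA eps0; have eh : 0 < eps / 2 by rewrite divr_gt0.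
have : (completed_algebra_gen (@lebesgue_measure R)).-sigma.-measurable A.
  by rewrite completed_caratheodory_measurable.
rewrite g_sigma_completed_algebra_genE => -[/= B mB [N negN] BNA].
have mBL : measurable (B : set Leb) by exact: sub_caratheodory.
have BA : B `<=` A by rewrite -BNA; exact: subsetUl.
have muB : (@lebesgue_measure R B < +oo)%E.
  apply: le_lt_trans muA; exact: (le_measure mu (mem_set mBL) (mem_set mA) BA).
have [W [oO BO OB]] := lebesgue_regularity_outer mB muB eh.
have [c [cO cmono Oc]] := open_rational_union oO.
have mO : @measurable _ (measurableTypeR R) W by exact: open_measurable.
pose D n := W `\` rational_union (c n).
have mD n : @measurable _ (measurableTypeR R) (D n).
  by apply: measurableD => //; exact: measurable_rational_union.
have muO : (@lebesgue_measure R W < +oo)%E.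
  rewrite -(setDUK BO).
  apply: le_lt_trans (measureU2 _ _ _) _ => //; first exact: measurableD.
  by rewrite lte_add_pinfty// (lt_trans OB)// ltry.
have D0 : @lebesgue_measure R (D n) @[n --> \oo] --> 0%E.
  rewrite -(measure0 (@lebesgue_measure R)) (_ : set0 = \bigcap_n D n); last first.
    apply/esym; rewrite -subset0 => t tD.
    have [Ot _] := tD 0%N Logic.I.
    have [n _ tn] := Oc t Ot.
    by have [_ /(_ tn)] := tD n Logic.I.
  apply: nonincreasing_cvg_mu => //.
  - by apply: le_lt_trans muO; apply: le_measure; rewrite ?inE//; exact: subDsetl.
  - exact: bigcapT_measurable.
  move=> n m nm; apply/subsetPset => t [Ot tm]; split => // tn; apply: tm.
  by move: tn => /hasP[q qn qt]; apply/hasP; exists q => //; exact: (cmono _ _ nm).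
have e2E : (0%:E < (eps / 2)%:E)%E by rewrite lte_fin.
have [n _ Hn] := D0 _ (open_ereal_lt' e2E).
have {}Hn := Hn n (leqnn n).
exists (c n).
have [N' [mN' N'0 NN']] := negN.
have mN'L : measurable (N' : set Leb) by exact: sub_caratheodory.
have mDL : measurable (D n : set Leb) by exact: sub_caratheodory.
have mOBL : measurable (W `\` B : set Leb).
  by apply: sub_caratheodory; exact: measurableD.
have mU : measurable (rational_union (c n) : set Leb).
  by apply: sub_caratheodory; exact: measurable_rational_union.
have mL : measurable ((A `\` rational_union (c n)) `|` (rational_union (c n) `\` A)).
  by apply: measurableU; exact: measurableD.
have mR : measurable ((D n `|` (W `\` B)) `|` N' : set Leb).
  by apply: measurableU => //; exact: measurableU.
apply: (@le_lt_trans _ _ (mu ((D n `|` (W `\` B)) `|` N' : set Leb))).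
  apply: (le_measure mu (mem_set mL) (mem_set mR)) => t.
  move=> [[At ct]|[ct At]]; last first.
    by left; right; split; [exact: cO ct|move=> /BA].
  have [Bt|Bt] := pselect (B t); first by left; left; split => //; exact: BO.
  by right; apply: NN'; move: At; rewrite -BNA => -[].
rewrite measureU0//; last by apply: measurableU.
apply: le_lt_trans (measureU2 _ _ _) _ => //.
rewrite [X in (_ < X)%E](_ : _ = ((eps / 2)%:E + (eps / 2)%:E)%E); last first.
  by rewrite -EFinD -splitr.
exact: lteD.
Qed.

End rational_approximation.

(** * Density of countably many step functions *)

Section Lp_density.
Context d (T : measurableType d) {R : realType} (mu : {measure set T -> \bar R}).
Context {E : normedModType R}.
Variable e : nat -> E.
Hypothesis e0 : e 0%N = 0.
Hypothesis e_dense : forall x eps, 0 < eps -> exists j, `|x - e j| < eps.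
Variables (I : set T) (p : R) (U : nat -> set T).
Hypotheses (mI : measurable I) (muI : (mu I < +oo)%E) (p1 : 1 <= p)
  (mU : forall k, measurable (U k)).
Hypothesis U_dense : forall A eps, measurable A -> A `<=` I -> 0 < eps ->
  exists k, (mu ((A `\` U k) `|` (U k `\` A)) < eps%:E)%E.

Let p0 : 0 < p := lt_le_trans ltr01 p1.

Lemma le_vnorm_sum (V : normedModType R) n (f : T -> V) (h : nat -> T -> V) :
  measurable_fun I (fun t => `|f t|) ->
  (forall j, measurable_fun I (fun t => `|h j t|)) ->
  (forall t, I t -> `|f t| <= \sum_(j < n) `|h j t|) ->
  (vnorm mu I p f <= \sum_(j < n) vnorm mu I p (h j))%E.
Proof.
move=> mf mh fh.
have ms k : measurable_fun I (fun t => `|\sum_(j < k) `|h j t| |).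
  apply: measurableT_comp; first exact: normr_measurable.
  by apply: measurable_sum => j; exact: mh.
have G k : (vnorm mu I p (fun t => \sum_(j < k) `|h j t|)%R <=
    \sum_(j < k) vnorm mu I p (h j))%E.
  elim: k => [|k IH].
    rewrite big_ord0 (_ : (fun _ => _) = fun=> 0); last first.
      by apply/funext => t; rewrite big_ord0.
    by rewrite vnorm0.
  rewrite big_ord_recr/= (le_trans _ (leeD IH (lexx _)))//.
  apply: (le_vnormD mI p1 (ms _) (ms _) (mh _)).
  by apply: nearW => t _; rewrite big_ord_recr/= (le_trans (ler_normD _ _))// normr_id.
apply: (le_trans _ (G n)); apply: (le_vnorm mI p0 mf (ms _)).
by apply: nearW => t It; rewrite [leRHS]ger0_norm ?sumr_ge0//; exact: fh.
Qed.

Lemma vnorm_indicator (A : set T) (v : E) eta : measurable A -> 0 <= eta ->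
  (mu A <= (eta `^ p)%:E)%E -> (vnorm mu I p (extend0 A (fun=> v)) <= (`|v| * eta)%:E)%E.
Proof.
move=> mA eta0 muA.
have mv := vmeasurable_norm (vmeasurable_extend0 mA measurableT (@subsetT _ A)
  (vmeasurable_cst (D := A) v)).
apply: (le_trans (sub_vnorm mu mI measurableT p0 (@subsetT _ I) mv)).
rewrite vnorm_extend0// vnorm_le_int ?mulr_ge0//.
rewrite (integral_cst _ mA) powRM// EFinM.
by apply: lee_wpmul2l => //; rewrite lee_fin powR_ge0.
Qed.

(** The code [c] only chooses which [U k] carries the vector [e j]; finite sequences of naturals are
    countable. The sets may overlap, and the vectors then add up. *)
Definition step_function (c : seq nat) (t : T) : E :=
  \sum_(j < size c) extend0 (U (nth 0%N c j)) (fun=> e j) t.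

Let mext k v : vmeasurable I (extend0 (U k) (fun=> v : E)).
Proof.
move=> y; apply: measurable_funS measurableT (@subsetT _ I) _.
exact: (vmeasurable_extend0 (mU k) measurableT (@subsetT _ _) (vmeasurable_cst v)).
Qed.

Lemma vmeasurable_step_function c : vmeasurable I (step_function c).
Proof.
rewrite /step_function; elim: (size c) => [|n IH].
  rewrite (_ : (fun t => _) = fun=> 0); first exact: vmeasurable_cst.
  by apply/funext => t; rewrite big_ord0.
rewrite (_ : (fun t => _) = fun t => \sum_(j < n) extend0 (U (nth 0%N c j)) (fun=> e j) t +
    extend0 (U (nth 0%N c n)) (fun=> e n) t).
  by apply: (vmeasurableD e_dense).
by apply/funext => t; rewrite big_ord_recr.
Qed.

Lemma vnorm_step_function c : (vnorm mu I p (step_function c) < +oo)%E.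
Proof.
pose h j := extend0 (U (nth 0%N c j)) (fun=> e j).
apply: (@le_lt_trans _ _ (\sum_(j < size c) vnorm mu I p (h j))%E).
  apply: le_vnorm_sum.
  - exact/vmeasurable_norm/vmeasurable_step_function.
  - by move=> j; exact/vmeasurable_norm/mext.
  - by move=> t _; exact: ler_norm_sum.
apply: lte_sum_pinfty => j _.
apply: (@le_lt_trans _ _ (vnorm mu I p (fun=> `|e j|))); last exact: vnorm_cst.
apply: (le_vnorm mI p0); [exact/vmeasurable_norm/mext|exact: measurable_cst|].
by apply: nearW => t _; rewrite /h /extend0 normr_id; case: ifP => // _; rewrite normr0.
Qed.

(** First [f] is replaced by its nearest points among [e 0, ..., e n], then each level set [A j] by
    some [U k]. The second error lives on the symmetric differences [B j]. *)
Lemma Lp_step_dense (f : T -> E) eps : vmeasurable I f -> (vnorm mu I p f < +oo)%E ->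
  0 < eps -> exists c, (vnorm mu I p (fun t => f t - step_function c t)%R <= eps%:E)%E.
Proof.
move=> mf fy eps0; have eh : 0 < eps / 2 by rewrite divr_gt0.
pose s n t := e (nearest e n (f t)).
have ms n : vmeasurable I (s n).
  move=> y; exact: (@measurable_nearest _ _ _ _ e I f (fun j _ => `|e j - y|) n mf
    (fun j => measurable_cst _)).
have mB (g g' : T -> E) : vmeasurable I g -> vmeasurable I g' ->
    measurable_fun I (fun t => `|g t - g' t|).
  by move=> mg mg'; exact/vmeasurable_norm/(vmeasurableB e_dense).
have [||n /(_ n (leqnn n)) Hn] := @vnorm_dominated _ _ _ mu _ _ I p
  (fun n t => f t - s n t) f (eps / 2) mI p0 (fun n => mB _ _ mf (ms n))
  (vmeasurable_norm mf) fy _ _ eh.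
- by move=> n t _; exact: (nearest_norm e0).
- apply: nearW => t It; apply/cvgr0Pnorm_lt => r r0.
  have /cvgrPdist_lt/(_ _ r0) := @cvg_nearest _ _ e e_dense (f t).
  by apply: filterS => n; rewrite normr_id.
pose A j := I `&` [set t | nearest e n (f t) = j].
have mA j : measurable (A j).
  have := @measurable_nearest _ _ _ _ e I f (fun i t => (i == j)%:R) n mf
    (fun i => measurable_cst _) mI [set 1] (measurable_set1 _).
  congr measurable; congr (_ `&` _); apply/seteqP; split=> t /=.
    by case: eqP => // _ /esym/eqP; rewrite oner_eq0.
  by move=> ->; rewrite eqxx.
(* Chosen so that each of the [n + 1] terms [|e j| * eta j] is at most [eps / 2 / (n + 1)]; the
   added 1 covers [e j = 0]. Measures are compared with [eta j ^ p] because the norm of an indicator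
   is a [p]-th root. *)
pose eta j := eps / 2 / n.+1%:R / (`|e j| + 1).
have eta0 j : 0 < eta j by rewrite !divr_gt0// ltr_wpDl.
have /choice[k kP] j : exists k, (mu ((A j `\` U k) `|` (U k `\` A j)) < (eta j `^ p)%:E)%E.
  by apply: U_dense => //; [exact: subIsetl|rewrite powR_gt0].
pose c := [seq k j | j <- iota 0 n.+1].
have sc : size c = n.+1 by rewrite size_map size_iota.
have nc j : (j < n.+1)%N -> nth 0%N c j = k j.
  by move=> jn; rewrite (nth_map 0%N) ?size_iota// nth_iota.
pose B j := (A j `\` U (k j)) `|` (U (k j) `\` A j).
have mBj j : measurable (B j) by apply: measurableU; exact: measurableD.
exists c; have mstep := vmeasurable_step_function c.
have H1 : (vnorm mu I p (fun t => f t - step_function c t)%R <=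
    vnorm mu I p (fun t => f t - s n t)%R + vnorm mu I p (fun t => s n t - step_function c t)%R)%E.
  apply: (le_vnormD mI p1 (mB _ _ mf mstep) (mB _ _ mf (ms n)) (mB _ _ (ms n) mstep)).
  by apply: nearW => t _; exact: ler_distD.
apply: (le_trans H1); rewrite [eps]splitr EFinD; apply: leeD => //.
have H2 : (vnorm mu I p (fun t => s n t - step_function c t)%R <=
    \sum_(j < n.+1) vnorm mu I p (extend0 (B j) (fun=> e j)))%E.
  apply: (@le_vnorm_sum E n.+1 _ (fun j => extend0 (B j) (fun=> e j))).
    exact: mB.
    move=> j; apply/vmeasurable_norm => y.
    apply: measurable_funS measurableT (@subsetT _ I) _.
    exact: (vmeasurable_extend0 (mBj j) measurableT (@subsetT _ _) (vmeasurable_cst _)).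
  move=> t It.
  have -> : s n t = \sum_(j < n.+1) extend0 (A j) (fun=> e j) t.
    have jn : (nearest e n (f t) < n.+1)%N by rewrite ltnS nearest_le.
    rewrite (bigD1 (Ordinal jn))//= {1}/extend0 mem_set//= big1 ?addr0// => j jt.
    rewrite /extend0; case: ifP => // /set_mem[_ /= tj]; case/eqP: jt.
    exact/val_inj.
  rewrite /step_function sc -sumrB (le_trans (ler_norm_sum _ _ _))//.
  apply: ler_sum => j _; rewrite nc// /extend0.
  have [tA|tA] := boolP (t \in A j); have [tU|tU] := boolP (t \in U (k j)).
  - by rewrite subrr normr0.
  - rewrite mem_set ?subr0//; left; split; first exact: set_mem.
    by move=> /mem_set; apply/negP.
  - rewrite mem_set ?sub0r ?normrN//; right; split; first exact: set_mem.
    by move=> /mem_set; apply/negP.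
  - by rewrite subrr normr0.
apply: (le_trans H2).
apply: (@le_trans _ _ (\sum_(j < n.+1) (eps / 2 / n.+1%:R)%:E)%E); last first.
  by rewrite sumEFin sumr_const card_ord -[X in X%:E]mulr_natr divfK.
apply: lee_sum => j _.
apply: (le_trans (vnorm_indicator _ (mBj j) (ltW (eta0 j)) (ltW (kP j)))).
rewrite lee_fin /eta mulrCA ler_piMr//; first by rewrite divr_ge0// ltW.
by rewrite ler_pdivrMr ?ltr_wpDl// mul1r lerDl.
Qed.

End Lp_density.

(** * The defect of the inclusion *)

Section inclusion_defect.
Context d (T : measurableType d) {R : realType} (mu : {measure set T -> \bar R}).
Context {E : normedModType R}.
Variable e : nat -> E.
Hypothesis e_dense : forall x eps, 0 < eps -> exists j, `|x - e j| < eps.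
Variables (p : R) (I : set T) (m : nat) (J : nat -> set T).
Hypotheses (p1 : 1 <= p) (mI : measurable I) (muI : (mu I < +oo)%E)
  (mJ : forall i, measurable (J i)) (JI : forall i, J i `<=` I)
  (IJ : forall t, I t -> exists2 i, (i < m)%N & J i t).
Variables (N : set T) (F : T -> E -> set E) (al be : T -> R).
Hypotheses (mN : measurable N) (N0 : mu N = 0%E).
Hypothesis F0 : forall t x, I t -> F t x !=set0.
Hypothesis F_closed : forall t x, I t -> closed (F t x).
Hypothesis F_convex : forall t x, I t -> convex_set (F t x : set (convex_lmodType E)).
Hypothesis mF : forall x C, open C -> measurable [set t | I t /\ F t x `<=` C].
Hypothesis F_lip : forall t, I t -> ~ N t -> forall x y,
  (hausdorff_dist (F t x) (F t y) <= (al t * `|x - y|)%:E)%E.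
Hypothesis F_be : forall t, I t -> ~ N t -> (dist_set 0%R (F t 0%R) <= (be t)%:E)%E.
Hypotheses (Lal : lebesgue_class mu p I al) (Lbe : lebesgue_class mu p I be).
(** The analogue of [Lp_fun] over an abstract measure; [vclass_Lp_fun] identifies the two on
    [[0, T]]. *)
Definition vclass (u : T -> E) := vmeasurable I u /\ (vnorm mu I p u < +oo)%E.
Variables (Phi : (T -> E) -> T -> E) (C eta : R).
Hypotheses (C0 : 0 <= C) (eta0 : 0 <= eta).
Hypothesis Phi_meas : forall u, vclass u -> vmeasurable I (Phi u).
Hypothesis Phi_bdd : forall u, vclass u -> exists M, forall t, I t -> `|Phi u t| <= M.
Hypothesis Phi_causal : forall u u', vclass u -> vclass u' -> forall i t, J i t ->
  `|Phi u t - Phi u' t| <=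
  C * \sum_(j < i.+1) piece_norm mu p J j (fun t => u t - u' t).
Hypothesis al_eta : forall i, piece_norm mu p J i al <= eta.
Hypothesis Ceta : 2 * eta * C <= 8^-1.

Local Notation wn := (weighted_norm mu p m J).
Local Notation df := (defect N F).
Local Notation cls := (lebesgue_class mu p I).
Let p0 : 0 < p := lt_le_trans ltr01 p1.

(** This is the [rho u v] of the overview, taken in the weighted norm: [u] enters only through the
    state [Phi u], and [v] is tested against the values of [F]. *)
Definition total_defect (u v : T -> E) : R := wn (fun t => df t (Phi u t) (v t)).

Lemma vclass_class u : vclass u -> cls u.
Proof. by move=> [mu1 uy]; split => //; exact: vmeasurable_norm. Qed.

Lemma vclassB u v : vclass u -> vclass v -> vclass (fun t => u t - v t).
Proof.
move=> [mu1 uy] [mv vy]; have mB := vmeasurableB e_dense mu1 mv; split => //.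
apply: (@le_lt_trans _ _ (vnorm mu I p u + vnorm mu I p v)%E); last exact: lte_add_pinfty.
apply: (le_vnormD mI p1 (vmeasurable_norm mB) (vmeasurable_norm mu1) (vmeasurable_norm mv)).
by apply: nearW => t _; exact: ler_normB.
Qed.

Lemma class_le {U V W : normedModType R} (f : T -> U) (g : T -> V) (h : T -> W) :
  measurable_fun I (fun t => `|f t|) -> cls g -> cls h ->
  (forall t, I t -> `|f t| <= `|g t| + `|h t|) -> cls f.
Proof.
move=> mf [mg gy] [mh hy] fgh; split => //.
apply: (@le_lt_trans _ _ (vnorm mu I p g + vnorm mu I p h)%E); last exact: lte_add_pinfty.
by apply: (le_vnormD mI p1 mf mg mh); exact: nearW.
Qed.

Lemma class_cst (c : R) : cls (fun=> c : R).
Proof. by split; [exact: measurable_cst|exact: vnorm_cst]. Qed.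

Lemma measurable_df u v : vclass u -> vclass v ->
  measurable_fun I (fun t => df t (Phi u t) (v t)).
Proof.
move=> Lu [mv _].
by apply: (measurable_defect e_dense mI mN F0 mF F_lip); [exact: Phi_meas|].
Qed.

Lemma measurable_norm_df u v : vclass u -> vclass v ->
  measurable_fun I (fun t => `|df t (Phi u t) (v t)|).
Proof.
move=> Lu Lv; apply: measurableT_comp; first exact: normr_measurable.
exact: measurable_df.
Qed.

Lemma class_normM {V W : normedModType R} (f : T -> V) (g : T -> W) (M : R) : cls f ->
  measurable_fun I (fun t => `|g t|) ->
  (forall t, I t -> `|g t| <= M) -> cls (fun t => `|f t| * `|g t|).
Proof.
move=> Lf mg gM; have mfg : measurable_fun I (fun t => `| `|f t| * `|g t| |).
  apply: measurableT_comp; first exact: normr_measurable.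
  by apply: measurable_funM; [case: Lf|].
have LM : cls (fun t => `|M| *: f t).
  split.
    rewrite (_ : (fun t => _) = fun t => `|M| * `|f t|).
      by apply: measurable_funM; [exact: measurable_cst|case: Lf].
    by apply/funext => t; rewrite normrZ normr_id.
  rewrite (vnormZ mu _ mI p0 Lf.1) normr_id.
  have ffin : vnorm mu I p f \is a fin_num.
    by rewrite ge0_fin_numE ?vnorm_ge0//; case: Lf.
  by rewrite -(fineK ffin) -EFinM ltry.
apply: (class_le mfg LM (class_cst 0)) => t It.
have -> : `| `|M| *: f t| + `|0 : R| = `|M| * `|f t|.
  by rewrite normrZ normr_id normr0 addr0.
rewrite normrM !normr_id mulrC ler_wpM2r//.
by rewrite (le_trans (gM t It))// ler_norm.
Qed.

Lemma class_df u v : vclass u -> vclass v -> cls (fun t => df t (Phi u t) (v t)).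
Proof.
move=> Lu Lv; have [M PhiM] := Phi_bdd Lu.
have mP := vmeasurable_norm (Phi_meas Lu).
have L1 := class_normM Lal mP PhiM.
have m2 : measurable_fun I (fun t => `| `|al t| * `|Phi u t| + `|be t| |).
  apply: measurableT_comp; first exact: normr_measurable.
  apply: measurable_funD; last by case: Lbe.
  by apply: measurable_funM => //; case: Lal.
have L2 : cls (fun t => `|al t| * `|Phi u t| + `|be t|).
  by apply: (class_le m2 L1 Lbe) => t It; rewrite (le_trans (ler_normD _ _))// normr_id.
apply: (class_le (measurable_norm_df Lu Lv) (vclass_class Lv) L2) => t It.
rewrite ger0_norm ?defect_ge0// ger0_norm ?addr_ge0 ?mulr_ge0// addrA.
exact: (defect_le F0 F_lip F_be).
Qed.

Lemma total_defect_ge0 u v : 0 <= total_defect u v.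
Proof. exact: weighted_norm_ge0. Qed.

(** Changing [v] costs the norm of the change. Changing [u] costs [|al|] times the change of the
    state, to which [weighted_norm_causal] applies; [Ceta] brings its constant down to [8^-1]. *)
Lemma total_defect_lip u v u' v' : vclass u -> vclass v -> vclass u' -> vclass v' ->
  total_defect u v <=
    total_defect u' v' + wn (fun t => v t - v' t) + 8^-1 * wn (fun t => u t - u' t).
Proof.
move=> Lu Lv Lu' Lv'.
have Lvv := vclassB Lv Lv'; have Luu := vclassB Lu Lu'.
have mPP : measurable_fun I (fun t => `|Phi u t - Phi u' t|).
  apply: vmeasurable_norm; apply: (vmeasurableB e_dense); exact: Phi_meas.
have [M PhiM] := Phi_bdd Lu; have [M' PhiM'] := Phi_bdd Lu'.
have LaP : cls (fun t => `|al t| * `|Phi u t - Phi u' t|).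
  apply: (class_normM (M := M + M') Lal mPP) => t It.
  by rewrite (le_trans (ler_normB _ _))// lerD ?PhiM ?PhiM'.
pose w t := `|v t - v' t| + `|al t| * `|Phi u t - Phi u' t|.
have mvv : measurable_fun I (fun t => `|v t - v' t|) by exact/vmeasurable_norm/Lvv.1.
have mw : measurable_fun I (fun t => `|w t|).
  apply: measurableT_comp; first exact: normr_measurable.
  apply: measurable_funD => //; apply: measurable_funM => //; by case: Lal.
have w_le t : `|w t| <= `|v t - v' t| + `| `|al t| * `|Phi u t - Phi u' t| |.
  by rewrite (le_trans (ler_normD _ _))// normr_id.
have Lw : cls w by apply: (class_le mw (vclass_class Lvv) LaP) => t _.
have H1 : total_defect u v <= total_defect u' v' + wn w.
  apply: (weighted_normD m p1 mI mJ JI (measurable_norm_df Lu Lv) (class_df Lu' Lv') Lw).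
  apply: nearW => t It; rewrite !ger0_norm ?defect_ge0 ?addr_ge0 ?mulr_ge0//.
  have := defect_lip N F0 (Phi u t) (v t) (v' t) It.
  have := defect_lipx F0 F_lip (Phi u t) (Phi u' t) (v' t) It.
  by rewrite /w => ? ?; lra.
have H2 : wn w <= wn (fun t => v t - v' t) + wn (fun t => `|al t| * `|Phi u t - Phi u' t|).
  by apply: (weighted_normD m p1 mI mJ JI mw (vclass_class Lvv) LaP); exact: nearW.
have H3 : wn (fun t => `|al t| * `|Phi u t - Phi u' t|) <=
    2 * eta * C * wn (fun t => u t - u' t).
  apply: (weighted_norm_causal m p1 mI mJ JI C0 eta0 LaP.1 Lal (vclass_class Luu) al_eta).
  move=> i t Jt; rewrite normrM !normr_id mulrC ler_wpM2r//.
  exact: Phi_causal.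
have H4 : 2 * eta * C * wn (fun t => u t - u' t) <= 8^-1 * wn (fun t => u t - u' t).
  by rewrite ler_wpM2r// weighted_norm_ge0.
rewrite -addrA (le_trans H1)// lerD2l (le_trans H2)// lerD2l.
exact: le_trans H3 H4.
Qed.

Lemma total_defect_convex u a v w : vclass u -> vclass v -> vclass w -> 0 <= a <= 1 ->
  vclass (fun t => a *: v t + (1 - a) *: w t) ->
  total_defect u (fun t => a *: v t + (1 - a) *: w t) <=
    a * total_defect u v + (1 - a) * total_defect u w.
Proof.
move=> Lu Lv Lw a01 Lvw; have /andP[a0 a1] := a01.
have Z (c : R) z : vclass z -> cls (fun t => c *: (df t (Phi u t) (z t) : R^o)).
  move=> Lz; have Ld := class_df Lu Lz; split.
    rewrite (_ : (fun t => _) = fun t => `|c| * `|df t (Phi u t) (z t)|).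
      by apply: measurable_funM; [exact: measurable_cst|case: Ld].
    by apply/funext => t; rewrite normrZ.
  rewrite (vnormZ mu _ mI p0 Ld.1).
  have ffin : vnorm mu I p (fun t => df t (Phi u t) (z t)) \is a fin_num.
    by rewrite ge0_fin_numE ?vnorm_ge0//; case: Ld.
  by rewrite -(fineK ffin) -EFinM ltry.
have ZE (c : R) z : 0 <= c -> vclass z ->
    c * total_defect u z = wn (fun t => c *: (df t (Phi u t) (z t) : R^o)).
  move=> c0 Lz; rewrite (weighted_normZ m p1 mI mJ JI c (class_df Lu Lz)).
  by rewrite ger0_norm.
rewrite !ZE ?subr_ge0//.
apply: (weighted_normD m p1 mI mJ JI (measurable_norm_df Lu Lvw) (Z a v Lv) (Z (1 - a) w Lw)).
apply: nearW => t It; rewrite !normrZ !ger0_norm ?defect_ge0 ?subr_ge0//.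
exact: (defect_convex N F0 F_convex).
Qed.

Lemma total_defect_select u : vclass u -> 0 < total_defect u u ->
  exists2 v, vclass v &
    total_defect u v < total_defect u u / 2 /\ wn (fun t => v t - u t) < 2 * total_defect u u.
Proof.
move=> Lu ruu; pose K := wn (fun=> 1 : R).
have K0 : 0 <= K by exact: weighted_norm_ge0.
(* The constant map [eps] has weighted norm [eps * K], which this choice keeps below half the
   defect, also when [K = 0]. That single bound serves both conclusions. *)
pose eps := total_defect u u / (4 * (K + 1)).
have eps0 : 0 < eps by rewrite divr_gt0// mulr_gt0// ltr_wpDl.
have epsK : eps * K < total_defect u u / 2.
  rewrite /eps mulrAC ltr_pdivrMr ?mulr_gt0 ?ltr_wpDl// -!mulrA ltr_pM2l//.
  by lra.
have [v mv vP] := measurable_approximate_selection e_dense mI mN F0 mF F_lip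
  Lu.1 (Phi_meas Lu) eps0.
have Ldu := class_df Lu Lu.
have muv : measurable_fun I (fun t => `|u t - v t|).
  by apply: vmeasurable_norm; apply: (vmeasurableB e_dense) => //; exact: Lu.1.
have Luv : cls (fun t => u t - v t).
  apply: (class_le muv Ldu (class_cst eps)) => t It.
  by have [_ /ltW/le_trans] := vP t It; apply; rewrite !ger0_norm ?defect_ge0// ltW.
(* The selection is [p]-integrable because it stays within the defect plus [eps] of [u]. *)
have Lv : vclass v.
  split => //; have [] // : cls v.
  apply: (class_le (vmeasurable_norm mv) (vclass_class Lu) Luv) => t It.
  by rewrite -[X in `|X| <= _](subKr (u t)) ler_normB.
exists v => //.
have wcst : wn (fun=> eps : R) = eps * K.
  have := weighted_normZ m p1 mI mJ JI eps (class_cst 1).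
  rewrite ger0_norm ?(ltW eps0)// => <-; congr weighted_norm.
  by apply/funext => t; rewrite -[RHS]/(eps * 1) mulr1.
split.
  apply: le_lt_trans epsK; rewrite -wcst.
  apply: (le_weighted_norm m p1 mI mJ JI (measurable_norm_df Lu Lv) (class_cst eps)).
  apply: nearW => t It; rewrite !ger0_norm ?defect_ge0 ?(ltW eps0)//.
  by have [/ltW] := vP t It.
apply: (@le_lt_trans _ _ (total_defect u u + wn (fun=> eps : R))); last by rewrite wcst; lra.
have mvu : measurable_fun I (fun t => `|v t - u t|).
  by rewrite (_ : (fun t => _) = fun t => `|u t - v t|)//; apply/funext => t; rewrite distrC.
apply: (weighted_normD m p1 mI mJ JI mvu Ldu (class_cst eps)).
apply: nearW => t It; rewrite distrC.
by have [_ /ltW/le_trans] := vP t It; apply; rewrite !ger0_norm ?defect_ge0// ltW.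
Qed.

(** Outside the null set [N], distance 0 to a closed set is membership in it. *)
Lemma total_defect_eq0 u : vclass u -> (total_defect u u = 0 <->
  {ae mu, forall t, I t -> F t (Phi u t) (u t)}).
Proof.
move=> Lu; have aeN : {ae mu, forall t, ~ N t}.
  by exists N; split => // t /= /contrapT.
split=> [/(weighted_norm_eq0 p1 mI mJ JI IJ (class_df Lu Lu)) H|H].
  apply: filterS2 aeN H => t Nt H It; have := H It.
  rewrite /defect memNset//; apply: set_dist_eq0; [exact: F0|exact: F_closed].
apply: (ae_eq0_weighted_norm m p1 mI mJ JI (measurable_norm_df Lu Lu)).
apply: filterS H => t H It; rewrite /defect; case: ifP => // _.
exact/set_dist_mem/H.
Qed.

End inclusion_defect.

(** * L^p as a seminormed space *)

Section Lp_vectors.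
Context {R : realType} (a b p : R) (p1 : 1 <= p) (V : normedModType R).
Local Notation mu := (lebesgueR R).
Local Notation I := (`[a, b]%classic : set (lebR R)).

Lemma Lp_funZD (c : R) (f g : R -> V) : Lp_fun I p f -> Lp_fun I p g ->
  Lp_fun I p (fun t => c *: f t + g t).
Proof.
move=> [mf fy] [mg gy]; have p0 : 0 < p by exact: lt_le_trans p1.
have mI := measurable_cc a b : measurable I.
have mcf : strongly_measurable I (fun t => c *: f t).
  have [s [ss sf]] := mf; exists (fun n t => c *: s n t); split.
    move=> n; exact: (simple_function_comp2 (fun x _ => c *: x) (ss n) (ss n)).
  by apply: filterS sf => t sf It; apply: cvgZr; exact: sf.
have msum : strongly_measurable I (fun t => c *: f t + g t).
  have [s [ss sf]] := mcf; have [r [sr rg]] := mg.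
  exists (fun n t => s n t + r n t); split.
    by move=> n; exact: simple_function_comp2.
  by apply: filterS2 sf rg => t sf rg It; apply: cvgD; [exact: sf|exact: rg].
split => //.
have H : (bochner_norm I p (fun t => c *: f t + g t)%R <=
    bochner_norm I p (fun t => c *: f t)%R + bochner_norm I p g)%E.
  apply: (le_vnormD mI p1 (strongly_measurable_norm mI msum)
    (strongly_measurable_norm mI mcf) (strongly_measurable_norm mI mg)).
  by apply: nearW => t _; exact: ler_normD.
apply: (le_lt_trans H); apply: lte_add_pinfty => //.
rewrite bochner_normV (vnormZ mu c mI p0 (strongly_measurable_norm mI mf)).
have ffin : vnorm mu I p (f : lebR R -> V) \is a fin_num.
  by rewrite ge0_fin_numE ?vnorm_ge0.
by rewrite -(fineK ffin) -EFinM ltry.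
Qed.

Definition Lp_pred of 1 <= p : {pred R -> V} := [pred f : R -> V | `[< Lp_fun I p f >]].

Lemma Lp_predP (f : R -> V) : reflect (Lp_fun I p f) (f \in Lp_pred p1).
Proof. exact: asboolP. Qed.

Lemma Lp_pred_submod_closed : submod_closed (Lp_pred p1).
Proof.
split; first by apply/Lp_predP; exact: Lp_fun0.
by move=> c f g Lf Lg; apply/Lp_predP; apply: Lp_funZD; exact/Lp_predP.
Qed.

HB.instance Definition _ := GRing.isSubmodClosed.Build R (R -> V)
  (Lp_pred p1) Lp_pred_submod_closed.

(* Maps rather than classes: this spares the vector space structure of the
   quotient, at the price of seminorms. *)
Record Lp_vec := LpVec { Lp_vec_fun :> R -> V; _ : Lp_vec_fun \in Lp_pred p1 }.

HB.instance Definition _ := [isSub for Lp_vec_fun].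
HB.instance Definition _ := [Choice of Lp_vec by <:].
HB.instance Definition _ := [SubChoice_isSubLmodule of Lp_vec by <:].

Lemma Lp_vecP (f : Lp_vec) : Lp_fun I p f.
Proof. by case: f => f fP; exact/Lp_predP. Qed.

Definition Lp_vec_of (f : R -> V) (Lf : Lp_fun I p f) : Lp_vec :=
  LpVec (introT (Lp_predP f) Lf).

End Lp_vectors.

Section Lp_vector_space.
Context {R : realType} (T p : R) (T0 : 0 <= T) (p1 : 1 <= p).
Local Notation mu := (lebesgueR R).
Local Notation Leb := (lebR R).
Local Notation I := (`[0, T]%classic : set Leb).

Lemma step_index (h t : R) k : 0 <= t -> t <= k%:R * h -> (0 < k)%N ->
  exists2 j, (j < k)%N & j%:R * h <= t <= j.+1%:R * h.
Proof.
move=> t0; elim: k => // k IH tk _.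
have [kt|kt] := leP (k%:R * h) t; first by exists k => //; rewrite kt.
case: k => [|k] in IH tk kt *; first by move: kt; rewrite mul0r ltNge t0.
have [j jk jt] := IH (ltW kt) isT; exists j => //.
exact: leq_trans jk _.
Qed.

(** Successive intervals of equal length, short enough for absolute continuity of the norm of [al].
    The fourth property expresses their order: any time before a point of piece [i] lies in a piece
    of index at most [i]. *)
Lemma small_pieces (V : normedModType R) (al : R -> V) eta : Lp_fun I p al -> 0 < eta ->
  exists m (J : nat -> set Leb), [/\ forall i, measurable (J i), forall i, J i `<=` I,
    forall t, I t -> exists2 i, (i < m)%N & J i t,
    forall i t, J i t -> forall s, 0 <= s <= t -> exists2 j, (j < i.+1)%N & J j s &
    forall i, piece_norm mu p J i (al : Leb -> V) <= eta].
Proof.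
move=> [mal aly] eta0; have mI := measurable_cc 0 T : measurable I.
have p0 : 0 < p by exact: lt_le_trans p1.
have [del del0 H] := vnorm_absolute_continuity mI p0 (strongly_measurable_norm mI mal) aly eta0.
have [n nT] : exists n : nat, T / del < n.+1%:R.
  have T1 : 0 <= T / del by rewrite divr_ge0// ltW.
  exists (Num.bound (T / del)); rewrite (lt_trans (archi_boundP T1))//.
  by rewrite ltr_nat.
pose m := n.+1; pose h := T / m%:R.
have h0 : 0 <= h by rewrite divr_ge0.
have hdel : h < del by rewrite /h ltr_pdivrMr// mulrC -ltr_pdivrMr.
pose J i : set Leb := I `&` `[i%:R * h, i.+1%:R * h]%classic.
have mcc i : measurable (`[i%:R * h, i.+1%:R * h]%classic : set Leb) by exact: measurable_cc.
have mJ i : measurable (J i) by exact: measurableI.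
have JI i : J i `<=` I by exact: subIsetl.
have TE : m%:R * h = T by rewrite /h mulrC divfK// /m pnatr_eq0.
exists m, J; split => //.
- move=> t It; move: (It); rewrite /= in_itv/= => /andP[t0 tT].
  have [|j jm jt] := @step_index h t m t0 _ isT; first by rewrite TE.
  by exists j => //; split => //=; rewrite in_itv.
- move=> i t [It /=]; rewrite in_itv/= => /andP[_ ti] s /andP[s0 st].
  have [|j jm js] := @step_index h s i.+1 s0 _ isT; first exact: le_trans st ti.
  exists j => //; split => /=; rewrite in_itv//=.
  move: It; rewrite /= in_itv/= => /andP[_ tT].
  by rewrite s0 (le_trans st).
move=> i; rewrite /piece_norm.
have := H (J i) (mJ i) (JI i).
have muJ : (mu (J i) < del%:E)%E.
  apply: (@le_lt_trans _ _ (mu (`[i%:R * h, i.+1%:R * h]%classic : set Leb))).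
    exact: (le_measure mu (mem_set (mJ i)) (mem_set (mcc i)) (@subIsetr _ _ _)).
  rewrite (_ : mu _ = lebesgue_measure `[i%:R * h, i.+1%:R * h]%classic)//.
  rewrite lebesgue_measure_itv/=; case: ifP => _; last by rewrite lte_fin.
  by rewrite EFinN -EFinD lte_fin -mulrBl -natrB// subSnn mul1r.
move=> /(_ muJ) Jeta; rewrite -lee_fin fineK// ge0_fin_numE ?vnorm_ge0//.
by rewrite (le_lt_trans Jeta)// ltry.
Qed.

Context {E : completeNormedModType R}.
Variable e : nat -> E.
Hypothesis e0 : e 0%N = 0.
Hypothesis e_dense : forall x eps, 0 < eps -> exists j, `|x - e j| < eps.
Variables (m : nat) (J : nat -> set Leb).
Hypotheses (mJ : forall i, measurable (J i)) (JI : forall i, J i `<=` I)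
  (IJ : forall t, I t -> exists2 i, (i < m)%N & J i t).
Local Notation X := (Lp_vec 0 T p1 E).
Local Notation wn := (weighted_norm mu p m J).

Let mI : measurable I := measurable_cc 0 T.

Definition Lp_wnorm (x : X) : R := wn (x : Leb -> E).

Lemma vclass_Lp_fun (f : R -> E) : vclass mu p I (f : Leb -> E) <-> Lp_fun I p f.
Proof.
split=> -[mf fy]; (split; last exact: fy).
  exact: (vmeasurable_strongly e_dense mI mf).
exact: (strongly_vmeasurable mI mf).
Qed.

Lemma vclass_vec (x : X) : vclass mu p I (x : Leb -> E).
Proof. exact/vclass_Lp_fun/Lp_vecP. Qed.

Lemma class_vec (x : X) : lebesgue_class mu p I (x : Leb -> E).
Proof. exact/vclass_class/vclass_vec. Qed.

Lemma Lp_wnorm_seminorm : seminorm Lp_wnorm.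
Proof.
split=> [x y|c x]; last exact: (weighted_normZ m p1 mI mJ JI c (class_vec x)).
apply: (weighted_normD m p1 mI mJ JI (class_vec (x + y)).1 (class_vec x) (class_vec y)).
by apply: nearW => t _; exact: ler_normD.
Qed.

Lemma vec_fin (x : X) : vnorm mu I p (x : Leb -> E) \is a fin_num.
Proof. by rewrite ge0_fin_numE ?vnorm_ge0//; case: (class_vec x). Qed.

Lemma Lp_wnorm_le (x : X) c : (vnorm mu I p (x : Leb -> E) <= c%:E)%E ->
  Lp_wnorm x <= 2 * c.
Proof.
move=> xc; rewrite (le_trans (weighted_norm_le m p1 mI mJ JI (class_vec x)))//.
by rewrite ler_wpM2l// -lee_fin (fineK (vec_fin x)).
Qed.

Lemma vnorm_Lp_wnorm (x : X) : (vnorm mu I p (x : Leb -> E) <= (2 ^+ m * Lp_wnorm x)%:E)%E.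
Proof.
rewrite -(fineK (vec_fin x)) lee_fin.
exact: (le_vnorm_weighted p1 mI mJ JI IJ (class_vec x)).
Qed.

Lemma Lp_vec_separable : exists g : nat -> X,
  forall x eps, 0 < eps -> exists j, Lp_wnorm (x - g j) < eps.
Proof.
have muI := finite_measure_cc 0 T : (mu I < +oo)%E.
pose U k : set Leb := rational_union (odflt [::] (unpickle k)).
have mU k : measurable (U k).
  by apply: sub_caratheodory; exact: measurable_rational_union.
have U_dense A eps : measurable A -> A `<=` I -> 0 < eps ->
    exists k, (mu ((A `\` U k) `|` (U k `\` A)) < eps%:E)%E.
  move=> mA AI eps0; have muA : (mu A < +oo)%E.
    apply: le_lt_trans muI; exact: (le_measure mu (mem_set mA) (mem_set mI) AI).
  have [c Hc] := rational_union_approx mA muA eps0.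
  by exists (pickle c); rewrite /U pickleK.
have step c : Lp_fun I p (step_function e U c : R -> E).
  apply/vclass_Lp_fun; split.
    exact: (vmeasurable_step_function e_dense mU).
  exact: (vnorm_step_function e_dense mI muI p1 mU).
pose g k : X := Lp_vec_of p1 (step (odflt [::] (unpickle k))).
exists g => x eps eps0.
(* Passing from the [L^p] norm to the weighted norm costs a factor 2 ([Lp_wnorm_le]), which leaves
   [eps / 2 < eps]. *)
have e4 : 0 < eps / 4 by rewrite divr_gt0.
have [c Hc] := Lp_step_dense e0 e_dense mI p1 mU U_dense
  (vclass_vec x).1 (vclass_vec x).2 e4.
exists (pickle c).
have H : (vnorm mu I p (((x - g (pickle c))%R : X) : Leb -> E) <= (eps / 4)%:E)%E.
  by move: Hc; rewrite /g; congr (vnorm _ _ _ _ <= _)%E; rewrite pickleK.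
apply: (le_lt_trans (Lp_wnorm_le H)).
by rewrite mulrA ltr_pdivrMr// mulrC ltr_pM2l// ltr_nat.
Qed.

(** The geometric bounds pass to the [L^p] norm with a factor [2 ^+ m], and the limit found there is
    a limit in the weighted norm. *)
Lemma Lp_vec_complete q : 0 < q -> p^-1 + q^-1 = 1 -> forall (v : nat -> X) C a,
  0 <= a < 1 -> (forall n, Lp_wnorm (v n.+1 - v n) <= C * a ^+ n) ->
  exists x, forall eps, 0 < eps ->
    exists n0, forall n, (n0 <= n)%N -> Lp_wnorm (x - v n) < eps.
Proof.
move=> q0 pq v C a a01 vC; have muI := finite_measure_cc 0 T : (mu I < +oo)%E.
have C0 : 0 <= C.
  have := vC 0%N; rewrite expr0 mulr1; apply: le_trans.
  exact: weighted_norm_ge0.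
have D0 : 0 <= 2 ^+ m * C by rewrite mulr_ge0// exprn_ge0.
have fast n : (vnorm mu I p (fun t : Leb => v n.+1 t - v n t)%R <=
    (2 ^+ m * C * a ^+ n)%:E)%E.
  apply: (le_trans (vnorm_Lp_wnorm (v n.+1 - v n)%R)).
  by rewrite lee_fin -mulrA ler_wpM2l ?exprn_ge0.
have [g [mg gy gP]] := Lp_complete e_dense mI muI p1 q0 pq D0 a01
  (fun n => (vclass_vec (v n)).1) fast.
have Lg0 : Lp_fun I p (fun t => g t - v 0%N t).
  apply/vclass_Lp_fun; split; last exact: gy.
  exact: (vmeasurableB e_dense mg (vclass_vec (v 0%N)).1).
have Lg : Lp_fun I p g.
  have := Lp_funZD p1 1 Lg0 (Lp_vecP (v 0%N)); congr Lp_fun.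
  by apply/funext => t; rewrite scale1r subrK.
exists (Lp_vec_of p1 Lg) => eps eps0.
have [n0 Hn0] := gP (eps / 4) ltac:(by rewrite divr_gt0).
exists n0 => n /Hn0 H.
apply: (le_lt_trans (@Lp_wnorm_le (Lp_vec_of p1 Lg - v n) _ H)).
by rewrite mulrA ltr_pdivrMr// mulrC ltr_pM2l// ltr_nat.
Qed.

End Lp_vector_space.

(** * The solution set *)

Section solution_map.
Context {R : realType} (T p q : R) (T0 : 0 <= T) (p1 : 1 < p) (q1 : 1 < q).
Hypothesis pq : p^-1 + q^-1 = 1.
Context {E : completeNormedModType R}.
Local Notation mu := (lebesgueR R).
Local Notation Leb := (lebR R).
Local Notation I := (`[0, T]%classic : set Leb).
Variable e : nat -> E.
Hypothesis e0 : e 0%N = 0.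
Hypothesis e_dense : forall x eps, 0 < eps -> exists j, `|x - e j| < eps.
Variable k : R -> R -> endoL E.
Hypothesis k5 : forall t : R, t \in `[0, T] -> Lp_fun `[0, t]%classic q (k t).
Hypothesis k6 : {within `[0, T], continuous
  (fun t : R => Lp_class 0 T (ltW q1) (kernel_ext k t))}.
Variable h : R -> E.
Hypothesis hC : {within `[0, T], continuous h}.

Definition state (w : R -> E) (t : R) : E := h t + volterra k w t.

Let p0 : 0 < p := lt_trans ltr01 p1.
Let mI : measurable I := measurable_cc 0 T.

Lemma state_continuous w : Lp_fun I p w -> {within `[0, T], continuous (state w)}.
Proof.
move=> Lw; have /within_continuousP cV := volterra_continuous p1 pq e0 e_dense k5 k6 Lw.
have /within_continuousP ch := hC.
apply/within_continuousP => t eps It eps0.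
have e2 : 0 < eps / 2 by rewrite divr_gt0.
have [d1 d10 H1] := ch t _ It e2; have [d2 d20 H2] := cV t _ It e2.
exists (Num.min d1 d2); first by rewrite lt_min d10.
move=> t' It'; rewrite lt_min => /andP[/(H1 t' It') h1 /(H2 t' It') h2].
rewrite /state opprD addrACA (le_lt_trans (ler_normD _ _))//.
by rewrite [eps]splitr ltrD.
Qed.

Lemma state_bounded w : Lp_fun I p w -> exists M, forall t, I t -> `|state w t| <= M.
Proof.
move=> Lw; have [M HM] := within_continuous_bounded T0 (state_continuous Lw).
by exists M => t It; exact: HM.
Qed.

Lemma state_measurable w : Lp_fun I p w -> vmeasurable I (state w : Leb -> E).
Proof.
move=> Lw x.
have /within_continuousP cS := state_continuous Lw.
have c : {within `[0, T]%classic, continuous (fun t => `|state w t - x|)}.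
  apply/within_continuousP => t eps It eps0.
  have [del del0 H] := cS t eps It eps0; exists del => // t' It' /(H t' It').
  apply: le_lt_trans; rewrite (le_trans (ler_dist_dist _ _))//.
  by rewrite opprB addrA subrK.
have mf := subspace_continuous_measurable_fun (measurable_itv `[0, T]) c.
by move=> _ B mB; apply: sub_caratheodory; exact: mf.
Qed.

(** [h] cancels, and [volterra_dist] leaves the norm of [u - u'] over [[0, t]]. By [Jc] the pieces
    of index at most [i] cover that interval, so the norm is at most the sum of theirs. *)
Lemma state_causal C (J : nat -> set Leb) : 0 <= C ->
  (forall t, t \in `[0, T] -> (bochner_norm I q (kernel_ext k t) <= C%:E)%E) ->
  (forall i, measurable (J i)) -> (forall i, J i `<=` I) ->
  (forall i t, J i t -> forall s, 0 <= s <= t -> exists2 j, (j < i.+1)%N & J j s) ->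
  forall u u', Lp_fun I p u -> Lp_fun I p u' -> forall i t, J i t ->
  `|state u t - state u' t| <=
  C * \sum_(j < i.+1) piece_norm mu p J j (fun t : Leb => u t - u' t).
Proof.
move=> C0 CP mJ JI Jc u u' Lu Lu' i t Jt; have It := JI i t Jt.
have -> : state u t - state u' t = volterra k u t - volterra k u' t.
  by rewrite /state opprD addrACA subrr add0r.
rewrite -lee_fin.
apply: (le_trans (volterra_dist p1 q1 pq e0 e_dense k5 CP It Lu Lu')).
rewrite EFinM; apply: lee_wpmul2l; first by rewrite lee_fin.
have LB : Lp_fun I p (fun t => u t - u' t).
  have := Lp_funZD (ltW p1) (-1) Lu' Lu; congr Lp_fun.
  by apply/funext => s; rewrite scaleN1r addrC.
have mB := strongly_measurable_norm mI LB.1.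
have mt : measurable (`[0, t]%classic : set Leb) := measurable_cc 0 t.
have tI : (`[0, t]%classic : set Leb) `<=` I := sub_cc It.
have mBt := measurable_funS mI tI mB.
apply: (le_trans (@vnorm_bigcup _ _ _ mu _ i.+1 (fun j => J j `&` `[0, t]%classic)
  _ _ _ (fun j => measurableI _ _ (mJ j) mt) mt (ltW p1) (fun j => @subIsetr _ _ _) _ mBt)).
  move=> s st; have [|j ji js] := Jc i t Jt s; last by exists j.
  by move: st; rewrite /= in_itv.
rewrite -sumEFin; apply: lee_sum => j _.
rewrite /piece_norm fineK; last first.
  rewrite ge0_fin_numE ?vnorm_ge0//.
  by apply: le_lt_trans (sub_vnorm mu (mJ j) mI p0 (JI j) mB) _; case: LB.
apply: (sub_vnorm mu (measurableI _ _ (mJ j) mt) (mJ j) p0 (@subIsetl _ _ _)).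
exact: measurable_funS mI (JI j) mB.
Qed.

End solution_map.

(** * Closed embeddings in terms of distances *)

Section closed_embeddings.
Context {R : realType} {M Y : metricType R}.

Lemma near_mdist (y : Y) eps : 0 < eps -> \forall y' \near y, mdist y y' < eps.
Proof.
move=> e0; have := nbhsx_ballx y eps e0.
by apply: filterS => y'; rewrite ballEmdist.
Qed.

Lemma nbhs_mdist (y : Y) A : nbhs y A ->
  exists2 d : R, 0 < d & forall y', mdist y y' < d -> A y'.
Proof.
move=> /nbhs_ballP[d /= d0 dA]; exists d => // y' yy'.
by apply: dA; rewrite ballEmdist.
Qed.

Context {A : set M} {i : set_type A -> Y}.
Hypothesis ci : closed_embedding i.

(** Continuity of the inverse of [i]: a ball of the subspace is the preimage of an open set of
    [Y]. *)
Lemma closed_embedding_dist (z : set_type A) eps : 0 < eps ->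
  exists2 d : R, 0 < d & forall z', mdist (i z) (i z') < d ->
    mdist (set_val z) (set_val z') < eps.
Proof.
move=> e0; have [_ _ iopen _] := ci.
have oU : open ((set_val : set_type A -> M) @^-1` (ball (set_val z) eps)°).
  by apply: open_comp; [move=> ? _; exact: initial_continuous|exact: open_interior].
have [W oW UW] := iopen _ oU.
have Wz : W (i z).
  rewrite -[W (i z)]/((i @^-1` W) z) -UW /=.
  exact: nbhsx_ballx.
have [d d0 dW] := nbhs_mdist (open_nbhs_nbhs (conj oW Wz)).
exists d => // z' /dW Wz'.
have : (i @^-1` W) z' by [].
by rewrite -UW /= => /interior_subset; rewrite ballEmdist.
Qed.

Lemma closed_embedding_dist_inv (z : set_type A) eps : 0 < eps ->
  exists2 d : R, 0 < d & forall z', mdist (set_val z) (set_val z') < d ->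
    mdist (i z) (i z') < eps.
Proof.
move=> e0; have [_ icont _ _] := ci.
have /icont/nbhs_ballP[d /= d0 dU] := near_mdist (i z) e0.
by exists d => // z' zz'; apply: dU; rewrite -initial_ballE /= ballEmdist.
Qed.

Lemma retract_range (g : Y -> M) : (forall y, A (g y)) ->
  (forall y eps, 0 < eps -> \forall y' \near y, mdist (g y) (g y') < eps) ->
  (forall z, g (i z) = set_val z) -> retract (range i).
Proof.
move=> Ag cg gi; have [_ icont _ _] := ci.
pose s y : set_type A := exist _ (g y) (mem_set (Ag y)).
exists (i \o s); split=> [y|y|_ [z _ <-]].
- apply: continuous_comp; last exact: icont.
  apply: continuous_comp_initial => {}y.
  apply/cvg_ballP => eps e0.
  by apply: filterS (cg y eps e0) => y'; rewrite ballEmdist.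
- by exists (s y).
- by rewrite /=; congr i; apply/val_inj; rewrite /= gi.
Qed.

End closed_embeddings.

Section Lp_classes.
Context {R : realType} {T p : R} {p1 : 1 <= p} {E : completeNormedModType R}.
Local Notation mu := (lebesgueR R).
Local Notation Leb := (lebR R).
Local Notation I := (`[0, T]%classic : set Leb).
Local Notation X := (Lp_vec 0 T p1 E).
Local Notation Lp := (Lp_space 0 T E p1).
Variable e : nat -> E.
Hypothesis e_dense : forall x eps, 0 < eps -> exists j, `|x - e j| < eps.
Variables (m : nat) (J : nat -> set Leb).
Hypotheses (mJ : forall i, measurable (J i)) (JI : forall i, J i `<=` I)
  (IJ : forall t, I t -> exists2 i, (i < m)%N & J i t).

Definition vec_class (x : X) : Lp := Lp_class 0 T p1 x.
Definition vec_repr (w : Lp) : X := Lp_vec_of p1 (Lp_reprP w).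

Let mI : measurable I := measurable_cc 0 T.

Lemma vec_reprK w : vec_class (vec_repr w) = w.
Proof. by apply: Lp_eq_class; [exact: Lp_reprP|exact: nearW]. Qed.

(** With [Lp_wnorm_vec_repr], passing to classes and choosing representatives are both Lipschitz, so
    continuity and closeness transfer between the quotient and the space of maps. *)
Lemma mdist_vec_class (x y : X) :
  mdist (vec_class x) (vec_class y) <= 2 ^+ m * Lp_wnorm m J (x - y).
Proof.
rewrite (Lp_mdistE (Lp_vecP x) (Lp_vecP y) (Lp_repr_class p1 (Lp_vecP x))
  (Lp_repr_class p1 (Lp_vecP y))).
rewrite -lee_fin; apply: le_trans (vnorm_Lp_wnorm e_dense mJ JI IJ (x - y)).
by rewrite -(fineK (vec_fin e_dense (x - y))).
Qed.

Lemma Lp_wnorm_vec_repr (v w : Lp) :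
  Lp_wnorm m J (vec_repr v - vec_repr w) <= 2 * mdist v w.
Proof.
apply: (Lp_wnorm_le e_dense m mJ JI).
by rewrite -(fineK (vec_fin e_dense _)).
Qed.

Lemma Lp_wnorm_vec_class (x : X) : Lp_wnorm m J (vec_repr (vec_class x) - x) = 0.
Proof.
apply: (ae_eq0_weighted_norm m p1 mI mJ JI).
  exact: (class_vec e_dense _).1.
apply: filterS (Lp_repr_class p1 (Lp_vecP x)) => t xt It.
by rewrite -[LHS]/(Lp_repr (vec_class x) t - x t) xt// subrr.
Qed.

End Lp_classes.

Theorem theorem8 (R : realType) (T p q : R) (T0 : 0 <= T)
    (p1 : 1 < p) (q1 : 1 < q) (pq : p^-1 + q^-1 = 1)
    (E : completeNormedModType R) (sepE : separable E)
    (F : R -> E -> set E)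
    (F_convex : forall (t : R) (x : E), t \in `[0, T] ->
       convex_set (F t x : set (convex_lmodType E)))
    (H1 : forall (t : R) (x : E), t \in `[0, T] ->
       [/\ F t x !=set0, closed (F t x) & bounded_set (F t x)])
    (H2 : forall (x : E) (C : set E), open C ->
       measurable ([set t | t \in `[0, T] /\ F t x `<=` C] : set (lebR R)))
    (H3 : exists2 alpha : R -> R, Lp_fun `[0, T]%classic p alpha &
       {ae lebesgueR R, forall t, t \in `[0, T] -> forall x y : E,
          (hausdorff_dist (F t x) (F t y) <= (alpha t * `|x - y|)%:E)%E})
    (H4 : exists2 beta : R -> R, Lp_fun `[0, T]%classic p beta &
       {ae lebesgueR R, forall t, t \in `[0, T] ->
          (dist_set 0%R (F t 0%R) <= (beta t)%:E)%E})
    (k : R -> R -> endoL E)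
    (k5 : forall t : R, t \in `[0, T] -> Lp_fun `[0, t]%classic q (k t))
    (k6 : {within `[0, T], continuous
       (fun t : R => Lp_class 0 T (ltW q1) (kernel_ext k t))})
    (h : R -> E) (hC : {within `[0, T], continuous h}) :
  absolute_retract (solution_set T (ltW p1) F k h).
Proof.
have [e [e0 e_dense]] := separable_dense_sequence sepE.
have [al Lal [N1 [mN1 N10 F_lip1]]] := H3.
have [be Lbe [N2 [mN2 N20 F_be2]]] := H4.
pose I := `[0, T]%classic : set (lebR R).
(* A measurable null set outside which the Lipschitz and the growth condition hold at once. *)
pose N := N1 `|` N2.
have mI : measurable I := measurable_cc 0 T.
have muI : (lebesgueR R I < +oo)%E := finite_measure_cc 0 T.
have mN : measurable N := measurableU _ _ mN1 mN2.
have N0 : lebesgueR R N = 0%E by exact: null_set_setU.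
have F_lip t : I t -> ~ N t -> forall x y : E,
    (hausdorff_dist (F t x) (F t y) <= (al t * `|x - y|)%:E)%E.
  move=> It Nt; have : ~ N1 t by move=> N1t; apply: Nt; left.
  by move=> N1t; apply: contrapT => P; apply: N1t; apply: F_lip1 => /(_ It).
have F_be t : I t -> ~ N t -> (dist_set 0%R (F t 0%R) <= (be t)%:E)%E.
  move=> It Nt; have : ~ N2 t by move=> N2t; apply: Nt; right.
  by move=> N2t; apply: contrapT => P; apply: N2t; apply: F_be2 => /(_ It).
have F0 t x : I t -> F t x !=set0 by move=> It; have [] := H1 t x It.
have F_closed t x : I t -> closed (F t x) by move=> It; have [] := H1 t x It.
have Lcal : lebesgue_class (lebesgueR R) p I (al : lebR R -> R).
  by split; [exact: strongly_measurable_norm mI Lal.1|exact: Lal.2].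
have Lcbe : lebesgue_class (lebesgueR R) p I (be : lebR R -> R).
  by split; [exact: strongly_measurable_norm mI Lbe.1|exact: Lbe.2].
have [C C0 kC] := kernel_bounded T0 k5 k6.
(* This makes [2 * eta * C = C / (8 * (C + 1))], at most [8^-1]; the added 1 covers [C = 0]. *)
pose eta := (16 * (C + 1))^-1.
have eta0 : 0 < eta by rewrite invr_gt0 mulr_gt0// ltr_wpDl.
have Ceta : 2 * eta * C <= 8^-1.
  have C1 : 0 < 16 * (C + 1) by rewrite mulr_gt0// ltr_wpDl.
  rewrite /eta mulrAC ler_pdivrMr//; clear - C0; lra.
have [m [J [mJ JI IJ Jc Jeta]]] := small_pieces T0 (ltW p1) Lal eta0.
have LL u := vclass_Lp_fun T p e_dense u.
pose Phi := state k h.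
have Phi_meas u : vclass (lebesgueR R) p I u -> vmeasurable I (Phi u).
  by move=> /LL; exact: (state_measurable p1 pq e0 e_dense k5 k6 hC).
have Phi_bdd u : vclass (lebesgueR R) p I u -> exists M, forall t, I t -> `|Phi u t| <= M.
  by move=> /LL; exact: (state_bounded T0 p1 pq e0 e_dense k5 k6 hC).
have Phi_causal u u' : vclass (lebesgueR R) p I u -> vclass (lebesgueR R) p I u' ->
    forall i t, J i t -> `|Phi u t - Phi u' t| <=
    C * \sum_(j < i.+1) piece_norm (lebesgueR R) p J j (fun t => u t - u' t).
  move=> /LL Lu /LL Lu'.
  exact: (state_causal p1 q1 pq e0 e_dense k5 h C0 kC mJ JI Jc Lu Lu').
pose X := Lp_vec 0 T (ltW p1) E.
pose rho (x v : X) := total_defect (lebesgueR R) p m J N F Phi x v.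
have LX := @vclass_vec R T p (ltW p1) E e e_dense.
have rho_lip (x v x' v' : X) : rho x v <=
    rho x' v' + Lp_wnorm m J (v - v') + 8^-1 * Lp_wnorm m J (x - x').
  exact: (total_defect_lip e_dense m (ltW p1) mI muI mJ JI mN F0 H2 F_lip F_be Lcal Lcbe
    C0 (ltW eta0) Phi_meas Phi_bdd Phi_causal Jeta Ceta).
have rho_convex (x : X) (a : R) (v w : X) : 0 <= a <= 1 ->
    rho x (a *: v + (1 - a) *: w) <= a * rho x v + (1 - a) * rho x w.
  move=> a01.
  exact: (total_defect_convex e_dense m (ltW p1) mI muI mJ JI mN F0 F_convex H2 F_lip F_be
    Lcal Lcbe Phi_meas Phi_bdd (LX x) (LX v) (LX w) a01 (LX (a *: v + (1 - a) *: w))).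
have rho_sel (x : X) : 0 < rho x x ->
    exists2 v, rho x v < rho x x / 2 & Lp_wnorm m J (v - x) < 2 * rho x x.
  move=> /(total_defect_select e_dense (ltW p1) mI muI mJ JI mN F0 H2 F_lip F_be Lcal Lcbe
    Phi_meas Phi_bdd (LX x))[v /LL Lv [xv vx]].
  by exists (Lp_vec_of (ltW p1) Lv).
have rho_eq0 (x : X) : rho x x = 0 <->
    {ae lebesgueR R, forall t, I t -> F t (Phi x t) (x t)}.
  exact: (total_defect_eq0 e_dense (ltW p1) mI muI mJ JI IJ mN N0 F0 F_closed H2 F_lip F_be
    Lcal Lcbe Phi_meas Phi_bdd (LX x)).
(* The map underlying [vec_repr w] is [Lp_repr w], the one in the definition of the solution set, so
   this is [rho_eq0] up to conversion. *)
have solutionP w : solution_set T (ltW p1) F k h w <-> rho (vec_repr w) (vec_repr w) = 0.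
  exact: iff_sym (rho_eq0 (vec_repr w)).
(* The chosen representative of the class of [x] is at seminorm 0 from [x], and by [rho_lip] zeros
   of [rho] are insensitive to such changes. *)
have solution_class (x : X) : rho x x = 0 -> solution_set T (ltW p1) F k h (vec_class x).
  move=> x0; apply/solutionP/eqP; rewrite eq_le total_defect_ge0 andbT.
  have := rho_lip (vec_repr (vec_class x)) (vec_repr (vec_class x)) x x.
  by rewrite x0 (Lp_wnorm_vec_class e_dense m mJ JI) mulr0 !addr0.
have sN := Lp_wnorm_seminorm (ltW p1) e_dense m mJ JI.
have [g g_dense] := Lp_vec_separable (ltW p1) e0 e_dense m mJ JI.
have q0 : 0 < q := lt_trans ltr01 q1.
move=> Y i ci; have [_ _ _ i_closed] := ci.
have i_near z eps : 0 < eps -> exists2 d : R, 0 < d &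
    forall z', mdist (i z) (i z') < d ->
    Lp_wnorm m J (vec_repr (set_val z') - vec_repr (set_val z)) < eps.
  move=> eps0; have eps2 : 0 < eps / 2 by rewrite divr_gt0.
  have [d d0 dP] := closed_embedding_dist ci z eps2.
  exists d => // z' /dP zz'.
  apply: le_lt_trans (Lp_wnorm_vec_repr e_dense m mJ JI (set_val z') (set_val z)) _.
  by rewrite metric_sym mulrC -ltr_pdivlMr.
(* Together with [i_near]: the embedding [i] and the representatives in the weighted seminorm define
   the same topology on the solution set. *)
have near_i z eps : 0 < eps -> exists2 d : R, 0 < d &
    forall z', Lp_wnorm m J (vec_repr (set_val z') - vec_repr (set_val z)) < d ->
    mdist (i z) (i z') < eps.
  move=> eps0; have [d d0 dP] := closed_embedding_dist_inv ci z eps0.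
  exists (d / 2 ^+ m) => [|z' zz']; first by rewrite divr_gt0// exprn_gt0.
  apply: dP; rewrite metric_sym -[set_val z']vec_reprK -[set_val z]vec_reprK.
  apply: le_lt_trans (mdist_vec_class e_dense mJ JI IJ _ _) _.
  by rewrite mulrC -ltr_pdivlMr// exprn_gt0.
have rho_i (z : set_type (solution_set T (ltW p1) F k h)) :
    rho (vec_repr (set_val z)) (vec_repr (set_val z)) = 0.
  by apply/solutionP; rewrite set_valE; exact: set_valP.
have [f [f_cont f_rho fi]] := fixed_point_absolute_extensor sN g_dense
  (fun v C a => @Lp_vec_complete R T p (ltW p1) E e e_dense m J mJ JI IJ q q0 pq v C a)
  (fun x v => total_defect_ge0 (lebesgueR R) p m J N F Phi x v) rho_lip rho_convex rho_sel
  i_closed i_near near_i rho_i.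
apply: (retract_range ci (g := fun y => vec_class (f y))) => [y|y eps eps0|z].
- exact: solution_class (f_rho y).
- have eps2 : 0 < eps / 2 ^+ m by rewrite divr_gt0// exprn_gt0.
  apply: filterS (f_cont y _ eps2) => y' yy'; rewrite metric_sym.
  apply: le_lt_trans (mdist_vec_class e_dense mJ JI IJ _ _) _.
  by rewrite mulrC -ltr_pdivlMr// exprn_gt0.
(* [f (i z)] and the representative of [z] are only at seminorm 0; in the quotient this becomes
   equality. *)
- rewrite -[RHS]vec_reprK; apply: mdist_positivity; apply/eqP.
  rewrite eq_le mdist_ge0 andbT.
  apply: le_trans (mdist_vec_class e_dense mJ JI IJ _ _) _.
  by rewrite fi mulr0.
Qed.
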